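(* Let $K$ be a field of characteristic zero, let $Usl(2)$ be the universal enveloping algebra of the Lie algebra $sl(2)$ over $K$, let $Q(Usl(2))$ be its division ring of fractions, and let $C$ be the Casimir element. (1) The universal enveloping algebra $Usl(2)$ and its division ring $Q(Usl(2))$ satisfy the commutative centralizer condition, and the centre $Z(Q(Usl(2)))=K(C)$. (2) The universal enveloping algebra $Usl(2)$, and any noncommutative subalgebra $A$ of the division ring $Q(Usl(2))$ with Gelfand-Kirillov dimension $\operatorname{GK}(A)<4$ and such that $A\cap K(C)\neq K$, admits the Dixmier partition and satisfies both the homogeneous centralizer condition and the commutative centralizer condition.
   Context: $Usl(2)=K\langle X,Y,H\mid[H,X]=X,\ [H,Y]=-Y,\ [X,Y]=2H\rangle$ and the Casimir element is $C=YX+H(H+1)$, which generates the centre: $Z(Usl(2))=K[C]$; $K(C)$ is its field of fractions. Let $\overline K$ be the algebraic closure of $K$. For a $K$-algebra $A$ with centre $Z(A)$, put $\overline A=\overline K\otimes_K A$ and identify $A$ with $1\otimes A$. For $a\in A$ let $\operatorname{ad} a: b\mapsto [a,b]=ab-ba$, and put $C(a)=\ker(\operatorname{ad} a)$ (the centralizer of $a$ in $A$); $N(a)=\bigcup_{i\ge0}\ker\big((\operatorname{ad} a)^{i+1}\big)\subseteq A$; $D(a)=A\cap\bigoplus_{\lambda\in\overline K}\{b\in\overline A:[a,b]=\lambda b\}$; $F(a)=\{b\in A:\dim_K K[\operatorname{ad} a]\,b<\infty\}$. Types of elements $a\in A\setminus Z(A)$: $a\in\Delta_1(A)$ (strongly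 nilpotent) if $N(a)=A$ and $D(a)=C(a)$; $a\in\Delta_2(A)$ (weakly nilpotent) if $C(a)\ne N(a)\ne A$ and $D(a)=C(a)$; $a\in\Delta_3(A)$ (strongly semi-simple) if $N(a)=C(a)$ and $D(a)=A$; $a\in\Delta_4(A)$ (weakly semi-simple) if $N(a)=C(a)$ and $C(a)\ne D(a)=F(a)\ne A$; $a\in\Delta_5(A)$ (generic) if $N(a)=D(a)=C(a)$. $A$ admits the Dixmier partition if $A\setminus Z(A)=\Delta_1(A)\cup\cdots\cup\Delta_5(A)$. A noncommutative algebra satisfies the commutative centralizer condition if the centralizer of each of its non-central elements is a commutative algebra. A noncommutative algebra $A$ that admits the Dixmier partition satisfies the homogeneous centralizer condition if, for each $a\in A\setminus Z(A)$, the elements of $C(a)\setminus Z(A)$ are of exactly one of the following kinds: (1) all strongly nilpotent; (2) all weakly nilpotent; (3) all generic except for a subset $K^*a'+Z(A)$ of strongly semi-simple elements, for some $a'\in\Delta_3(A)$; (4) all generic except for a subset $K^*a'+Z(A)$ of weakly semi-simple elements, for some $a'\in\Delta_4(A)$; (5) all generic. Here $K^*=K\setminus\{0\}$. *)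

(* Defs.v *)
From HB Require Import structures.
From mathcomp Require Import all_boot all_order all_algebra.
From mathcomp Require Import all_classical all_reals all_analysis.
From mathcomp Require Import generic_quotient.

Set Implicit Arguments.
Unset Strict Implicit.
Unset Printing Implicit Defensive.

Import Order.TTheory GRing.Theory Num.Theory.
Local Open Scope classical_set_scope.
Local Open Scope ring_scope.

(******************************************************************************)
(*  Usl(2) = K<X, Y, H | [H,X] = X, [H,Y] = -Y, [X,Y] = 2H>: terms in X, Y, H *)
(*  and scalars, modulo the least congruence containing the laws of           *)
(*  associative unital K-algebras and the three defining relations.           *)
(*  Usl2_lift below is the corresponding universal property.                  *)
(******************************************************************************)

Section Usl2.
Variable K : fieldType.

Inductive usl2_term : Type :=
| TmX | TmY | TmH
| TmCst of K
| TmAdd of usl2_term & usl2_term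
| TmMul of usl2_term & usl2_term.

Inductive usl2_cong : usl2_term -> usl2_term -> Prop :=
| uc_refl t : usl2_cong t t
| uc_sym t u : usl2_cong t u -> usl2_cong u t
| uc_trans t u v : usl2_cong t u -> usl2_cong u v -> usl2_cong t v
| uc_add t t' u u' :
    usl2_cong t t' -> usl2_cong u u' -> usl2_cong (TmAdd t u) (TmAdd t' u')
| uc_mul t t' u u' :
    usl2_cong t t' -> usl2_cong u u' -> usl2_cong (TmMul t u) (TmMul t' u')
| uc_addA t u v : usl2_cong (TmAdd t (TmAdd u v)) (TmAdd (TmAdd t u) v)
| uc_addC t u : usl2_cong (TmAdd t u) (TmAdd u t)
| uc_add0 t : usl2_cong (TmAdd (TmCst 0) t) t
| uc_addN t : usl2_cong (TmAdd (TmMul (TmCst (- 1)) t) t) (TmCst 0)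
| uc_mulA t u v : usl2_cong (TmMul t (TmMul u v)) (TmMul (TmMul t u) v)
| uc_mul1 t : usl2_cong (TmMul (TmCst 1) t) t
| uc_mulDl t u v :
    usl2_cong (TmMul (TmAdd t u) v) (TmAdd (TmMul t v) (TmMul u v))
| uc_mulDr t u v :
    usl2_cong (TmMul t (TmAdd u v)) (TmAdd (TmMul t u) (TmMul t v))
| uc_cstD k l : usl2_cong (TmCst (k + l)) (TmAdd (TmCst k) (TmCst l))
| uc_cstM k l : usl2_cong (TmCst (k * l)) (TmMul (TmCst k) (TmCst l))
| uc_cstC k t : usl2_cong (TmMul (TmCst k) t) (TmMul t (TmCst k))
| uc_HX : usl2_cong (TmMul TmH TmX) (TmAdd (TmMul TmX TmH) TmX)
| uc_HY : usl2_cong (TmMul TmH TmY)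
                    (TmAdd (TmMul TmY TmH) (TmMul (TmCst (- 1)) TmY))
| uc_XY : usl2_cong (TmMul TmX TmY)
                    (TmAdd (TmMul TmY TmX) (TmMul (TmCst 2%:R) TmH)).

HB.instance Definition _ := gen_eqMixin usl2_term.
HB.instance Definition _ := gen_choiceMixin usl2_term.

Definition usl2_eqv (t u : usl2_term) : bool := `[< usl2_cong t u >].

Lemma usl2_eqv_refl : reflexive usl2_eqv.
Proof. by move=> t; apply/asboolP; exact: uc_refl. Qed.

Lemma usl2_eqv_sym : symmetric usl2_eqv.
Proof. by move=> t u; apply/asboolP/asboolP => /uc_sym. Qed.

Lemma usl2_eqv_trans : transitive usl2_eqv.
Proof.
by move=> u t v /asboolP tu /asboolP uv; apply/asboolP; exact: uc_trans tu uv.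
Qed.

Canonical usl2_equiv :=
  EquivRel usl2_eqv usl2_eqv_refl usl2_eqv_sym usl2_eqv_trans.

Definition Usl2 : Type := {eq_quot usl2_equiv}%qT.

HB.instance Definition _ := Choice.on Usl2.

Definition usl2_class (t : usl2_term) : Usl2 := (\pi_{eq_quot usl2_equiv} t)%qT.

Lemma usl2_classP t u : usl2_cong t u -> usl2_class t = usl2_class u.
Proof. by move=> tu; apply/eqmodP/asboolP. Qed.

Lemma usl2_class_inj t u : usl2_class t = usl2_class u -> usl2_cong t u.
Proof. by move=> /eqmodP/asboolP. Qed.

Lemma usl2_ind (P : Usl2 -> Prop) : (forall t, P (usl2_class t)) -> forall x, P x.
Proof. by move=> Pt; elim/quotW => t; exact: Pt. Qed.

Definition usl2_repr (x : Usl2) : usl2_term :=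
  repr (x : {eq_quot usl2_equiv}%qT).

Lemma usl2_reprK x : usl2_class (usl2_repr x) = x.
Proof. exact: reprK. Qed.

Lemma usl2_repr_cong t : usl2_cong (usl2_repr (usl2_class t)) t.
Proof. by apply: usl2_class_inj; rewrite usl2_reprK. Qed.

Fact usl2_key : unit. Proof. by []. Qed.
Definition usl2_add : Usl2 -> Usl2 -> Usl2 := locked_with usl2_key
  (fun x y => usl2_class (TmAdd (usl2_repr x) (usl2_repr y))).
Definition usl2_mul : Usl2 -> Usl2 -> Usl2 := locked_with usl2_key
  (fun x y => usl2_class (TmMul (usl2_repr x) (usl2_repr y))).
Definition usl2_cst (k : K) : Usl2 := usl2_class (TmCst k).
Definition usl2_opp (x : Usl2) : Usl2 := usl2_mul (usl2_cst (- 1)) x.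
Definition usl2_scale (k : K) (x : Usl2) : Usl2 := usl2_mul (usl2_cst k) x.

Lemma usl2_addE t u :
  usl2_add (usl2_class t) (usl2_class u) = usl2_class (TmAdd t u).
Proof.
rewrite /usl2_add unlock; apply: usl2_classP.
by apply: uc_add; exact: usl2_repr_cong. Qed.

Lemma usl2_mulE t u :
  usl2_mul (usl2_class t) (usl2_class u) = usl2_class (TmMul t u).
Proof.
rewrite /usl2_mul unlock; apply: usl2_classP.
by apply: uc_mul; exact: usl2_repr_cong. Qed.

Definition usl2E := (usl2_addE, usl2_mulE).

Lemma usl2_addA : associative usl2_add.
Proof.
elim/usl2_ind => t; elim/usl2_ind => u; elim/usl2_ind => v.
by rewrite !usl2E; apply: usl2_classP; exact: uc_addA.
Qed.

Lemma usl2_addC : commutative usl2_add.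
Proof.
elim/usl2_ind => t; elim/usl2_ind => u.
by rewrite !usl2E; apply: usl2_classP; exact: uc_addC.
Qed.

Lemma usl2_add0 : left_id (usl2_cst 0) usl2_add.
Proof.
by elim/usl2_ind => t; rewrite !usl2E; apply: usl2_classP; exact: uc_add0.
Qed.

Lemma usl2_addN : left_inverse (usl2_cst 0) usl2_opp usl2_add.
Proof.
by elim/usl2_ind => t; rewrite /usl2_opp !usl2E; apply: usl2_classP; exact: uc_addN.
Qed.

HB.instance Definition _ :=
  GRing.isZmodule.Build Usl2 usl2_addA usl2_addC usl2_add0 usl2_addN.

Lemma usl2_mulA : associative usl2_mul.
Proof.
elim/usl2_ind => t; elim/usl2_ind => u; elim/usl2_ind => v.
by rewrite !usl2E; apply: usl2_classP; exact: uc_mulA.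
Qed.

Lemma usl2_mul1 : left_id (usl2_cst 1) usl2_mul.
Proof.
by elim/usl2_ind => t; rewrite !usl2E; apply: usl2_classP; exact: uc_mul1.
Qed.

Lemma usl2_cstC k x : usl2_mul (usl2_cst k) x = usl2_mul x (usl2_cst k).
Proof.
by elim/usl2_ind: x => t; rewrite !usl2E; apply: usl2_classP; exact: uc_cstC.
Qed.

Lemma usl2_mulr1 : right_id (usl2_cst 1) usl2_mul.
Proof. by move=> x; rewrite -usl2_cstC usl2_mul1. Qed.

Lemma usl2_mulDl : left_distributive usl2_mul usl2_add.
Proof.
elim/usl2_ind => t; elim/usl2_ind => u; elim/usl2_ind => v.
by rewrite !usl2E; apply: usl2_classP; exact: uc_mulDl.
Qed.

Lemma usl2_mulDr : right_distributive usl2_mul usl2_add.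
Proof.
elim/usl2_ind => t; elim/usl2_ind => u; elim/usl2_ind => v.
by rewrite !usl2E; apply: usl2_classP; exact: uc_mulDr.
Qed.

(* Evaluation of a term; with B = K and x = y = h = 0 it is the augmentation,
   which shows that Usl2 is not the zero ring. *)
Fixpoint usl2_eval (B : pzRingType) (c : K -> B) (x y h : B) (t : usl2_term) : B :=
  match t with
  | TmX => x
  | TmY => y
  | TmH => h
  | TmCst k => c k
  | TmAdd t u => usl2_eval c x y h t + usl2_eval c x y h u
  | TmMul t u => usl2_eval c x y h t * usl2_eval c x y h u
  end.

Lemma usl2_eval_cong (B : pzRingType) (c : {rmorphism K -> B}) (x y h : B) :
  (forall k b, c k * b = b * c k) ->
  h * x - x * h = x -> h * y - y * h = - y -> x * y - y * x = h *+ 2 ->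
  forall t u, usl2_cong t u -> usl2_eval c x y h t = usl2_eval c x y h u.
Proof.
move=> cC hx hy xy t u; elim=> //=.
- by move=> t1 u1 v1 _ -> _ ->.
- by move=> t1 t2 u1 u2 _ -> _ ->.
- by move=> t1 t2 u1 u2 _ -> _ ->.
- by move=> *; rewrite addrA.
- by move=> *; rewrite addrC.
- by move=> *; rewrite rmorph0 add0r.
- by move=> *; rewrite rmorphN1 rmorph0 mulN1r addNr.
- by move=> *; rewrite mulrA.
- by move=> *; rewrite rmorph1 mul1r.
- by move=> *; rewrite mulrDl.
- by move=> *; rewrite mulrDr.
- by move=> *; rewrite rmorphD.
- by move=> *; rewrite rmorphM.
- by apply/eqP; rewrite addrC -subr_eq hx.
- by apply/eqP; rewrite rmorphN1 mulN1r addrC -subr_eq hy.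
- by apply/eqP; rewrite rmorph_nat mulr_natl addrC -subr_eq xy.
Qed.

Lemma usl2_1_neq0 : usl2_cst 1 != 0 :> Usl2.
Proof.
apply/eqP => /usl2_class_inj.
move/(@usl2_eval_cong K idfun 0 0 0) => /=.
rewrite mulr0 subr0 oppr0 mul0rn => /(_ (fun k b => mulrC _ _) erefl erefl erefl).
by move/eqP; rewrite oner_eq0.
Qed.

HB.instance Definition _ := GRing.Zmodule_isNzRing.Build Usl2
  usl2_mulA usl2_mul1 usl2_mulr1 usl2_mulDl usl2_mulDr usl2_1_neq0.

Lemma usl2_scaleA k l (x : Usl2) :
  usl2_scale k (usl2_scale l x) = usl2_scale (k * l) x.
Proof.
rewrite /usl2_scale usl2_mulA; congr usl2_mul.
by rewrite !usl2E; apply: usl2_classP; apply: uc_sym; exact: uc_cstM.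
Qed.

Lemma usl2_scale1 : left_id 1 usl2_scale.
Proof. exact: usl2_mul1. Qed.

Lemma usl2_scaleDr : right_distributive usl2_scale +%R.
Proof. by move=> k x y; exact: usl2_mulDr. Qed.

Lemma usl2_scaleDl (x : Usl2) : {morph usl2_scale^~ x : k l / k + l}.
Proof.
move=> k l; rewrite /usl2_scale -[RHS]usl2_mulDl; congr usl2_mul.
by rewrite !usl2E; apply: usl2_classP; exact: uc_cstD.
Qed.

HB.instance Definition _ := GRing.Zmodule_isLmodule.Build K Usl2
  usl2_scaleA usl2_scale1 usl2_scaleDr usl2_scaleDl.

Lemma usl2_scaleAl (k : K) (x y : Usl2) : k *: (x * y) = (k *: x) * y.
Proof. exact: usl2_mulA. Qed.

HB.instance Definition _ := GRing.Lmodule_isLalgebra.Build K Usl2 usl2_scaleAl.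

Lemma usl2_scaleAr (k : K) (x y : Usl2) : k *: (x * y) = x * (k *: y).
Proof.
by rewrite -[LHS]/(usl2_cst k * (x * y)) -[k *: y]/(usl2_cst k * y) mulrA
  [usl2_cst k * x]usl2_cstC mulrA.
Qed.

HB.instance Definition _ := GRing.Lalgebra_isAlgebra.Build K Usl2 usl2_scaleAr.

Definition usl2X : Usl2 := usl2_class TmX.
Definition usl2Y : Usl2 := usl2_class TmY.
Definition usl2H : Usl2 := usl2_class TmH.

Definition casimir : Usl2 := usl2Y * usl2X + usl2H * (usl2H + 1).

Lemma usl2_HX : usl2H * usl2X - usl2X * usl2H = usl2X.
Proof.
apply/eqP; rewrite subr_eq addrC; apply/eqP.
rewrite -[LHS]/(usl2_mul _ _) -[RHS]/(usl2_add (usl2_mul _ _) _) !usl2E.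
by apply: usl2_classP; exact: uc_HX.
Qed.

Lemma usl2_HY : usl2H * usl2Y - usl2Y * usl2H = - usl2Y.
Proof.
apply/eqP; rewrite subr_eq addrC; apply/eqP.
rewrite -[LHS]/(usl2_mul _ _) -[RHS]/(usl2_add (usl2_mul _ _) (usl2_mul _ _)).
by rewrite !usl2E; apply: usl2_classP; exact: uc_HY.
Qed.

Lemma usl2_XY : usl2X * usl2Y - usl2Y * usl2X = usl2H *+ 2.
Proof.
apply/eqP; rewrite subr_eq addrC; apply/eqP.
rewrite -scaler_nat.
rewrite -[LHS]/(usl2_mul _ _) -[RHS]/(usl2_add (usl2_mul _ _) (usl2_mul _ _)).
by rewrite !usl2E; apply: usl2_classP; exact: uc_XY.
Qed.

Lemma usl2_lift (B : algType K) (x y h : B) :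
  h * x - x * h = x -> h * y - y * h = - y -> x * y - y * x = h *+ 2 ->
  exists f : {lrmorphism Usl2 -> B},
    [/\ f usl2X = x, f usl2Y = y & f usl2H = h] /\
    forall g : {lrmorphism Usl2 -> B},
      g usl2X = x -> g usl2Y = y -> g usl2H = h -> g =1 f.
Proof.
move=> hx hy xy; pose c : {rmorphism K -> B} := GRing.in_alg B.
pose ev (q : Usl2) := usl2_eval c x y h (usl2_repr q).
have evE t : ev (usl2_class t) = usl2_eval c x y h t.
  apply: (usl2_eval_cong _ hx hy xy) (usl2_repr_cong t) => k b.
  by rewrite /= mulr_algl mulr_algr.
have evB : zmod_morphism ev.
  elim/usl2_ind => t; elim/usl2_ind => u.
  rewrite -[_ - _]/(usl2_add _ (usl2_mul _ _)) !usl2E !evE /=.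
  by rewrite scaleN1r mulN1r.
have evM : monoid_morphism ev.
  split; first by rewrite -[1]/(usl2_cst 1) evE /= scale1r.
  elim/usl2_ind => t; elim/usl2_ind => u.
  by rewrite -[_ * _]/(usl2_mul _ _) !usl2E !evE.
have evZ : scalable ev.
  move=> k; elim/usl2_ind => t.
  by rewrite -[k *: _]/(usl2_mul _ _) !usl2E !evE /= mulr_algl.
pose m1 := GRing.isZmodMorphism.Build _ _ ev evB.
pose m2 := GRing.isMonoidMorphism.Build _ _ ev evM.
pose m3 := GRing.isScalable.Build _ _ _ _ ev evZ.
pose F : {lrmorphism Usl2 -> B} := HB.pack ev m1 m2 m3.
exists F; split; first by split; exact: evE.
move=> g gX gY gH; elim/usl2_ind => t; rewrite [RHS]evE.
elim: t => //= [k|t <- u <-|t <- u <-].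
- rewrite -[1](rmorph1 g) -linearZ; apply: (congr1 g).
  exact: esym (usl2_mulr1 _).
- by rewrite -rmorphD; apply: (congr1 g); rewrite -[LHS]usl2_addE.
- by rewrite -rmorphM; apply: (congr1 g); rewrite -[LHS]usl2_mulE.
Qed.

End Usl2.

(******************************************************************************)
(*  L (x)_K A for a field extension iota : K -> L: finite formal sums of      *)
(*  pairs (l, a), modulo the least congruence making (l, a) |-> l (x) a       *)
(*  additive in each variable and K-balanced.                                 *)
(******************************************************************************)

Section BaseChange.
Variables (K L : fieldType) (iota : {rmorphism K -> L}) (A : algType K).

Inductive tens_cong : seq (L * A) -> seq (L * A) -> Prop :=
| tc_refl s : tens_cong s s
| tc_sym s t : tens_cong s t -> tens_cong t s
| tc_trans s t u : tens_cong s t -> tens_cong t u -> tens_cong s u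
| tc_cat s s' t t' :
    tens_cong s s' -> tens_cong t t' -> tens_cong (s ++ t) (s' ++ t')
| tc_catC s t : tens_cong (s ++ t) (t ++ s)
| tc_0 a : tens_cong [:: (0, a)] [::]
| tc_Dl l l' a : tens_cong [:: (l + l', a)] [:: (l, a); (l', a)]
| tc_Dr l a a' : tens_cong [:: (l, a + a')] [:: (l, a); (l, a')]
| tc_bal l k a : tens_cong [:: (l * iota k, a)] [:: (l, k *: a)].

Definition tens_eqv (s t : seq (L * A)) : bool := `[< tens_cong s t >].

Lemma tens_eqv_refl : reflexive tens_eqv.
Proof. by move=> t; apply/asboolP; exact: tc_refl. Qed.

Lemma tens_eqv_sym : symmetric tens_eqv.
Proof. by move=> t u; apply/asboolP/asboolP => /tc_sym. Qed.

Lemma tens_eqv_trans : transitive tens_eqv.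
Proof.
by move=> u t v /asboolP tu /asboolP uv; apply/asboolP; exact: tc_trans tu uv.
Qed.

Canonical tens_equiv :=
  EquivRel tens_eqv tens_eqv_refl tens_eqv_sym tens_eqv_trans.

Definition base_change : Type := {eq_quot tens_equiv}%qT.

HB.instance Definition _ := Choice.on base_change.

Definition tens_class (s : seq (L * A)) : base_change :=
  (\pi_{eq_quot tens_equiv} s)%qT.

Lemma tens_classP s t : tens_cong s t -> tens_class s = tens_class t.
Proof. by move=> st; apply/eqmodP/asboolP. Qed.

Lemma tens_class_inj s t : tens_class s = tens_class t -> tens_cong s t.
Proof. by move=> /eqmodP/asboolP. Qed.

Lemma tens_quotW (P : base_change -> Prop) :
  (forall s, P (tens_class s)) -> forall x, P x.
Proof. by move=> Pt; elim/quotW => t; exact: Pt. Qed.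

Definition tens_repr (x : base_change) : seq (L * A) :=
  repr (x : {eq_quot tens_equiv}%qT).

Lemma tens_reprK x : tens_class (tens_repr x) = x.
Proof. exact: reprK. Qed.

Lemma tens_repr_cong s : tens_cong (tens_repr (tens_class s)) s.
Proof. by apply: tens_class_inj; rewrite tens_reprK. Qed.

Fact tens_key : unit. Proof. by []. Qed.
Definition tens_add : base_change -> base_change -> base_change :=
  locked_with tens_key (fun x y => tens_class (tens_repr x ++ tens_repr y)).
Definition tens_opp : base_change -> base_change :=
  locked_with tens_key
    (fun x => tens_class [seq (- p.1, p.2) | p <- tens_repr x]).

Lemma tens_addE s t : tens_add (tens_class s) (tens_class t) = tens_class (s ++ t).
Proof.
rewrite /tens_add unlock; apply: tens_classP.
by apply: tc_cat; exact: tens_repr_cong.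
Qed.

Lemma tens_addA : associative tens_add.
Proof.
elim/tens_quotW => s; elim/tens_quotW => t; elim/tens_quotW => u.
by rewrite !tens_addE catA.
Qed.

Lemma tens_addC : commutative tens_add.
Proof.
elim/tens_quotW => s; elim/tens_quotW => t.
by rewrite !tens_addE; apply: tens_classP; exact: tc_catC.
Qed.

Lemma tens_add0 : left_id (tens_class [::]) tens_add.
Proof. by elim/tens_quotW => s; rewrite tens_addE. Qed.

Lemma tens_addN : left_inverse (tens_class [::]) tens_opp tens_add.
Proof.
move=> x; rewrite /tens_opp unlock -{2}[x]tens_reprK tens_addE.
apply: tens_classP; elim: (tens_repr x) => [|[l a] s IHs] /=.
  exact: tc_refl.
have -> : (- l, a) :: [seq (- p.1, p.2) | p <- s] ++ (l, a) :: s =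
  [:: (- l, a)] ++ (([seq (- p.1, p.2) | p <- s] ++ [:: (l, a)]) ++ s).
  by rewrite -catA.
apply: (@tc_trans _ ([:: (- l, a)] ++
  (([:: (l, a)] ++ [seq (- p.1, p.2) | p <- s]) ++ s))).
  apply: tc_cat; first exact: tc_refl.
  by apply: tc_cat; [exact: tc_catC | exact: tc_refl].
rewrite -(catA [:: (l, a)]) (catA [:: (- l, a)]) -[X in tens_cong _ X]/([::] ++ [::]).
apply: tc_cat; last exact: IHs.
apply: tc_trans (tc_sym (tc_Dl _ _ _)) _.
by rewrite addNr; exact: tc_0.
Qed.

HB.instance Definition _ :=
  GRing.isZmodule.Build base_change tens_addA tens_addC tens_add0 tens_addN.

Definition tens (l : L) (a : A) : base_change := tens_class [:: (l, a)].

Lemma tens_classE s : tens_class s = \sum_(p <- s) tens p.1 p.2.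
Proof.
elim: s => [|[l a] s IHs]; first by rewrite big_nil.
by rewrite big_cons -IHs -[RHS]/(tens_add (tens_class _) _) tens_addE.
Qed.

Lemma tensDl l l' a : tens (l + l') a = tens l a + tens l' a.
Proof.
rewrite -[RHS]/(tens_add (tens_class _) (tens_class _)) tens_addE.
by apply: tens_classP; exact: tc_Dl. Qed.

Lemma tensDr l a a' : tens l (a + a') = tens l a + tens l a'.
Proof.
rewrite -[RHS]/(tens_add (tens_class _) (tens_class _)) tens_addE.
by apply: tens_classP; exact: tc_Dr. Qed.

Lemma tens_bal l k a : tens (l * iota k) a = tens l (k *: a).
Proof. by apply: tens_classP; exact: tc_bal. Qed.

Definition balanced (V : zmodType) (f : L -> A -> V) : Prop :=
  [/\ forall l l' a, f (l + l') a = f l a + f l' a,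
      forall l a a', f l (a + a') = f l a + f l a' &
      forall l k a, f (l * iota k) a = f l (k *: a)].

Definition tens_lift (V : zmodType) (f : L -> A -> V) (x : base_change) : V :=
  \sum_(p <- tens_repr x) f p.1 p.2.

Lemma tens_liftE (V : zmodType) (f : L -> A -> V) s : balanced f ->
  tens_lift f (tens_class s) = \sum_(p <- s) f p.1 p.2.
Proof.
case=> fDl fDr fb; rewrite /tens_lift.
suff fE t u : tens_cong t u ->
  \sum_(p <- t) f p.1 p.2 = \sum_(p <- u) f p.1 p.2.
  exact: fE (tens_repr_cong s).
elim=> {s t u} // [s t u _ -> _ ->|s s' t t' _ IHs _ IHt
  |s t|a|l l' a|l a a'|l k a] //.
- by rewrite !big_cat /= IHs IHt.
- by rewrite !big_cat /= addrC.
- rewrite big_seq1 big_nil /=.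
  by apply: (addrI (f 0 a)); rewrite -fDl !addr0.
- by rewrite big_seq1 !big_cons big_nil addr0 fDl.
- by rewrite big_seq1 !big_cons big_nil addr0 fDr.
- by rewrite !big_seq1 fb.
Qed.

Lemma tens_lift_tens (V : zmodType) (f : L -> A -> V) l a : balanced f ->
  tens_lift f (tens l a) = f l a.
Proof. by move=> fb; rewrite tens_liftE // big_seq1. Qed.

Lemma tens_liftD (V : zmodType) (f : L -> A -> V) : balanced f ->
  {morph tens_lift f : x y / x + y}.
Proof.
move=> fb; elim/tens_quotW => s; elim/tens_quotW => t.
by rewrite -[_ + _ in LHS]/(tens_add _ _) tens_addE !tens_liftE // big_cat.
Qed.

Lemma tens_ind (P : base_change -> Prop) :
  P 0 -> (forall l a x, P x -> P (tens l a + x)) -> forall x, P x.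
Proof.
move=> P0 PD; elim/tens_quotW => s; rewrite tens_classE.
elim: s => [|p s IHs]; first by rewrite big_nil.
by rewrite big_cons; exact: PD.
Qed.

Lemma tens_lift0 (V : zmodType) (f : L -> A -> V) : balanced f ->
  tens_lift f 0 = 0.
Proof. by move=> fb; rewrite -[0]/(tens_class [::]) tens_liftE // big_nil. Qed.

Definition tens_scale (l : L) : base_change -> base_change :=
  tens_lift (fun l' a => tens (l * l') a).

Lemma tens_scale_balanced l : balanced (fun l' a => tens (l * l') a).
Proof.
split=> *; first by rewrite mulrDr tensDl.
  by rewrite tensDr.
by rewrite mulrA tens_bal.
Qed.

Lemma tens_scaleE l l' a : tens_scale l (tens l' a) = tens (l * l') a.
Proof. by apply: tens_lift_tens; exact: tens_scale_balanced. Qed.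

Lemma tens_scaleDr : right_distributive tens_scale +%R.
Proof. by move=> l; apply: tens_liftD; exact: tens_scale_balanced. Qed.

Lemma tens_scale0 l : tens_scale l 0 = 0.
Proof. by apply: tens_lift0; exact: tens_scale_balanced. Qed.

Lemma tens_scaleA k l x : tens_scale k (tens_scale l x) = tens_scale (k * l) x.
Proof.
elim/tens_ind: x => [|m a x IHx]; first by rewrite !tens_scale0.
by rewrite !tens_scaleDr IHx !tens_scaleE mulrA.
Qed.

Lemma tens_scale1 : left_id 1 tens_scale.
Proof.
elim/tens_ind => [|m a x IHx]; first by rewrite tens_scale0.
by rewrite tens_scaleDr IHx tens_scaleE mul1r.
Qed.

Lemma tens_scaleDl x : {morph tens_scale^~ x : k l / k + l}.
Proof.
move=> k l; elim/tens_ind: x => [|m a x IHx] /=.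
  by rewrite !tens_scale0 addr0.
by rewrite !tens_scaleDr IHx !tens_scaleE mulrDl tensDl addrACA.
Qed.

HB.instance Definition _ := GRing.Zmodule_isLmodule.Build L base_change
  tens_scaleA tens_scale1 tens_scaleDr tens_scaleDl.

Definition tens_lmul (l : L) (a : A) : base_change -> base_change :=
  tens_lift (fun l' a' => tens (l * l') (a * a')).

Lemma tens_lmul_balanced l a : balanced (fun l' a' => tens (l * l') (a * a')).
Proof.
split=> *; first by rewrite mulrDr tensDl.
  by rewrite mulrDr tensDr.
by rewrite mulrA tens_bal scalerAr.
Qed.

Lemma tens_lmulE l a l' a' : tens_lmul l a (tens l' a') = tens (l * l') (a * a').
Proof. by apply: tens_lift_tens; exact: tens_lmul_balanced. Qed.

Lemma tens_lmulD l a : {morph tens_lmul l a : x y / x + y}.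
Proof. by apply: tens_liftD; exact: tens_lmul_balanced. Qed.

Lemma tens_lmul0 l a : tens_lmul l a 0 = 0.
Proof. by apply: tens_lift0; exact: tens_lmul_balanced. Qed.

Definition tens_mul (x y : base_change) : base_change :=
  tens_lift (fun l a => tens_lmul l a y) x.

Lemma tens_mul_balanced y : balanced (fun l a => tens_lmul l a y).
Proof.
split=> *; elim/tens_ind: y => [|m b y IHy]; rewrite ?tens_lmul0 ?addr0 //;
  rewrite !tens_lmulD IHy !tens_lmulE.
- by rewrite mulrDl tensDl addrACA.
- by rewrite mulrDl tensDr addrACA.
- by rewrite -scalerAl -tens_bal mulrAC.
Qed.

Lemma tens_mulE l a l' a' :
  tens_mul (tens l a) (tens l' a') = tens (l * l') (a * a').
Proof.
by rewrite /tens_mul tens_lift_tens ?tens_lmulE//; exact: tens_mul_balanced.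
Qed.

Lemma tens_mulDl : left_distributive tens_mul +%R.
Proof. by move=> x y z; apply: tens_liftD; exact: tens_mul_balanced. Qed.

Lemma tens_mul0l y : tens_mul 0 y = 0.
Proof. by apply: tens_lift0; exact: tens_mul_balanced. Qed.

Lemma tens_mul_lmul l a y : tens_mul (tens l a) y = tens_lmul l a y.
Proof. by apply: tens_lift_tens; exact: tens_mul_balanced. Qed.

Lemma tens_mulDr : right_distributive tens_mul +%R.
Proof.
elim/tens_ind => [|l a x IHx] y z; first by rewrite !tens_mul0l addr0.
by rewrite !tens_mulDl IHx !tens_mul_lmul tens_lmulD addrACA.
Qed.

Lemma tens_mul0r x : tens_mul x 0 = 0.
Proof. by apply: (addrI (tens_mul x 0)); rewrite -tens_mulDr !addr0. Qed.

Lemma tens_mulA : associative tens_mul.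
Proof.
elim/tens_ind => [|l a x IHx] y z; first by rewrite !tens_mul0l.
rewrite !tens_mulDl IHx; congr (_ + _).
elim/tens_ind: y => [|l' a' y IHy]; first by rewrite tens_mul0r !tens_mul0l tens_mul0r.
rewrite tens_mulDl !tens_mulDr tens_mulDl IHy; congr (_ + _).
elim/tens_ind: z {IHx IHy} => [|l'' a'' z IHz]; first by rewrite !tens_mul0r.
by rewrite !tens_mulDr IHz !tens_mulE !mulrA.
Qed.

Lemma tens_mul1l : left_id (tens 1 1) tens_mul.
Proof.
elim/tens_ind => [|l a x IHx]; first by rewrite tens_mul0r.
by rewrite tens_mulDr IHx tens_mulE !mul1r.
Qed.

Lemma tens_mul1r : right_id (tens 1 1) tens_mul.
Proof.
elim/tens_ind => [|l a x IHx]; first by rewrite tens_mul0l.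
by rewrite tens_mulDl IHx tens_mulE !mulr1.
Qed.

HB.instance Definition _ := GRing.Zmodule_isPzRing.Build base_change
  tens_mulA tens_mul1l tens_mul1r tens_mulDl tens_mulDr.

Lemma tens_scaleAl (l : L) (x y : base_change) : l *: (x * y) = (l *: x) * y.
Proof.
elim/tens_ind: x => [|m a x IHx]; first by rewrite mul0r scaler0 mul0r.
rewrite scalerDr mulrDl [RHS]mulrDl scalerDr IHx; congr (_ + _).
elim/tens_ind: y {IHx} => [|m' a' y IHy]; first by rewrite !mulr0 scaler0.
rewrite !mulrDr scalerDr IHy; congr (_ + _).
rewrite -[tens m a * _]/(tens_mul _ _) tens_mulE.
by rewrite -[LHS]/(tens_scale _ _) -[RHS]/(tens_mul (tens_scale _ _) _)
  !tens_scaleE tens_mulE mulrA.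
Qed.

Lemma tens_scaleAr (l : L) (x y : base_change) : l *: (x * y) = x * (l *: y).
Proof.
elim/tens_ind: x => [|m a x IHx]; first by rewrite !mul0r scaler0.
rewrite mulrDl [RHS]mulrDl scalerDr IHx; congr (_ + _).
elim/tens_ind: y {IHx} => [|m' a' y IHy]; first by rewrite scaler0 !mulr0 scaler0.
rewrite scalerDr !mulrDr scalerDr IHy; congr (_ + _).
rewrite -[tens m a * _]/(tens_mul _ _) tens_mulE.
by rewrite -[LHS]/(tens_scale _ _) -[RHS]/(tens_mul _ (tens_scale _ _))
  !tens_scaleE tens_mulE mulrCA.
Qed.

End BaseChange.
Arguments base_change {K L} iota A.
Arguments tens {K L iota A} l a.

Section Subalgebra.
Variables (K : fieldType) (Q : algType K) (S : subalgClosed Q).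

Record subalg := Subalg { subalg_val : Q; subalg_valP : subalg_val \in S }.

HB.instance Definition _ := [isSub for subalg_val].
HB.instance Definition _ := [Choice of subalg by <:].
HB.instance Definition _ := [SubChoice_isSubAlgebra of subalg by <:].

End Subalgebra.

Definition algebraic_closure (K : fieldType) (Kbar : closedFieldType)
    (iota : {rmorphism K -> Kbar}) : Prop :=
  forall z, algebraicOver iota z.

Definition division_ring_of_fractions (K : fieldType) (U : algType K)
    (Q : unitAlgType K) (j : {lrmorphism U -> Q}) : Prop :=
  [/\ injective j,
      forall q : Q, q != 0 -> q \is a GRing.unit,
      forall q : Q, exists a s : U, s != 0 /\ q = (j s)^-1 * j a &
      forall q : Q, exists a s : U, s != 0 /\ q = j a * (j s)^-1].

(* K(C) inside Q. *)
Definition casimir_fractions (K : fieldType) (Q : unitAlgType K)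
    (j : {lrmorphism Usl2 K -> Q}) : set Q :=
  [set q | exists p r : {poly K}, horner_alg (casimir K) r != 0 /\
     q = j (horner_alg (casimir K) p) / j (horner_alg (casimir K) r)].

(******************************************************************************)
(*  Gelfand-Kirillov dimension: sup over the finite-dimensional subspaces     *)
(*  V = K1 + <s> of limsup_n log (dim V^n) / log n (the terms n = 0, 1, where *)
(*  ln n = 0 and the quotient is 0 by convention, do not affect the limsup).  *)
(******************************************************************************)

Section GKdim.
Variable K : fieldType.

Definition lin_indep (V : lmodType K) (I : finType) (v : I -> V) (J : {set I}) :
  Prop :=
  forall c : I -> K, \sum_(i in J) c i *: v i = 0 -> forall i, i \in J -> c i = 0.

Definition span_dim (V : lmodType K) (s : seq V) : nat :=
  \max_(J : {set 'I_(size s)} | `[< lin_indep (fun i : 'I_(size s) => s`_i) J >]) #|J|.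

(* All products x_1 * .. * x_n of n elements of s. *)
Fixpoint products (A : algType K) (s : seq A) (n : nat) : seq A :=
  if n is m.+1 then [seq x * y | x <- s, y <- products s m] else [:: 1].

Definition GKdim (R : realType) (A : algType K) : \bar R :=
  ereal_sup [set limn_esup (fun n : nat =>
    (ln (span_dim (products (1 :: s) n))%:R / ln n%:R : R)%:E) | s in [set: seq A]].

End GKdim.

Section DixmierTypes.
Variables (K : fieldType) (L : fieldType) (iota : {rmorphism K -> L}).
Variable A : algType K.
Implicit Types a b : A.

Definition noncommutative : Prop := ~ commutative (@GRing.mul A).

Definition alg_center : set A := [set z | forall x, z * x = x * z].

Definition ad (B : pzRingType) (a b : B) : B := a * b - b * a.

Definition centralizer a : set A := [set b | ad a b = 0].

Definition nil_part a : set A := [set b | exists i, iter i.+1 (ad a) b = 0].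

(* The sum of the eigenspaces of ad a on L (x) A is automatically direct. *)
Definition ss_part a : set A :=
  [set b | exists s : seq (L * base_change iota A),
    (forall p, p \in s -> ad (tens 1 a) p.2 = p.1 *: p.2) /\
    tens 1 b = \sum_(p <- s) p.2].

Definition fin_dim (W : set A) : Prop :=
  exists s : seq A, forall w, W w ->
    exists c : 'I_(size s) -> K, w = \sum_i c i *: s`_i.

(* K[ad a] b *)
Definition ad_orbit a b : set A :=
  [set w | exists p : {poly K}, w = \sum_(i < size p) p`_i *: iter i (ad a) b].

Definition locfin_part a : set A := [set b | fin_dim (ad_orbit a b)].

Definition strongly_nilpotent a : Prop :=
  [/\ ~ alg_center a, nil_part a = setT & ss_part a = centralizer a].

Definition weakly_nilpotent a : Prop :=
  [/\ ~ alg_center a, centralizer a <> nil_part a, nil_part a <> setT &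
      ss_part a = centralizer a].

Definition strongly_semisimple a : Prop :=
  [/\ ~ alg_center a, nil_part a = centralizer a & ss_part a = setT].

Definition weakly_semisimple a : Prop :=
  [/\ ~ alg_center a, nil_part a = centralizer a, centralizer a <> ss_part a,
      ss_part a = locfin_part a & locfin_part a <> setT].

Definition generic a : Prop :=
  [/\ ~ alg_center a, nil_part a = ss_part a & ss_part a = centralizer a].

Definition dixmier_partition : Prop :=
  ~` alg_center = [set a | strongly_nilpotent a] `|` [set a | weakly_nilpotent a] `|`
    [set a | strongly_semisimple a] `|` [set a | weakly_semisimple a] `|`
    [set a | generic a].

Definition commutative_centralizers : Prop :=
  noncommutative /\
  forall a, ~ alg_center a -> forall b c, centralizer a b -> centralizer a c ->
    b * c = c * b.

Variant centralizer_kind : Type :=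
| AllStronglyNilpotent
| AllWeaklyNilpotent
| GenericOrStronglySemisimple
| GenericOrWeaklySemisimple
| AllGeneric.

(* K^* a + Z(A) *)
Definition punctured_line_center a : set A :=
  [set x | exists k : K, exists z, [/\ k != 0, alg_center z & x = k *: a + z]].

Definition generic_except (D : set A) (S : set A) : Prop :=
  exists a', [/\ D a', punctured_line_center a' `<=` S `&` D &
    S `\` punctured_line_center a' `<=` [set x | generic x]].

Definition has_centralizer_kind a (k : centralizer_kind) : Prop :=
  let S := centralizer a `\` alg_center in
  match k with
  | AllStronglyNilpotent => S `<=` [set x | strongly_nilpotent x]
  | AllWeaklyNilpotent => S `<=` [set x | weakly_nilpotent x]
  | GenericOrStronglySemisimple =>
      generic_except [set x | strongly_semisimple x] S
  | GenericOrWeaklySemisimple => generic_except [set x | weakly_semisimple x] S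
  | AllGeneric => S `<=` [set x | generic x]
  end.

Definition homogeneous_centralizers : Prop :=
  [/\ noncommutative, dixmier_partition &
      forall a, ~ alg_center a -> exists! k, has_centralizer_kind a k].

End DixmierTypes.

Arguments noncommutative {K} A.
Arguments alg_center {K} A.
Arguments commutative_centralizers {K} A.

(* Main.v *)
From HB Require Import structures.
Require Import Defs.
From mathcomp Require Import all_boot all_order all_algebra.
From mathcomp Require Import all_classical all_reals all_analysis.
From mathcomp Require Import generic_quotient fraction separable ring lra zify.

(** Why the theorem holds.

    Everything takes place in one division ring [E]: the skew Laurent series in
    [T] over the field [L(C, H)], where [L] is the algebraic closure of [K] and
    [T] shifts [H] by one. The enveloping algebra embeds in [E] by its normal form
    (the sum of the [X^i K[C][H]] and of the [Y^i K[C][H]]), the Ore condition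
    extends the embedding to the division ring of fractions [Q], and [L (x) A] maps
    to [E] for every subalgebra [A] of [Q].

    Centralizers in [E] are commutative ([laurent_centralizers]). The valuation is
    the lowest exponent of [T]. If the noncentral element [a] has nonzero
    valuation, leading coefficients in the centralizer of [a] are determined by the
    valuation up to a factor fixed by the shift, hence central; so an element [u] of
    least positive valuation generates the centralizer topologically over the
    centre. If [a] has valuation zero, either its constant term is central and may
    be subtracted, or everything commuting with [a] has valuation zero and
    commutators, having no constant term, vanish. The centre of [Q] is [K(C)]
    ([frac_center]) because a central element is a rational function of [H] that is
    invariant under the shift, hence constant in [H].

    Commutative centralizers already give half of homogeneity: for [b] in [C(a)]
    and noncentral, [C(b) = C(a)] and then [N(b) = N(a)] ([nil_eq]).

    The rest is a growth argument. In an algebra [A] of Gelfand-Kirillov dimension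
    less than [4], no four elements of the image of [L (x) A] have linearly
    independent monomials ([slow_growth_dependent]). One of the four is always a
    fixed central element [c] transcendental over [L], and [a], having an
    eigenvector, is transcendental over the centre; so no two elements [x], [y] can
    have their monomials [x^i y^j] independent over [C(a)]
    ([no_independent_pair]). Applied to a generalized eigenvector and an
    eigenvector this shows that a nilpotent direction excludes eigenvectors with
    nonzero eigenvalue, and that generalized eigenvectors are eigenvectors
    ([no_jordan]); so [D(a) = C(a)] when [N(a) <> C(a)] ([nil_ss]), and
    [F(a) = D(a)] when [N(a) = C(a)] ([locfin_ss], [ss_locfin]). This is the Dixmier
    partition.

    For commuting [a] and [b] with eigenvectors [z] and [z'], conjugation by [z] and
    by [z'] acts on the field [C(a) = C(b)], and by independence of characters the
    monomials [z^i z'^j] are independent unless two of these automorphisms agree.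
    Then [z^m = z'^n g] with [g] in [C(a)], and comparing the two eigenvalues
    produces a combination of [a] and [b] commuting with [z^m], which must be
    central ([eigen_commensurable]). So [b = k a + d] with [d] central, and [k] lies
    in [K] because a fraction of elements of [A] that is a scalar of [L] is a scalar
    of [K] ([frac_ser_scalar]). Hence the semisimple elements of a centralizer form
    one line modulo the centre ([abstract_homogeneous]).

    Finally [Usl(2)] itself grows like [n ^ 3], since products of [n] fixed elements
    lie in the span of [O(n ^ 3)] monomials ([usl2_slow_growth]). *)

Set Implicit Arguments.
Unset Strict Implicit.
Unset Printing Implicit Defensive.

Import Order.TTheory GRing.Theory Num.Theory.
Local Open Scope classical_set_scope.
Local Open Scope ring_scope.

(** * Polynomials in a linear operator *)

Section LinearFunctions.
Variables (F : fieldType) (V W : lmodType F) (S : V -> W).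
Hypothesis Slin : linear S.

Let S' : {linear V -> W} := HB.pack S (GRing.isLinear.Build _ _ _ _ S Slin).

Lemma lin_sum (I : Type) (r : seq I) (P : pred I) (f : I -> V) :
  S (\sum_(i <- r | P i) f i) = \sum_(i <- r | P i) S (f i).
Proof. exact: (linear_sum S'). Qed.

Lemma linZ k v : S (k *: v) = k *: S v.
Proof. exact: (linearZ_LR S'). Qed.

Lemma lin0 : S 0 = 0.
Proof. exact: (linear0 S'). Qed.

Lemma linB u v : S (u - v) = S u - S v.
Proof. exact: (linearB S'). Qed.

End LinearFunctions.

Section OperatorPolynomials.
Variables (F : fieldType) (V : lmodType F) (T : V -> V).
Hypothesis Tlin : linear T.
Implicit Types (p q : {poly F}) (v w : V).

Definition opoly p v : V := \sum_(i < size p) p`_i *: iter i T v.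

Lemma iter_linear n : linear (iter n T).
Proof.
elim: n => [|n IHn] k v w //=; by rewrite IHn Tlin.
Qed.

Lemma opolyE n p v : (size p <= n)%N ->
  opoly p v = \sum_(i < n) p`_i *: iter i T v.
Proof.
move=> le_pn; rewrite /opoly (big_ord_widen _ (fun i => p`_i *: iter i T v) le_pn).
rewrite big_mkcond /=; apply: eq_bigr => i _; case: ltnP => // le_pi.
by rewrite nth_default // scale0r.
Qed.

Lemma opolyD p q v : opoly (p + q) v = opoly p v + opoly q v.
Proof.
pose n := maxn (size p) (size q).
rewrite (@opolyE n p) ?leq_maxl // (@opolyE n q) ?leq_maxr //.
rewrite (@opolyE n (p + q)) ?size_polyD // -big_split /=.
by apply: eq_bigr => i _; rewrite coefD scalerDl.
Qed.

Lemma opolyZ k p v : opoly (k *: p) v = k *: opoly p v.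
Proof.
rewrite (@opolyE (size p)) ?size_scale_leq // scaler_sumr.
by apply: eq_bigr => i _; rewrite coefZ scalerA.
Qed.

Lemma opoly0 v : opoly 0 v = 0.
Proof. by rewrite /opoly size_poly0 big_ord0. Qed.

Lemma opolyC c v : opoly c%:P v = c *: v.
Proof.
by rewrite (@opolyE 1) ?size_polyC_leq1 // big_ord1 coefC.
Qed.

Lemma opoly1 v : opoly 1 v = v.
Proof. by rewrite -[1]/(1%:P) opolyC scale1r. Qed.

Lemma opolyMX p v : opoly (p * 'X) v = T (opoly p v).
Proof.
rewrite (@opolyE (size p).+1); last first.
  by rewrite (leq_trans (size_polyMleq _ _)) // size_polyX addn2.
rewrite big_ord_recl coefMX /= scale0r add0r (lin_sum Tlin).
by apply: eq_bigr => i _; rewrite coefMX /= (linZ Tlin).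
Qed.

Lemma opolyX v : opoly 'X v = T v.
Proof. by rewrite -['X]mul1r opolyMX opoly1. Qed.

Lemma opolyM p q v : opoly (p * q) v = opoly p (opoly q v).
Proof.
elim/poly_ind: p => [|p c IHp]; first by rewrite mul0r !opoly0.
rewrite mulrDl !opolyD -mulrA ['X * q]mulrC mulrA opolyMX IHp opolyMX.
by rewrite mul_polyC opolyZ opolyC.
Qed.

Lemma opolyXn n v : opoly 'X^n v = iter n T v.
Proof.
elim: n v => [|n IHn] v; first by rewrite opoly1.
by rewrite exprSr opolyMX IHn.
Qed.

Lemma opolyXsubC c v : opoly ('X - c%:P) v = T v - c *: v.
Proof. by rewrite opolyD opolyX -polyCN opolyC scaleNr. Qed.

Lemma opoly_linear p : linear (opoly p).
Proof.
move=> k v w; rewrite /opoly scaler_sumr -big_split /=.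
apply: eq_bigr => i _; rewrite iter_linear scalerDr !scalerA.
by rewrite mulrC.
Qed.

Lemma opoly_at0 p : opoly p 0 = 0.
Proof. exact/lin0/opoly_linear. Qed.

Lemma opoly_kill_dvd p q v : p %| q -> opoly p v = 0 -> opoly q v = 0.
Proof. by move=> /dvdpP[r ->] pv; rewrite opolyM pv opoly_at0. Qed.

Lemma opoly_eigen c p v : T v = c *: v -> opoly p v = p.[c] *: v.
Proof.
move=> Tv; elim/poly_ind: p => [|p d IHp]; first by rewrite opoly0 horner0 scale0r.
by rewrite opolyD opolyMX IHp opolyC (linZ Tlin) Tv scalerA hornerMXaddC scalerDl.
Qed.

End OperatorPolynomials.

(** Carries annihilating polynomials from [A] to its extension of scalars and to [E]. *)
Lemma opoly_transport (F F' : fieldType) (iota : {rmorphism F -> F'})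
    (V : lmodType F) (W : lmodType F') (T : V -> V) (S : W -> W) (f : V -> W) :
  {morph f : x y / x + y} -> (forall k v, f (k *: v) = iota k *: f v) ->
  (forall v, f (T v) = S (f v)) ->
  forall p v, f (opoly T p v) = opoly S (map_poly iota p) (f v).
Proof.
move=> fD fZ fT p v; rewrite /opoly size_map_poly.
have fS n : f (iter n T v) = iter n S (f v) by elim: n => //= n <-.
have f0 : f 0 = 0 by apply: (addrI (f 0)); rewrite -fD !addr0.
rewrite (big_morph f fD f0); apply: eq_bigr => i _.
by rewrite fZ fS coef_map.
Qed.

Section FiniteDimension.
Variables (F : fieldType) (V : lmodType F).

(** The matrix of coordinates has more rows than columns, so a nonzero row vector
    kills it on the left. *)
Lemma dependent_of_span (n d : nat) (u : 'I_n -> V) (s : 'I_d -> V)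
    (c : 'I_n -> 'I_d -> F) :
  (d < n)%N -> (forall i, u i = \sum_j c i j *: s j) ->
  exists2 r : 'I_n -> F, (exists i, r i != 0) & \sum_i r i *: u i = 0.
Proof.
move=> lt_dn uE; pose M := \matrix_(i < n, j < d) c i j.
have kM : kermx M != 0.
  rewrite -mxrank_eq0 mxrank_ker -lt0n subn_gt0.
  by rewrite (leq_ltn_trans (rank_leq_col M)).
have [i rowi] : exists i, row i (kermx M) != 0.
  apply/existsP; apply: contraNT kM; rewrite negb_exists => /forallP h.
  by apply/eqP/row_matrixP => i; rewrite row0; apply/eqP; rewrite -[_ == _]negbK h.
exists (fun j => (row i (kermx M)) 0 j).
  apply/existsP; apply: contraNT rowi; rewrite negb_exists => /forallP h.
  apply/eqP/rowP => j; rewrite [RHS]mxE; apply/eqP; by rewrite -[_ == _]negbK h.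
under eq_bigr do rewrite uE scaler_sumr.
rewrite exchange_big /= big1 // => j _.
under eq_bigr do rewrite scalerA.
rewrite -scaler_suml.
have /rowP/(_ j) : row i (kermx M) *m M = 0 by rewrite -row_mul mulmx_ker row0.
rewrite [LHS]mxE [RHS]mxE => h; transitivity (0 *: s j); last exact: scale0r.
congr (_ *: _); rewrite -[RHS]h; apply: eq_bigr => l _; by rewrite [M _ _]mxE.
Qed.

End FiniteDimension.

(** * Spans and growth *)

Section Span.
Variables (F : fieldType) (V : lmodType F).
Implicit Types (s t : seq V) (x y : V).

Definition inspan s x : Prop :=
  exists c : 'I_(size s) -> F, x = \sum_i c i *: s`_i.

Lemma inspan0 s : inspan s 0.
Proof. by exists (fun _ => 0); rewrite big1 // => i _; rewrite scale0r. Qed.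

Lemma inspanD s x y : inspan s x -> inspan s y -> inspan s (x + y).
Proof.
move=> [c ->] [d ->]; exists (fun i => c i + d i); rewrite -big_split /=.
by apply: eq_bigr => i _; rewrite scalerDl.
Qed.

Lemma inspanZ s k x : inspan s x -> inspan s (k *: x).
Proof.
move=> [c ->]; exists (fun i => k * c i); rewrite scaler_sumr.
by apply: eq_bigr => i _; rewrite scalerA.
Qed.

Lemma inspan_mem s x : x \in s -> inspan s x.
Proof.
move=> /(nthP 0)[i lt_is <-]; exists (fun j => if j == Ordinal lt_is then 1 else 0).
rewrite (bigD1 (Ordinal lt_is)) //= eqxx scale1r big1 ?addr0 // => j /negPf ->.
by rewrite scale0r.
Qed.

Lemma inspan_sum (I : Type) (r : seq I) (P : pred I) (f : I -> V) s :
  (forall i, P i -> inspan s (f i)) -> inspan s (\sum_(i <- r | P i) f i).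
Proof.
move=> sf; elim/big_rec: _ => [|i x Pi sx]; first exact: inspan0.
by apply: inspanD => //; exact: sf.
Qed.

Lemma inspan_trans s t x :
  (forall y, y \in s -> inspan t y) -> inspan s x -> inspan t x.
Proof.
move=> st [c ->]; apply: inspan_sum => i _; apply: inspanZ; apply: st.
exact: mem_nth.
Qed.

Lemma inspan_card_le (I : finType) (u : I -> V) s :
  (forall i, inspan s (u i)) ->
  (forall c : I -> F, \sum_i c i *: u i = 0 -> forall i, c i = 0) ->
  (#|I| <= size s)%N.
Proof.
move=> us indep; rewrite leqNgt; apply/negP => lt_sI.
have /(_ _)/cid-/all_tag[c cE] := us.
have [|r [i0 r0]] := @dependent_of_span F V #|I| (size s)
  (fun i => u (enum_val i)) (fun j => s`_j) (fun i => c (enum_val i)) lt_sI.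
  by move=> i; exact: cE.
move=> sum0; move: r0; suff -> : r i0 = 0 by rewrite eqxx.
rewrite -[i0]enum_valK.
apply: (indep (fun i => r (enum_rank i))); rewrite -[RHS]sum0.
rewrite (reindex_onto enum_val enum_rank) /=; last by move=> i _; rewrite enum_rankK.
apply: eq_big => [i|i _]; by rewrite enum_valK ?eqxx.
Qed.

Lemma span_dim_le s t : (forall x, x \in s -> inspan t x) ->
  (span_dim s <= size t)%N.
Proof.
move=> st; apply/bigmax_leqP => J /asboolP Jind.
rewrite -[#|J|]card_sig.
apply: (@inspan_card_le {i | i \in J} (fun i => s`_(val i))) => [[i Ji]|c sum0 [i Ji]].
  exact/st/mem_nth.
pose d i := if insub i is Some j then c j else 0.
have dE (j : {i | i \in J}) : d (val j) = c j by rewrite /d valK.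
rewrite -dE; apply: Jind => //; rewrite -[RHS]sum0.
rewrite (reindex_omap (val : {i | i \in J} -> 'I_(size s)) insub) /=; last by move=> j Jj; rewrite insubT.
apply: eq_big => [j|j _]; last by rewrite dE.
by rewrite (valP j) valK eqxx.
Qed.

(** A linearly independent subfamily of largest cardinality spans. *)
Lemma span_dim_basis s : exists t, [/\ size t = span_dim s,
  {subset t <= s} & forall x, x \in s -> inspan t x].
Proof.
have set0P : (finset.set0 : {set 'I_(size s)}) \in
    [pred J : {set 'I_(size s)} | `[< lin_indep (fun i : 'I_(size s) => s`_i) J >]].
  by apply/asboolP => c _ i; rewrite inE.
have [|J /asboolP Jind cardJ] := @eq_bigmax_cond _
  [pred J : {set 'I_(size s)} | `[< lin_indep (fun i : 'I_(size s) => s`_i) J >]]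
  (fun J => #|J|).
  apply/card_gt0P; exists finset.set0; exact: set0P.
exists [seq s`_(val i) | i <- enum J]; split.
- by rewrite size_map -cardE -cardJ /span_dim; apply: eq_bigl => I.
- by move=> x /mapP[i _ ->]; exact: mem_nth (ltn_ord i).
move=> x /(nthP 0)[i0 lt_i0 <-]; pose i := Ordinal lt_i0.
have inJ j : j \in J -> inspan [seq s`_(val i) | i <- enum J] s`_j.
  by move=> Jj; apply: inspan_mem; apply/mapP; exists j; rewrite ?mem_enum.
have [Ji|nJi] := boolP (i \in J); first exact: (inJ i).
have : ~ lin_indep (fun i : 'I_(size s) => s`_i) (i |: J)%SET.
  move=> indJ; have : (#|(i |: J)%SET| <= #|J|)%N.
    rewrite -cardJ.
    apply: (@leq_bigmax_cond _ _ (fun J : {set 'I_(size s)} => #|J|) (i |: J)%SET).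
    exact/asboolP.
  by rewrite cardsU1 nJi ltnn.
move=> dep; apply: contrapT => nspan; apply: dep => c sum0.
have sumE : \sum_(j in (i |: J)%SET) c j *: s`_j = c i *: s`_i + \sum_(j in J) c j *: s`_j.
  rewrite (bigD1 i) ?finset.setU11 //=; congr (_ + _); apply: eq_bigl => j.
  rewrite !inE; have [->|ji] := eqVneq j i; last by rewrite andbT.
  by rewrite (negPf nJi).
rewrite sumE in sum0.
have ci0 : c i = 0.
  apply: contrapT => /eqP ci; apply: nspan.
  have -> : s`_i0 = (- (c i)^-1) *: \sum_(j in J) c j *: s`_j.
    move/eqP: sum0; rewrite addr_eq0 => /eqP h.
    by rewrite -[\sum_(_ in _) _]opprK -h scaleNr scalerN opprK scalerA mulVf // scale1r.
  by apply: inspanZ; apply: inspan_sum => j Jj; apply: inspanZ; exact: inJ.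
move=> j; rewrite !inE => /orP[/eqP -> //|]; apply: Jind.
by move: sum0; rewrite ci0 scale0r add0r.
Qed.

End Span.

(** The consequence of Gelfand-Kirillov dimension less than [4] that the proofs use.
    The factor [4] is the degree of the monomials [g1^i g2^j g3^k g4^l] in units of
    the bound on the exponents. *)
Definition slow_growth (K : fieldType) (A : algType K) : Prop :=
  forall s : seq A, exists n, (span_dim (products (1%R :: s) (4 * n)) < n ^ 4)%N.

Section GrowthOfImages.
Variables (K L : fieldType) (iota : {rmorphism K -> L}).
Variables (A : algType K) (E : algType L) (e : {rmorphism A -> E}).
Hypothesis eZ : forall k a, e (k *: a) = iota k *: e a.

Lemma inspan_map (s : seq A) a : inspan s a -> inspan (map e s) (e a).
Proof.
move=> [c ->]; rewrite rmorph_sum; apply: inspan_sum => i _.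
by rewrite eZ; apply: inspanZ; apply: inspan_mem; apply: map_f; exact: mem_nth.
Qed.

(** The image of [L (x) A] in [E]. *)
Definition espan (x : E) : Prop := exists s : seq A, inspan (map e s) x.

Lemma espan_e a : espan (e a).
Proof. by exists [:: a]; apply: inspan_mem; rewrite mem_head. Qed.

Lemma products_mul (s : seq A) N g x :
  inspan (map e s) g -> inspan (map e (products s N)) x ->
  inspan (map e (products s N.+1)) (g * x).
Proof.
move=> [c ->] [d ->]; rewrite mulr_suml; apply: inspan_sum => i _.
rewrite mulr_sumr; apply: inspan_sum => j _.
rewrite -scalerAl -scalerAr; do 2!apply: inspanZ.
have /mapP[y sy ->] : (map e s)`_i \in map e s by exact: mem_nth (ltn_ord i).
have /mapP[z sz ->] : (map e (products s N))`_j \in map e (products s N).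
  exact: mem_nth (ltn_ord j).
rewrite -rmorphM; apply: inspan_mem; apply: map_f.
by apply/allpairsP; exists (y, z).
Qed.

Lemma products_exp (s : seq A) N n g x :
  inspan (map e s) g -> inspan (map e (products s N)) x ->
  inspan (map e (products s (n + N))) (g ^+ n * x).
Proof.
move=> sg sx; elim: n => [|n IHn]; first by rewrite mul1r.
by rewrite exprS -mulrA addSn; exact: products_mul.
Qed.

Definition monomials (g : 4.-tuple E) n (p : 'I_n * 'I_n * 'I_n * 'I_n) : E :=
  tnth g (inord 0) ^+ p.1.1.1 * (tnth g (inord 1) ^+ p.1.1.2 *
    (tnth g (inord 2) ^+ p.1.2 * tnth g (inord 3) ^+ p.2)).

(** The [n ^ 4] monomials with exponents less than [n] lie in the [L]-span of the
    image of the products of length [4 n], whose dimension over [L] is at most that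
    of these products over [K]. *)
Lemma slow_growth_dependent (g : 4.-tuple E) : slow_growth A ->
  (forall i, espan (tnth g i)) ->
  ~ (forall n (c : 'I_n * 'I_n * 'I_n * 'I_n -> L),
       \sum_p c p *: monomials g p = 0 -> forall p, c p = 0).
Proof.
move=> slow /(_ _)/cid-/all_tag[sg sgP] indep.
pose s := flatten [seq sg i | i <- enum 'I_4].
have [n] := slow s; rewrite ltnNge => /negP; apply.
have gs i : inspan (map e (1 :: s)) (tnth g i).
  apply: inspan_trans (sgP i) => y /mapP[a sa ->]; apply: inspan_mem; apply: map_f.
  rewrite inE; apply/orP; right; apply/flattenP; exists (sg i) => //.
  by apply: map_f; rewrite mem_enum.
have one_s : inspan (map e (1 :: s)) 1.
  by apply: inspan_mem; rewrite /= rmorph1 mem_head.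
have [t [sz_t _ st]] := span_dim_basis (products (1 :: s) (4 * n)).
rewrite -sz_t.
have -> : (n ^ 4 = #|{: 'I_n * 'I_n * 'I_n * 'I_n}|)%N.
  by rewrite !card_prod !card_ord !expnS expn0 muln1 !mulnA.
rewrite -(size_map e t); apply: inspan_card_le (@indep n) => p.
apply: (@inspan_trans _ _ (map e (products (1 :: s) (4 * n)))).
  by move=> y /mapP[a sa ->]; apply: inspan_map; exact: st.
case: p => [[[i j] k] l]; rewrite /monomials /=.
pose N := (i + (j + (k + (l + 0))))%N.
have -> : (4 * n = 4 * n - N + N)%N.
  rewrite subnK // /N addn0; move: (ltn_ord i) (ltn_ord j) (ltn_ord k) (ltn_ord l).
  by move: (nat_of_ord i) (nat_of_ord j) (nat_of_ord k) (nat_of_ord l); clear; lia.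
set x := _ * _; suff xN : inspan (map e (products (1 :: s) N)) x.
  by have := products_exp (4 * n - N) one_s xN; rewrite expr1n mul1r.
rewrite /x /N; do 3!apply: products_exp => //.
rewrite -[_ ^+ l]mulr1; apply: products_exp => //.
by apply: inspan_mem; rewrite /= rmorph1 mem_head.
Qed.

End GrowthOfImages.

(** If the dimension is at least [n ^ 4] at length [4 n] for every [n], the choice
    [n = 4 ^ m] gives the quotients [4 m / (m + 1)] of logarithms along the lengths
    [4 ^ (m + 1)], and these tend to [4]. *)
Lemma slow_growth_GKdim (R : realType) (K : fieldType) (A : algType K) :
  (GKdim R A < 4%:R%:E)%E -> slow_growth A.
Proof.
move=> gk4 s; apply: contrapT => /forallNP fast; move: gk4; apply/negP; rewrite -leNgt.
set u := fun n : nat => ((ln (span_dim (products (1 :: s) n))%:R / ln n%:R : R)%:E).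
suff : (4%:R%:E <= limn_esup u)%E.
  by move=> /le_trans; apply; apply: ereal_sup_ubound; exists s.
have um m : (((4 * m)%:R / (m.+1)%:R : R)%:E <= u (4 ^ m.+1)%N)%E.
  have ln4 : 0 < ln (4%:R : R) by rewrite ln_gt0 // ltr1n.
  have dim : ((4 ^ m) ^ 4 <= span_dim (products (1%R :: s) (4 ^ m.+1)))%N.
    by rewrite [(4 ^ m.+1)%N]expnS leqNgt; apply/negP; exact: fast.
  have dim_ln : (4 * m)%:R * ln 4%:R <=
      ln (span_dim (products (1 :: s) (4 ^ m.+1)))%:R :> R.
    rewrite mulr_natl -lnXn ?ltr0n // ler_ln ?posrE ?exprn_gt0 ?ltr0n //.
    - by rewrite -natrX ler_nat mulnC expnM.
    - by rewrite (leq_trans _ dim) // !expn_gt0.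
  rewrite /u lee_fin natrX lnXn ?ltr0n // -[ln 4 *+ _]mulr_natl invfM mulrA.
  rewrite ler_pdivlMr // mulrAC ler_pM2r ?invr_gt0 ?ltr0n //.
rewrite limn_esup_lim; apply: lime_ge; first exact: is_cvg_esups.
apply: nearW => n; apply/lee_addgt0Pr => eps eps0.
pose m := maxn n (Num.truncn (4%:R / eps)).+1.
apply: le_trans (_ : (u (4 ^ m.+1)%N + eps%:E <= _)%E); last first.
  rewrite leeD2r //; apply: ereal_sup_ubound => /=; exists (4 ^ m.+1)%N => //=.
  rewrite (leq_trans (leq_maxl _ _ : (n <= m)%N)) // ltnW // (leq_trans (ltnSn m)) //.
  exact/ltnW/ltn_expl.
apply: (@le_trans _ _ (((4 * m)%:R / (m.+1)%:R : R)%:E + eps%:E)%E); last first.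
  by rewrite leeD2r.
rewrite -EFinD lee_fin -lerBlDr.
have m4 : 4%:R / eps < m.+1%:R.
  apply: (lt_trans (truncnS_gt _)); rewrite ltr_nat ltnS; exact: leq_maxr.
rewrite ler_pdivlMr ?ltr0n //.
rewrite ltr_pdivrMr // in m4; rewrite natrM -natr1 in m4 *.
nra.
Qed.

(** * Inner derivations *)

Section Commutators.
Variables (F : fieldType) (B : algType F).
Implicit Types a x y z : B.

Lemma ad_linear a : linear (ad a).
Proof.
move=> k x y; rewrite /ad mulrDr mulrDl -scalerAr -scalerAl scalerBr.
by rewrite opprD addrACA.
Qed.

Lemma adM a x y : ad a (x * y) = ad a x * y + x * ad a y.
Proof. by rewrite /ad mulrBl mulrBr !mulrA addrA subrK. Qed.

Lemma ad_eq0 a x : ad a x = 0 <-> a * x = x * a.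
Proof. by rewrite /ad; split=> [/eqP|->]; rewrite ?subrr // subr_eq0 => /eqP. Qed.

Lemma adC a x : ad a x = - ad x a.
Proof. by rewrite /ad opprB. Qed.

Lemma ad_scale a k x : ad (k *: a) x = k *: ad a x.
Proof. by rewrite /ad -scalerAl -scalerAr scalerBr. Qed.

Lemma opoly_ad_comm a p g x : a * g = g * a ->
  opoly (ad a) p (g * x) = g * opoly (ad a) p x.
Proof.
move=> /ad_eq0 ag; rewrite /opoly mulr_sumr; apply: eq_bigr => i _.
rewrite -scalerAr; congr (_ *: _); elim: (nat_of_ord i) => //= m ->.
by rewrite adM ag mul0r add0r.
Qed.

(** Right multiplication by an eigenvector translates eigenvalues. *)
Lemma opoly_ad_mulr a la p x y : ad a y = la *: y ->
  opoly (ad a) (p \Po ('X - la%:P)) (x * y) = opoly (ad a) p x * y.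
Proof.
move=> ay; have al := ad_linear a.
elim/poly_ind: p => [|p c IHp]; first by rewrite comp_poly0 !opoly0 // mul0r.
rewrite comp_polyD comp_polyM comp_polyX comp_polyC !opolyD //.
rewrite mulrC opolyM // IHp opolyXsubC // !opolyC // opolyMX // adM ay.
by rewrite -scalerAr addrK [RHS]mulrDl scalerAl.
Qed.

End Commutators.

Section DivisionRing.
Variables (L : fieldType) (E : unitAlgType L).
Hypothesis L0 : [pchar L] =i pred0.
Hypothesis Ediv : forall x : E, x != 0 -> x \is a GRing.unit.
Implicit Types a b c d g u v w x y z : E.

Let natL n : (n.+1%:R : L) != 0.
Proof. by move/pcharf0P: L0 => ->. Qed.

Lemma div_mul_neq0 x y : x != 0 -> y != 0 -> x * y != 0.
Proof. by move=> /Ediv ux; rewrite mulrI_eq0 //; exact: mulrI. Qed.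

Lemma div_mul_eq0 x y : y != 0 -> x * y = 0 -> x = 0.
Proof. by move=> y0 /eqP; apply: contraTeq => x0; exact: div_mul_neq0. Qed.

Lemma div_exp_neq0 x n : x != 0 -> x ^+ n != 0.
Proof.
move=> x0; elim: n => [|n IHn]; first by rewrite expr0 oner_neq0.
by rewrite exprS div_mul_neq0.
Qed.

Lemma div_scale_neq0 k x : k != 0 -> x != 0 -> k *: x != 0.
Proof. by move=> k0 x0; rewrite scaler_eq0 negb_or k0. Qed.

Lemma alg_center_scalar k : alg_center E (k%:A : E).
Proof. by move=> x; rewrite mulr_algl mulr_algr. Qed.

Lemma alg_centerD x y : alg_center E x -> alg_center E y -> alg_center E (x + y).
Proof. by move=> xC yC z; rewrite mulrDl mulrDr xC yC. Qed.

Lemma alg_centerM x y : alg_center E x -> alg_center E y -> alg_center E (x * y).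
Proof. by move=> xC yC z; rewrite -mulrA yC mulrA xC mulrA. Qed.

Lemma alg_centerZ k x : alg_center E x -> alg_center E (k *: x).
Proof. by rewrite -mulr_algl; apply: alg_centerM; exact: alg_center_scalar. Qed.

Lemma alg_centerX x n : alg_center E x -> alg_center E (x ^+ n).
Proof.
move=> xC; elim: n => [|n IHn]; last by rewrite exprS; exact: alg_centerM.
by move=> y; rewrite mul1r mulr1.
Qed.

Lemma alg_center_sum (I : Type) (r : seq I) (P : pred I) (f : I -> E) :
  (forall i, P i -> alg_center E (f i)) -> alg_center E (\sum_(i <- r | P i) f i).
Proof.
move=> fC; elim/big_rec: _ => [|i x Pi]; last by apply: alg_centerD; exact: fC.
by move=> y; rewrite mul0r mulr0.
Qed.

(** Conjugation by an eigenvector [z] shifts [a] by [- la]. *)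
Lemma eigen_shift a z la : ad a z = la *: z -> z * a = (a - la%:A) * z.
Proof.
by rewrite mulrBl mulr_algl => <-; rewrite /ad opprB addrC subrK.
Qed.

(** Conjugating a relation [P(a) = 0] by [z] gives [P(a - la) = 0]. The difference
    [P(t - la) - P(t)] has smaller degree and leading coefficient [- n la d_n], so
    by induction [d_n = 0]. *)
Lemma eigen_transcendental a z la : la != 0 -> z != 0 -> ad a z = la *: z ->
  forall n (d : nat -> E), (forall j, alg_center E (d j)) ->
  \sum_(j < n) d j * a ^+ j = 0 -> forall j, (j < n)%N -> d j = 0.
Proof.
move=> la0 z0 az; elim=> [|n IHn] d dC sum0 j //.
have shift0 : \sum_(j < n.+1) d j * (a - la%:A) ^+ j = 0.
  apply: (div_mul_eq0 z0).
  transitivity (z * \sum_(j < n.+1) d j * a ^+ j); last by rewrite sum0 mulr0.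
  rewrite mulr_suml mulr_sumr; apply: eq_bigr => i _; rewrite [RHS]mulrA -dC -!mulrA; congr (_ * _).
  elim: (nat_of_ord i) => [|m IHm]; first by rewrite mul1r mulr1.
  by rewrite !exprS [RHS]mulrA (eigen_shift az) -!mulrA IHm.
have dn0 : d n = 0.
  case: n IHn sum0 shift0 {j} => [|n] IHn sum0 shift0.
    by move: sum0; rewrite big_ord1 mulr1.
  pose t := - la%:A : E; have tC : alg_center E t.
    by move=> x; rewrite /t -scaleNr; exact: alg_center_scalar.
  pose d' i := \sum_(j < n.+2 | (i < j)%N) d j * (t ^+ (j - i) *+ 'C(j, i)).
  have d'C i : alg_center E (d' i).
    apply: alg_center_sum => j _; apply: alg_centerM; first exact: dC.
    by rewrite -scaler_nat; apply: alg_centerZ; exact: alg_centerX.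
  have d'0 : \sum_(i < n.+1) d' i * a ^+ i = 0.
    transitivity (\sum_(j < n.+2) d j * (a - la%:A) ^+ j -
      \sum_(j < n.+2) d j * a ^+ j); last by rewrite shift0 sum0 subr0.
    rewrite -sumrB.
    rewrite (eq_bigr (fun j : 'I_n.+2 => \sum_(i < n.+1 | (i < j)%N)
        d j * (t ^+ (j - i) *+ 'C(j, i)) * a ^+ i)); last first.
      move=> j _; rewrite -mulrBr [a - _]addrC exprDn_comm; last exact: (tC a).
      rewrite big_ord_recr /= subnn binn mulr1n mul1r addrK mulr_sumr.
      rewrite (big_ord_widen_cond n.+1 xpredT
        (fun i => d j * (t ^+ (j - i) * a ^+ i *+ 'C(j, i)))); last by rewrite -ltnS.
      by apply: eq_bigr => i _; rewrite -mulrA mulrnAl.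
    rewrite (exchange_big_dep xpredT) //=; apply: eq_bigr => i _.
    by rewrite mulr_suml.
  have := IHn d' d'C d'0 n (ltnSn n).
  rewrite /d' (bigD1 ord_max) //= big1 ?addr0; last first.
    move=> i /andP[lt_ni]; rewrite -val_eqE /= => /negP; case.
    by rewrite eqn_leq lt_ni -ltnS ltn_ord.
  rewrite subSn // subnn expr1 binSn.
  have -> : t *+ n.+1 = (- (n.+1%:R * la))%:A.
    by rewrite -(scaler_nat n.+1 t) /t scalerN scalerA scaleNr.
  rewrite mulr_algr => /eqP.
  by rewrite scaler_eq0 oppr_eq0 mulf_eq0 (negPf (natL n)) (negPf la0) => /eqP.
rewrite ltnS leq_eqVlt => /orP[/eqP -> //|]; apply: IHn => //.
by move: sum0; rewrite big_ord_recr /= dn0 mul0r addr0.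
Qed.

End DivisionRing.

Lemma natr_inj_pchar0 (F : idomainType) : [pchar F] =i pred0 ->
  injective (fun n : nat => n%:R : F).
Proof.
move=> /pcharf0P F0 m n; wlog le_mn : m n / (m <= n)%N => [IH mn|/esym/eqP].
  by case/orP: (leq_total m n) => /IH; [apply|move/(_ (esym mn))].
by rewrite -subr_eq0 -natrB // F0 subn_eq0 => le_nm; apply/eqP; rewrite eqn_leq le_mn.
Qed.

Lemma intr_inj_pchar0 (F : idomainType) : [pchar F] =i pred0 ->
  injective (fun k : int => k%:~R : F).
Proof.
move=> /pcharf0P F0 m n /eqP; rewrite -subr_eq0 -rmorphB /= => mn; apply/eqP.
rewrite -subr_eq0; case: (m - n) mn => k; first by rewrite -pmulrn F0.
by rewrite NegzE rmorphN oppr_eq0 /= -pmulrn F0.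
Qed.

(** * Generalized eigenvectors of inner derivations *)

Section Eigenvectors.
Variables (F : fieldType) (B : algType F).
Implicit Types a u v w x y z : B.

Lemma ad_scaler a k x : ad a (k *: x) = k *: ad a x.
Proof. exact/linZ/ad_linear. Qed.

Lemma ad_eigenM a al be x y : ad a x = al *: x -> ad a y = be *: y ->
  ad a (x * y) = (al + be) *: (x * y).
Proof. by move=> ax ay; rewrite adM ax ay -scalerAl -scalerAr scalerDl. Qed.

Lemma ad_eigenX a la z n : ad a z = la *: z ->
  ad a (z ^+ n) = (n%:R * la) *: z ^+ n.
Proof.
move=> az; elim: n => [|n IHn]; first by rewrite mul0r scale0r /ad mulr1 mul1r subrr.
by rewrite exprS (ad_eigenM az IHn) -[n.+1]addn1 natrD mulrDl mul1r addrC.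
Qed.

(** [w] is a generalized eigenvector of depth two, so at most one of the factors
    [ad a - (al + mu)] falls on it. *)
Lemma jordan_leibniz a al mu w v u m :
  ad a w = mu *: w + v -> ad a v = mu *: v ->
  opoly (ad a) (('X - (al + mu)%:P) ^+ m.+1) (w * u) =
    w * opoly (ad a) (('X - al%:P) ^+ m.+1) u +
    m.+1%:R *: (v * opoly (ad a) (('X - al%:P) ^+ m) u).
Proof.
move=> aw av; have al_ := ad_linear a.
have shuffle (V : zmodType) (r s p q : V) : r + s + p - (q + r) = p - q + s.
  by rewrite [r + s]addrC addrAC opprD addrACA subrr addr0 addrAC addrC addrA addrAC [p + _]addrC.
have Dw y : opoly (ad a) ('X - (al + mu)%:P) (w * y) =
    w * opoly (ad a) ('X - al%:P) y + v * y.
  rewrite !opolyXsubC // adM aw [in RHS]mulrBr mulrDl -scalerAl -scalerAr scalerDl.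
  exact: shuffle.
have Dv y : opoly (ad a) ('X - (al + mu)%:P) (v * y) =
    v * opoly (ad a) ('X - al%:P) y.
  rewrite !opolyXsubC // adM av [RHS]mulrBr -scalerAl -scalerAr scalerDl.
  by rewrite -[X in X + _ - _]addr0 shuffle addr0.
elim: m => [|m IHm]; first by rewrite !expr1 expr0 opoly1 Dw scale1r.
have lin := opoly_linear al_ ('X - (al + mu)%:P).
rewrite [in LHS]exprS opolyM // IHm [X in opoly _ _ X]addrC lin Dw Dv -!opolyM // -!exprS.
by rewrite addrCA -[m.+2]addn1 natrD [in RHS]scalerDl scale1r.
Qed.

(** On [w ^ k] the generalized eigenvalue is [k mu], with depth exactly [k + 1]. *)
Lemma jordan_power a mu w v k : ad a w = mu *: w + v -> ad a v = mu *: v ->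
  opoly (ad a) (('X - (k%:R * mu)%:P) ^+ k) (w ^+ k) = k`!%:R *: v ^+ k /\
  opoly (ad a) (('X - (k%:R * mu)%:P) ^+ k.+1) (w ^+ k) = 0.
Proof.
move=> aw av; have al_ := ad_linear a.
elim: k => [|k [IH1 IH2]].
  by rewrite !expr0 opoly1 scale1r expr1 opolyXsubC // mul0r scale0r /ad mulr1 mul1r !subrr.
have -> : k.+1%:R * mu = k%:R * mu + mu by rewrite -addn1 natrD mulrDl mul1r.
rewrite [w ^+ k.+1]exprS !(jordan_leibniz _ _ _ aw av) IH2 IH1; split.
  by rewrite mulr0 add0r -scalerAr scalerA -exprS factS natrM.
rewrite exprS opolyM // IH2 opoly_at0 // mulr0 add0r.
by rewrite mulr0 scaler0.
Qed.

Lemma opoly_ad_mulr_pow a la p x z l : ad a z = la *: z ->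
  opoly (ad a) (p \Po ('X - (l%:R * la)%:P)) (x * z ^+ l) =
  opoly (ad a) p x * z ^+ l.
Proof. by move=> az; apply: opoly_ad_mulr; exact: ad_eigenX. Qed.

Lemma jordan_monomial a mu w v la z k l :
  ad a w = mu *: w + v -> ad a v = mu *: v -> ad a z = la *: z ->
  let nu := k%:R * mu + l%:R * la in
  opoly (ad a) (('X - nu%:P) ^+ k) (w ^+ k * z ^+ l) =
    k`!%:R *: (v ^+ k * z ^+ l) /\
  opoly (ad a) (('X - nu%:P) ^+ k.+1) (w ^+ k * z ^+ l) = 0.
Proof.
move=> aw av az nu; have [J1 J2] := jordan_power k aw av.
have shift m : ('X - nu%:P) ^+ m =
    (('X - (k%:R * mu)%:P) ^+ m) \Po ('X - (l%:R * la)%:P).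
  elim: m => [|m IHm]; first by rewrite !expr0 -polyC1 comp_polyC.
  rewrite !exprS comp_polyM -IHm comp_polyB comp_polyX comp_polyC; congr (_ * _).
  by rewrite /nu polyCD opprD addrA addrAC.
by rewrite !shift !opoly_ad_mulr_pow // J1 J2 mul0r -scalerAl.
Qed.

End Eigenvectors.

Section Independence.
Variables (L : fieldType) (E : unitAlgType L).
Hypothesis L0 : [pchar L] =i pred0.
Hypothesis Ediv : forall x : E, x != 0 -> x \is a GRing.unit.
Implicit Types a b d g u v w x y z : E.

(** Given a relation, take [S] to be its support: the operator attached to [S] kills
    all terms but one and commutes with the coefficients, so the remaining
    coefficient vanishes. *)
Lemma separated_indep (I : finType) (u : I -> E) a :
  (forall S : {set I}, S != finset.set0 -> exists t p,
     [/\ t \in S, opoly (ad a) p (u t) != 0 &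
         forall s, s \in S -> s != t -> opoly (ad a) p (u s) = 0]) ->
  forall f : I -> E, (forall t, a * f t = f t * a) ->
    \sum_t f t * u t = 0 -> forall t, f t = 0.
Proof.
move=> sep f fa sum0 t; apply: contrapT => /eqP ft.
have [|t0 [p [St0 pt0 p0]]] := sep (finset (fun t => f t != 0)).
  by apply/set0Pn; exists t; rewrite inE.
rewrite inE in St0; move: (ft); have /eqP := div_mul_neq0 Ediv St0 pt0; case.
rewrite -opoly_ad_comm // -[RHS](opoly_at0 (ad_linear a) p) -sum0.
rewrite (lin_sum (opoly_linear (ad_linear a) p)).
rewrite (bigD1 t0) //= big1 ?addr0 // => s st0.
rewrite opoly_ad_comm //; have [->|fs] := eqVneq (f s) 0; first by rewrite mul0r.
by rewrite p0 ?mulr0 // inE.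
Qed.

(** In a relation, take a term with the highest power of [w]. Other terms of the same
    generalized eigenvalue have a smaller power of [w], hence smaller depth (equal
    powers of [w] force equal powers of [z], as [la <> 0]); terms of another
    generalized eigenvalue are killed by a polynomial that is invertible on the
    chosen one. *)
Lemma jordan_indep a mu w v la z n :
  ad a w = mu *: w + v -> ad a v = mu *: v -> ad a z = la *: z ->
  v != 0 -> z != 0 -> la != 0 ->
  forall f : 'I_n * 'I_n -> E, (forall t, a * f t = f t * a) ->
    \sum_t f t * (w ^+ t.1 * z ^+ t.2) = 0 -> forall t, f t = 0.
Proof.
move=> aw av az v0 z0 la0; apply: separated_indep => S /set0Pn[t1 St1].
pose nu (t : 'I_n * 'I_n) := t.1%:R * mu + t.2%:R * la.
have al_ := ad_linear a.
have [t St tmax] : exists2 t, t \in S & forall s, s \in S -> (s.1 <= t.1)%N.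
  have [t St tmax] := @arg_maxnP _ t1 (mem S) (fun t => t.1 : nat) St1.
  by exists t.
pose P := \prod_(s in S | nu s != nu t) ('X - (nu s)%:P) ^+ n.
exists t, (P * ('X - (nu t)%:P) ^+ t.1); split=> //.
  have [J _] := jordan_monomial t.1 t.2 aw av az.
  rewrite opolyM // J (@opoly_eigen _ _ _ _ (nu t)) //; last first.
    have := ad_eigenM (ad_eigenX t.1 av) (ad_eigenX t.2 az).
    by rewrite -/(nu t) ad_scaler => ->; rewrite !scalerA mulrC.
  apply: div_scale_neq0; last apply: div_scale_neq0.
  - rewrite horner_prod; apply/prodf_neq0 => s /andP[_ st].
    by rewrite horner_exp expf_neq0 // hornerXsubC subr_eq0 eq_sym.
  - by move/pcharf0P: L0 => ->; rewrite -lt0n fact_gt0.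
  - by apply: div_mul_neq0 => //; apply: div_exp_neq0.
move=> s Ss st; have [_ J] := jordan_monomial s.1 s.2 aw av az.
apply: opoly_kill_dvd J => //; rewrite -/(nu s).
have [nuE|nuN] := eqVneq (nu s) (nu t).
  rewrite nuE dvdp_mull // dvdp_exp2l // ltn_neqAle tmax // andbT.
  apply: contra st => /eqP st1; rewrite -pair_eqE /pair_eq /= -!val_eqE /= st1 eqxx /=.
  move: nuE; rewrite /nu st1 => /addrI/(mulIf la0).
  by move/(natr_inj_pchar0 L0) ->.
rewrite dvdp_mulr // /P (bigD1 s) /= ?Ss // dvdp_mulr // dvdp_exp2l //.
Qed.

End Independence.

(** * Eigenvectors of commuting elements *)

Section Commensurability.
Variables (L : fieldType) (E : unitAlgType L).
Hypothesis L0 : [pchar L] =i pred0.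
Hypothesis Ediv : forall x : E, x != 0 -> x \is a GRing.unit.
Hypothesis Ecomm : forall a : E, ~ alg_center E a ->
  forall b c, a * b = b * a -> a * c = c * a -> b * c = c * b.
Implicit Types a b d g u v w x y z : E.

(** Independence of characters: multiply the relation by [g] on the right, subtract
    its multiple by the image of [g] under one of the automorphisms, and get a
    relation with smaller support. *)
Lemma dedekind_indep (I : finType) (u : I -> E) a : ~ alg_center E a ->
  (forall t, u t != 0) ->
  (forall t g, a * g = g * a -> a * (u t * g / u t) = (u t * g / u t) * a) ->
  (forall s t, s != t -> exists2 g, a * g = g * a &
     u s * g / u s != u t * g / u t) ->
  forall f : I -> E, (forall t, a * f t = f t * a) ->
    \sum_t f t * u t = 0 -> forall t, f t = 0.
Proof.
move=> aN u0 uN sep f; have [n le_fn] := ubnP #|[pred t | f t != 0]|.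
elim: n => // n IHn in f le_fn * => fa sum0 t; apply: contrapT => /eqP ft.
have uE s g : (u s * g / u s) * u s = u s * g by rewrite divrK // Ediv.
have f0 s : s != t -> f s = 0.
  move=> st; have [g ag gst] := sep _ _ st.
  pose h r := f r * (u r * g / u r - u t * g / u t).
  have ah r : a * h r = h r * a.
    apply: (Ecomm aN) => //; rewrite /h mulrA fa -[LHS]mulrA -[RHS]mulrA; congr (_ * _).
    by rewrite mulrBr mulrBl !uN.
  have hs : h s = 0.
    apply: (IHn h) => //.
      rewrite -ltnS (leq_trans _ le_fn) // ltnS; apply: proper_card; apply/properP.
      split; last by exists t; rewrite ?inE // /h subrr mulr0 eqxx.
      apply/fintype.subsetP => r; rewrite !inE; apply: contraNneq.
      by rewrite /h => ->; rewrite mul0r.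
    transitivity ((\sum_r f r * u r) * g - (u t * g / u t) * \sum_r f r * u r).
      rewrite mulr_suml mulr_sumr -sumrB; apply: eq_bigr => r _.
      rewrite /h mulrBr mulrBl; congr (_ - _); first by rewrite -mulrA uE mulrA.
      by rewrite (Ecomm aN (fa r) (uN t g ag)) [RHS]mulrA.
    by rewrite sum0 mul0r mulr0 subrr.
  apply: (div_mul_eq0 Ediv) hs; by rewrite subr_eq0.
move: sum0; rewrite (bigD1 t) //= big1 ?addr0; last first.
  by move=> s st; rewrite f0 // mul0r.
by apply/eqP; exact: div_mul_neq0.
Qed.

Lemma ad_inv a x la : x != 0 -> ad a x = la *: x -> ad a x^-1 = (- la) *: x^-1.
Proof.
move=> x0 ax; have ux := Ediv x0; apply: (mulrI ux).
have : ad a (x / x) = 0 by rewrite divrr // /ad mulr1 mul1r subrr.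
rewrite adM ax addrC => /eqP; rewrite addr_eq0 => /eqP ->.
by rewrite -scalerAl -scalerAr scaleNr.
Qed.

Lemma ad_eigen_exprz a x la (k : int) : x != 0 -> ad a x = la *: x ->
  ad a (x ^ k) = (k%:~R * la) *: x ^ k.
Proof.
move=> x0 ax; case: k => n; first exact: ad_eigenX.
rewrite NegzE -exprnN (@ad_inv _ _ (n.+1%:R * la)) ?div_exp_neq0 //.
  by rewrite mulrNz mulNr.
exact: ad_eigenX.
Qed.

(** Conjugation by an eigenvector moves [a] by a scalar, hence preserves its
    centralizer. *)
Lemma conj_centralizer a x g la : x != 0 -> ad a x = la *: x -> a * g = g * a ->
  a * (x * g / x) = (x * g / x) * a.
Proof.
move=> x0 ax /ad_eq0 ag; apply/ad_eq0.
have ag0 : ad a g = 0 *: g by rewrite scale0r.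
by rewrite (ad_eigenM (ad_eigenM ax ag0) (ad_inv x0 ax)) addr0 subrr scale0r.
Qed.

Lemma exprz_neq0 x (k : int) : x != 0 -> x ^ k != 0.
Proof.
move=> x0; case: k => n; first exact: div_exp_neq0.
by rewrite NegzE -exprnN invr_eq0 div_exp_neq0.
Qed.

Lemma conj_eq_comm x y w : x != 0 -> y != 0 -> x * w / x = y * w / y ->
  w * (y^-1 * x) = (y^-1 * x) * w.
Proof.
move=> /Ediv ux /Ediv uy xy; have -> : y^-1 * x * w = y^-1 * (x * w / x) * x.
  by rewrite mulrA divrK // mulrA.
by rewrite xy !mulrA mulVr // mul1r.
Qed.

(** If conjugation by [z^i z'^j] and by [z^k z'^l] agree on [C(a)], their quotient
    centralizes [C(a)], so it lies in [C(a)], and [z^m = z'^n g] with [g] in [C(a)].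
    This element is an eigenvector of [a] of eigenvalue [m la] and of [b] of
    eigenvalue [n mu], so [m la b - n mu a] commutes with it; were it noncentral, its
    centralizer would be [C(a)], forcing [m = n = 0]. *)
Lemma eigen_commensurable a b z z' la mu :
  ~ alg_center E a -> ~ alg_center E b -> a * b = b * a ->
  la != 0 -> z != 0 -> ad a z = la *: z ->
  mu != 0 -> z' != 0 -> ad b z' = mu *: z' ->
  (exists k d, alg_center E d /\ b = k *: a + d) \/
  forall n (f : 'I_n * 'I_n -> E), (forall t, a * f t = f t * a) ->
    \sum_t f t * (z ^+ t.1 * z' ^+ t.2) = 0 -> forall t, f t = 0.
Proof.
move=> aN bN ab la0 z0 az mu0 z'0 bz'.
have [|ndep] := pselect (exists k d, alg_center E d /\ b = k *: a + d); first by left.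
right=> n; pose u (t : 'I_n * 'I_n) := z ^+ t.1 * z' ^+ t.2.
have Ca_b g : a * g = g * a -> b * g = g * b by move=> ag; exact: (Ecomm aN).
have Cb_a g : b * g = g * b -> a * g = g * a.
  by move=> bg; apply: (Ecomm bN).
have conjz' g (k : int) : a * g = g * a ->
    a * (z' ^ k * g / z' ^ k) = z' ^ k * g / z' ^ k * a.
  move=> /Ca_b bg; apply: Cb_a.
  exact: conj_centralizer (exprz_neq0 k z'0) (ad_eigen_exprz k z'0 bz') bg.
apply: (@dedekind_indep _ u a aN) => [t|t g ag|s t st].
- by apply: div_mul_neq0 => //; exact: div_exp_neq0.
- have -> : u t * g / u t = z ^+ t.1 * (z' ^+ t.2 * g / z' ^+ t.2) / z ^+ t.1.
    by rewrite /u invrM ?Ediv ?div_exp_neq0 // !mulrA.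
  apply: (@conj_centralizer _ _ _ (t.1%:R * la)); first exact: div_exp_neq0.
    exact: ad_eigenX.
  exact: (conjz' g t.2).
apply: contrapT => /forall2NP same; apply: ndep.
have ut0 r : u r != 0 by apply: div_mul_neq0 => //; exact: div_exp_neq0.
pose g := (u t)^-1 * u s.
have sameE x : a * x = x * a -> u s * x / u s = u t * x / u t.
  by move=> ax; have [//|/negP] := same x; rewrite negbK => /eqP.
have ag : a * g = g * a.
  exact: (conj_eq_comm (ut0 s) (ut0 t) (sameE a erefl)).
pose m : int := s.1%:Z - t.1%:Z; pose n' : int := t.2%:Z - s.2%:Z.
pose g' := z' ^+ s.2 * g / z' ^+ s.2.
have ag' : a * g' = g' * a by exact: (conjz' g s.2).
have [uz uz'] := (Ediv z0, Ediv z'0).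
have yE : z ^ m = z' ^ n' * g'.
  have usE : z ^+ s.1 * z' ^+ s.2 = z ^+ t.1 * z' ^+ t.2 * g.
    by rewrite -/(u s) -/(u t) /g mulrA divrr ?mul1r ?Ediv.
  have us2 : z' ^+ s.2 \is a GRing.unit by rewrite unitrX.
  have ut1 : z ^+ t.1 \is a GRing.unit by rewrite unitrX.
  have zE : z ^+ s.1 = z ^+ t.1 * z' ^+ t.2 * g / z' ^+ s.2 by rewrite -usE mulrK.
  have -> : z ^ m = (z ^+ t.1)^-1 * z ^+ s.1.
    by rewrite /m addrC exprzDr // -exprnN -!exprnP.
  have -> : z' ^ n' = z' ^+ t.2 / z' ^+ s.2 by rewrite /n' exprzDr // -exprnN.
  by rewrite zE /g' -!mulrA mulKr // mulKr.
have ay : ad a (z ^ m) = (m%:~R * la) *: z ^ m by exact: ad_eigen_exprz.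
have by_ : ad b (z ^ m) = (n'%:~R * mu) *: z ^ m.
  have bg' : ad b g' = 0 *: g' by rewrite scale0r; apply/ad_eq0/Ca_b.
  by rewrite yE (ad_eigenM (ad_eigen_exprz n' z'0 bz') bg') addr0.
have ym0 : z ^ m != 0 by exact: exprz_neq0.
pose d := (m%:~R * la) *: b - (n'%:~R * mu) *: a.
have ad_d x : ad x d = (m%:~R * la) *: ad x b - (n'%:~R * mu) *: ad x a.
  by have := ad_linear x (- (n'%:~R * mu)) a ((m%:~R * la) *: b); 
    rewrite !scaleNr ad_scaler addrC => <-; rewrite addrC.
have da : d * a = a * d.
  apply/ad_eq0; rewrite adC ad_d.
  have /ad_eq0 -> := ab; have -> : ad a a = 0 by exact: subrr.
  by rewrite !scaler0 subr0 oppr0.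
have dy : d * z ^ m = z ^ m * d.
  apply/ad_eq0; rewrite adC ad_d [ad _ b]adC [ad _ a]adC ay by_ !scalerN !scalerA.
  by rewrite [X in X *: _]mulrC subrr oppr0.
have dC : alg_center E d.
  apply: contrapT => dN.
  have /ad_eq0 := Ecomm dN da dy; rewrite ay => /eqP.
  rewrite scaler_eq0 (negPf ym0) orbF mulf_eq0 (negPf la0) orbF => /eqP m0.
  have db : d * b = b * d.
    by apply: (Ecomm aN); [rewrite da|exact: ab].
  have /ad_eq0 := Ecomm dN db dy; rewrite by_ => /eqP.
  rewrite scaler_eq0 (negPf ym0) orbF mulf_eq0 (negPf mu0) orbF => /eqP n'0.
  move/eqP: st; apply; apply/eqP; rewrite -pair_eqE /pair_eq /= -!val_eqE /=.
  move: m0 n'0; rewrite -[0]/((0 : int)%:~R) => /(intr_inj_pchar0 L0) /subr0_eq [->].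
  by move=> /(intr_inj_pchar0 L0) /subr0_eq [->]; rewrite !eqxx.
have m0 : m%:~R * la != 0.
  apply/eqP => m0; apply: aN.
  have n0 : n'%:~R * mu != 0.
    apply: contraNneq st => n0.
    move/eqP: m0; rewrite mulf_eq0 (negPf la0) orbF => /eqP m0.
    move/eqP: n0; rewrite mulf_eq0 (negPf mu0) orbF => /eqP n'0.
    rewrite -pair_eqE /pair_eq /= -!val_eqE /=.
    move: m0 n'0; rewrite -[0]/((0 : int)%:~R) => /(intr_inj_pchar0 L0) /subr0_eq [->].
    by move=> /(intr_inj_pchar0 L0) /subr0_eq [->]; rewrite !eqxx.
  have -> : a = (- (n'%:~R * mu)^-1) *: d.
    by rewrite /d m0 scale0r sub0r scaleNr scalerN opprK scalerA mulVf // scale1r.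
  exact: alg_centerZ.
exists ((m%:~R * la)^-1 * (n'%:~R * mu)), ((m%:~R * la)^-1 *: d).
split; first exact: alg_centerZ.
by rewrite /d scalerBr !scalerA mulVf // scale1r addrC subrK.
Qed.
End Commensurability.

(** * Consequences of slow growth *)

Section CentralParameter.
Variables (L : fieldType) (E : unitAlgType L).
Hypothesis L0 : [pchar L] =i pred0.
Hypothesis Ediv : forall x : E, x != 0 -> x \is a GRing.unit.

(** Transcendence over the scalars. *)
Definition power_free (c : E) : Prop :=
  forall n (k : 'I_n -> L), \sum_i k i *: c ^+ i = 0 -> forall i, k i = 0.

Lemma central_eigen_free (c a z : E) la : alg_center E c -> power_free c ->
  la != 0 -> z != 0 -> ad a z = la *: z ->
  forall n (k : 'I_n * 'I_n -> L),
  \sum_p k p *: (c ^+ p.1 * a ^+ p.2) = 0 -> forall p, k p = 0.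
Proof.
move=> cC c_free la0 z0 az n k sum0 [i j].
pose d (m : nat) := if insub m is Some m' then
  \sum_(i < n) k (i, m') *: c ^+ i else 0 : E.
have dE (m : 'I_n) : d m = \sum_(i < n) k (i, m) *: c ^+ i by rewrite /d valK.
have dC m : alg_center E (d m).
  rewrite /d; case: insubP => [m' _ _|_]; last by move=> x; rewrite mul0r mulr0.
  by apply: alg_center_sum => // l _; apply: alg_centerZ; apply: alg_centerX.
have dl0 := eigen_transcendental L0 Ediv la0 z0 az dC.
apply: (c_free n (fun i => k (i, j))); rewrite -dE; apply: (dl0 n) => //.
rewrite -[RHS]sum0 (eq_bigr (fun m : 'I_n =>
  \sum_(i < n) k (i, m) *: (c ^+ i * a ^+ m))); last first.
  by move=> m _; rewrite dE mulr_suml; apply: eq_bigr => l _; rewrite scalerAl.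
rewrite exchange_big pair_bigA /=; apply: eq_bigr => p _.
by rewrite -surjective_pairing.
Qed.

End CentralParameter.

Section SlowGrowth.
Variables (K L : fieldType) (iota : {rmorphism K -> L}).
Variables (A : algType K) (E : unitAlgType L) (e : {rmorphism A -> E}).
Hypothesis L0 : [pchar L] =i pred0.
Hypothesis Ediv : forall x : E, x != 0 -> x \is a GRing.unit.
Hypothesis Ecomm : forall a : E, ~ alg_center E a ->
  forall b c, a * b = b * a -> a * c = c * a -> b * c = c * b.
Hypothesis eZ : forall k a, e (k *: a) = iota k *: e a.
Hypothesis e_inj : injective e.
Hypothesis slow : slow_growth A.
Variable c0 : A.
Hypothesis c0_central : alg_center E (e c0).
Hypothesis c0_free : power_free (e c0).

Local Notation espan := (espan e).

(** The central element [e c0] and [a] contribute two more independent directions,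
    since [a] is transcendental over the centre. *)
Lemma no_independent_pair (a x y z : E) la :
  (exists a0, a = e a0) -> espan x -> espan y ->
  la != 0 -> z != 0 -> ad a z = la *: z ->
  ~ (forall n (f : 'I_n * 'I_n -> E), (forall t, a * f t = f t * a) ->
       \sum_t f t * (x ^+ t.1 * y ^+ t.2) = 0 -> forall t, f t = 0).
Proof.
move=> [a0 ->] sx sy la0 z0 az indep.
pose g := [tuple e c0; e a0; x; y].
apply: (slow_growth_dependent eZ (g := g) slow).
  move=> i; rewrite (tnth_nth 0); case: i => [[|[|[|[|//]]]] ?] /=;
    [exact: espan_e|exact: espan_e|exact: sx|exact: sy].
move=> n k sum0 [[[i j] l] m].
pose f (t : 'I_n * 'I_n) : E :=
  \sum_p k (p.1, p.2, t.1, t.2) *: (e c0 ^+ p.1 * e a0 ^+ p.2).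
have f0 : f (l, m) = 0.
  apply: (indep n f) => [t|].
    rewrite /f mulr_suml mulr_sumr; apply: eq_bigr => p _.
    rewrite -scalerAr -scalerAl; congr (_ *: _).
    by rewrite mulrA -(alg_centerX p.1 c0_central) -!mulrA -exprS -exprSr.
  rewrite -[RHS]sum0; under eq_bigr do rewrite mulr_suml.
  rewrite exchange_big /= pair_bigA /=.
  rewrite [RHS](reindex (fun q : ('I_n * 'I_n) * ('I_n * 'I_n) =>
    (q.1.1, q.1.2, q.2.1, q.2.2))) /=; last first.
    exists (fun p => ((p.1.1.1, p.1.1.2), (p.1.2, p.2))).
      by move=> [[? ?] [? ?]].
    by move=> [[[? ?] ?] ?].
  apply: eq_bigr => q _; rewrite -scalerAl /monomials !(tnth_nth 0) /=.
  by rewrite !inordK //= -!mulrA.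
exact: (central_eigen_free L0 Ediv c0_central c0_free la0 z0 az f0 (i, j)).
Qed.

(** Otherwise the monomials in [w] and [z] would be independent over [C(a)]. *)
Lemma no_jordan (a0 : A) w v z mu la : let a := e a0 in
  espan w -> espan z -> ad a w = mu *: w + v -> ad a v = mu *: v ->
  ad a z = la *: z -> la != 0 -> z != 0 -> v = 0.
Proof.
move=> a sw sz aw av az la0 z0; apply: contrapT => /eqP v0.
apply: (no_independent_pair (a := a) _ sw sz la0 z0 az); first by exists a0.
by move=> n; exact: jordan_indep aw av az v0 z0 la0.
Qed.

Lemma commensurable (a0 b0 : A) z z' la mu : let a := e a0 in let b := e b0 in
  ~ alg_center E a -> ~ alg_center E b -> a * b = b * a ->
  espan z -> espan z' ->
  la != 0 -> z != 0 -> ad a z = la *: z ->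
  mu != 0 -> z' != 0 -> ad b z' = mu *: z' ->
  exists k d, alg_center E d /\ b = k *: a + d.
Proof.
move=> a b aN bN ab sz sz' la0 z0 az mu0 z'0 bz'.
have [//|indep] := eigen_commensurable L0 Ediv Ecomm aN bN ab la0 z0 az mu0 z'0 bz'.
case: (no_independent_pair (a := a) _ sz sz' la0 z0 az indep); by exists a0.
Qed.

End SlowGrowth.

(** * Extension of scalars *)

(** Induction on the roots: if [S x - la x] is a sum of eigenvectors [y_mu] with
    [mu <> la], then [x] differs from the sum of the [y_mu / (mu - la)] by an
    eigenvector of eigenvalue [la]. *)
Lemma eigen_decomposition (F : fieldType) (W : lmodType F) (S : W -> W)
    (Slin : linear S) (t : seq F) (x : W) :
  uniq t -> opoly S (\prod_(la <- t) ('X - la%:P)) x = 0 ->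
  exists s : seq (F * W), (forall p, p \in s -> p.1 \in t /\ S p.2 = p.1 *: p.2) /\
    x = \sum_(p <- s) p.2.
Proof.
elim: t x => [|la t IHt] x.
  by rewrite big_nil opoly1 => _ ->; exists [::]; rewrite big_nil.
rewrite /= => /andP[la_t uniq_t]; rewrite big_cons mulrC opolyM // => /(IHt _ uniq_t).
rewrite opolyXsubC // => -[s [sP sE]].
pose s' := [seq (p.1, (p.1 - la)^-1 *: p.2) | p <- s].
pose x' := \sum_(p <- s') p.2.
have Sx' : S x' - la *: x' = S x - la *: x.
  rewrite sE /x' /s' big_map (lin_sum Slin) scaler_sumr -sumrB !big_seq; apply: eq_bigr => p ps.
  have [pt Sp] := sP p ps; have ne : p.1 - la != 0.
    by rewrite subr_eq0; apply: contraNneq la_t => <-.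
  by rewrite /= (linZ Slin) Sp scalerA [la *: _]scalerA -scalerBl -mulrC -mulrBl mulfV // scale1r.
exists ((la, x - x') :: s'); split; last by rewrite big_cons /= -/x' subrK.
move=> p; rewrite inE => /orP[/eqP -> /=|].
  rewrite mem_head; split=> //; apply/eqP; rewrite -subr_eq0 scalerBr.
  by rewrite (linB Slin) opprD opprK addrACA -Sx' [- S x' + _]addrC -[la *: x' - S x']opprB subrr.
move=> /mapP[q qs -> /=]; have [qt Sq] := sP q qs.
by rewrite inE qt orbT (linZ Slin) Sq !scalerA mulrC.
Qed.

Section BaseChangeAd.
Variables (K L : fieldType) (iota : {rmorphism K -> L}) (A : algType K).
Local Notation AL := (base_change iota A).

Lemma tens0r l : tens l 0 = 0 :> AL.
Proof. by apply: (addrI (tens l 0)); rewrite -tensDr !addr0. Qed.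

Lemma tensNr l a : tens l (- a) = - tens l a :> AL.
Proof. by apply: (addrI (tens l a)); rewrite -tensDr !subrr tens0r. Qed.

Lemma tens_mulr l l' a a' : tens l a * tens l' a' = tens (l * l') (a * a') :> AL.
Proof. exact: tens_mulE. Qed.

Lemma tens_scaler l l' a : l *: tens l' a = tens (l * l') a :> AL.
Proof. exact: tens_scaleE. Qed.

Lemma tens1Z k a : tens 1 (k *: a) = iota k *: tens 1 a :> AL.
Proof. by rewrite -tens_bal mul1r tens_scaler mulr1. Qed.

Lemma ad_tens a l b : ad (tens 1 a) (tens l b) = tens l (ad a b) :> AL.
Proof. by rewrite /ad !tens_mulr mul1r mulr1 tensDr tensNr. Qed.

Lemma tens_ad_linear (x : AL) : linear (ad x).
Proof.
move=> k y z; rewrite /ad mulrDr mulrDl -[x * (k *: y)]tens_scaleAr.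
by rewrite -[(k *: y) * x]tens_scaleAl scalerBr opprD addrACA.
Qed.

Lemma tens_opoly a p b : tens 1 (opoly (ad a) p b) =
  opoly (ad (tens 1 a)) (map_poly iota p) (tens 1 b) :> AL.
Proof.
apply: opoly_transport => [x y|k v|v]; first exact: tensDr.
  exact: tens1Z.
by rewrite ad_tens.
Qed.

Variables (E : algType L) (e : {rmorphism A -> E}).
Hypothesis eZ : forall k a, e (k *: a) = iota k *: e a.

(** The extension of scalars [L (x) A -> E] of [e]. *)
Definition bar (x : AL) : E := tens_lift (fun l a => l *: e a) x.

Lemma bar_balanced : balanced iota (fun l a => l *: e a).
Proof.
split=> [l l' a|l a a'|l k a]; first exact: scalerDl.
  by rewrite rmorphD scalerDr.
by rewrite eZ scalerA.
Qed.

Lemma bar_tens l a : bar (tens l a) = l *: e a.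
Proof. by rewrite /bar tens_lift_tens //; exact: bar_balanced. Qed.

Lemma barD : {morph bar : x y / x + y}.
Proof. exact: tens_liftD bar_balanced. Qed.

Lemma bar0 : bar 0 = 0.
Proof. exact: tens_lift0 bar_balanced. Qed.

Lemma bar_sum (I : Type) (r : seq I) (f : I -> AL) :
  bar (\sum_(i <- r) f i) = \sum_(i <- r) bar (f i).
Proof. exact: (big_morph bar barD bar0). Qed.

Lemma barZ l x : bar (l *: x) = l *: bar x.
Proof.
elim/tens_ind: x => [|l' a x IHx]; first by rewrite scaler0 bar0 scaler0.
by rewrite scalerDr !barD IHx scalerDr tens_scaler !bar_tens scalerA.
Qed.

Lemma bar_ad a x : bar (ad (tens 1 a) x) = ad (e a) (bar x).
Proof.
elim/tens_ind: x => [|l b x IHx].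
  by rewrite /ad mulr0 mul0r subrr bar0 mulr0 mul0r subrr.
have tD : ad (tens 1 a) (tens l b + x) = tens l (ad a b) + ad (tens 1 a) x :> AL.
  by have := tens_ad_linear (tens 1 a) 1 (tens l b) x; rewrite !scale1r ad_tens.
have eD : ad (e a) (l *: e b + bar x) = l *: e (ad a b) + ad (e a) (bar x).
  by rewrite ad_linear [in RHS]/ad rmorphB !rmorphM.
by rewrite tD barD IHx bar_tens barD bar_tens eD.
Qed.

Lemma espan_bar x : espan e (bar x).
Proof.
elim/tens_quotW: x => s; rewrite /bar tens_liftE; last exact: bar_balanced.
exists (unzip2 s); rewrite big_seq; apply: inspan_sum => p ps; apply: inspanZ.
by apply: inspan_mem; apply: map_f; apply: map_f.
Qed.

End BaseChangeAd.

(** * Nilpotent, semisimple and locally finite parts *)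

(** In characteristic zero a root of multiplicity [n + 1] has multiplicity [n] in the
    derivative, so it survives in the quotient by the common divisor. *)
Lemma root_div_gcd_deriv (F F' : fieldType) (iota : {rmorphism F -> F'})
    (q : {poly F}) y : [pchar F'] =i pred0 -> q != 0 ->
  root (map_poly iota q) y -> root (map_poly iota (q %/ gcdp q q^`())) y.
Proof.
move=> /pcharf0P F0 nz_q qy_0.
have g0 : gcdp q q^`() != 0 by rewrite gcdp_eq0 negb_and nz_q.
have [n [r nz_ry Dr]] := multiplicity_XsubC (map_poly iota q) y.
rewrite map_poly_eq0 nz_q /= in nz_ry.
case: n => [|n] in Dr; first by rewrite Dr mulr1 (negPf nz_ry) in qy_0.
apply: contraT => ny; have q1y : coprimep (('X - y%:P) ^+ n.+1)
    (map_poly iota (q %/ gcdp q q^`())).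
  by rewrite coprimep_expl // coprimep_sym coprimep_XsubC.
have : ('X - y%:P) ^+ n.+1 %| map_poly iota (gcdp q q^`()).
  rewrite -(Gauss_dvdpr _ q1y).
  have -> : map_poly iota (q %/ gcdp q q^`()) * map_poly iota (gcdp q q^`()) =
      map_poly iota q by rewrite -rmorphM /= divpK ?dvdp_gcdl.
  by rewrite Dr dvdp_mulIr.
rewrite gcdp_map dvdp_gcd => /andP[_]; rewrite -deriv_map Dr.
rewrite derivM deriv_exp derivXsubC mul1r dvdp_addr ?dvdp_mulIr //.
rewrite /= mulrnAr -scaler_nat dvdpZr ?F0 // exprS dvdp_mul2r; last first.
  by rewrite expf_neq0 // polyXsubC_eq0.
by rewrite dvdp_XsubCl (negPf nz_ry).
Qed.

Section LocallyFinite.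
Variables (K : fieldType) (A : algType K).
Implicit Types a b : A.

(** Two descriptions of [F(a)]: a finite-dimensional orbit satisfies a linear relation
    between iterates, and conversely division by such a relation bounds the orbit. *)
Lemma locfin_polyP a b :
  locfin_part a b <-> exists2 P : {poly K}, P != 0 & opoly (ad a) P b = 0.
Proof.
have al := ad_linear a; split=> [[s sP]|[P P0 Pb]].
  have /(_ _)/cid-/all_tag[c cE] : forall i : 'I_(size s).+1, exists c : 'I_(size s) -> K,
      iter i (ad a) b = \sum_j c j *: s`_j.
    move=> i; apply: sP; exists 'X^i; rewrite -/(opoly (ad a) 'X^i b).
    by rewrite opolyXn.
  have [r [i0 r0] sum0] := dependent_of_span (ltnSn (size s)) cE.
  exists (\poly_(i < (size s).+1) r (inord i)).
    apply: contraNneq r0 => P0; have := congr1 (fun p : {poly K} => p`_i0) P0.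
    by rewrite coef0 coef_poly ltn_ord inord_val => ->.
  rewrite (@opolyE _ _ _ (size s).+1) ?size_poly // -[RHS]sum0.
  by apply: eq_bigr => i _; rewrite coef_poly ltn_ord inord_val.
exists (mkseq (fun i => iter i (ad a) b) (size P)) => w [p ->].
rewrite -/(opoly (ad a) p b) (divp_eq p P) opolyD opolyM // Pb opoly_at0 // add0r.
exists (fun i => (p %% P)`_i); rewrite size_mkseq.
rewrite (@opolyE _ _ _ (size P)); last by rewrite ltnW // ltn_modp.
by apply: eq_bigr => i _; rewrite nth_mkseq.
Qed.

Lemma centralizer_nil a : centralizer a `<=` nil_part a.
Proof. by move=> b ab; exists 0%N. Qed.

(** Take the last iterate of [ad a] outside the centralizer. *)
Lemma nil_jordan a : nil_part a <> centralizer a ->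
  exists x, ad a (ad a x) = 0 /\ ad a x <> 0.
Proof.
move=> NC; have [b [[i bi] bC]] : exists b, nil_part a b /\ ~ centralizer a b.
  apply: contrapT => /forallNP h; apply: NC; apply/seteqP; split; last exact: centralizer_nil.
  by move=> b Nb; have /not_andP[//|/contrapT] := h b.
elim: i b bC bi => [|i IHi] b bC bi; first by case: bC.
have [abC|abC] := pselect (centralizer a (ad a b)); first by exists b.
by apply: (IHi (ad a b) abC); rewrite -iterSr.
Qed.

End LocallyFinite.

Section ElementTypes.
Variables (K : fieldType) (L : closedFieldType) (iota : {rmorphism K -> L}).
Variables (A : algType K) (E : unitAlgType L) (e : {rmorphism A -> E}).
Hypothesis Lalg : algebraic_closure iota.
Hypothesis L0 : [pchar L] =i pred0.
Hypothesis Ediv : forall x : E, x != 0 -> x \is a GRing.unit.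
Hypothesis Ecomm : forall a : E, ~ alg_center E a ->
  forall b c, a * b = b * a -> a * c = c * a -> b * c = c * b.
Hypothesis eZ : forall k a, e (k *: a) = iota k *: e a.
Hypothesis e_inj : injective e.
Hypothesis slow : slow_growth A.
Variable c0 : A.
Hypothesis c0_central : alg_center E (e c0).
Hypothesis c0_free : power_free (e c0).
Implicit Types a b : A.

Lemma e_ad a b : e (ad a b) = ad (e a) (e b).
Proof. by rewrite /ad rmorphB !rmorphM. Qed.

Lemma e_eq0 a : e a = 0 -> a = 0.
Proof. by move=> ea; apply: e_inj; rewrite rmorph0. Qed.

Lemma e_opoly a p b : e (opoly (ad a) p b) = opoly (ad (e a)) (map_poly iota p) (e b).
Proof.
apply: opoly_transport => [x y|//|v]; first exact: rmorphD.
exact: e_ad.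
Qed.

Lemma espan_opoly a (p : {poly L}) b : espan e (opoly (ad (e a)) p (e b)).
Proof.
exists (mkseq (fun i => iter i (ad a) b) (size p)); apply: inspan_sum => i _.
apply: inspanZ; apply: inspan_mem; apply/mapP; exists (iter i (ad a) b).
  by apply/mapP; exists (i : nat) => //; rewrite mem_iota ltn_ord.
by elim: (nat_of_ord i) => //= n ->; rewrite e_ad.
Qed.

Lemma centralizer_ss a : centralizer a `<=` ss_part iota a.
Proof.
move=> b ab; exists [:: (0, tens 1 b)]; split; last by rewrite big_seq1.
move=> p; rewrite inE => /eqP -> /=.
by rewrite scale0r ad_tens ab tens0r.
Qed.

Lemma ss_eigenvector a b : ss_part iota a b -> ad a b <> 0 ->
  exists z la, [/\ espan e z, la != 0, z != 0 & ad (e a) z = la *: z].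
Proof.
move=> [s [sP sE]] ab0; apply: contrapT => none; apply: ab0; apply: e_eq0.
have bE : e b = bar e (\sum_(p <- s) p.2) by rewrite -sE bar_tens // scale1r.
rewrite e_ad bE bar_sum // (lin_sum (ad_linear _)) big_seq big1 // => p ps.
have az : ad (e a) (bar e p.2) = p.1 *: bar e p.2 by rewrite -bar_ad // sP // barZ.
apply: contrapT => az0; apply: none; exists (bar e p.2), p.1; split=> //.
- exact: espan_bar.
- by apply/eqP => p0; apply: az0; rewrite az p0 scale0r.
- by apply/eqP => p0; apply: az0; rewrite az p0 scaler0.
Qed.

(** A nilpotent direction [x] is a generalized eigenvector of eigenvalue [0]; by slow
    growth it excludes eigenvectors of nonzero eigenvalue. *)
Lemma nil_ss a : nil_part a <> centralizer a -> ss_part iota a = centralizer a.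
Proof.
move=> /nil_jordan[x [aax ax]]; apply/seteqP; split; last exact: centralizer_ss.
move=> b ab; apply: contrapT => /(ss_eigenvector ab)[z [la [sz la0 z0 az]]].
apply: ax; apply: e_eq0.
apply: (no_jordan L0 Ediv eZ slow c0_central c0_free (a0 := a) (w := e x) (mu := 0)
  (espan_e e x) sz _ _ az la0 z0).
  by rewrite scale0r add0r e_ad.
by rewrite scale0r -e_ad aax rmorph0.
Qed.

(** Nonzero eigenvalues have no generalized eigenvectors and [0] occurs once, so
    repeated roots may be dropped from a polynomial killing [b]. *)
Lemma kill_undup a b (s : seq L) (G : {poly L}) : (count_mem 0%R s <= 1)%N ->
  opoly (ad (e a)) (\prod_(la <- s) ('X - la%:P) * G) (e b) = 0 ->
  opoly (ad (e a)) (\prod_(la <- undup s) ('X - la%:P) * G) (e b) = 0.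
Proof.
have al := ad_linear (e a).
elim: s G => [|la s IHs] G //=; rewrite big_cons => s0 kill.
case: ifP => las; last first.
  rewrite big_cons -mulrA mulrCA; apply: IHs; first exact: leq_trans (leq_addl _ _) s0.
  by rewrite mulrCA mulrA.
apply: IHs; first exact: leq_trans (leq_addl _ _) s0.
have la0 : la != 0.
  apply: contraTneq s0 => la0; rewrite la0 eqxx -ltnNge ltnS -has_count.
  by apply/hasP; exists la; rewrite //= la0.
pose T := \prod_(l <- rem la s) ('X - l%:P) * G.
have TE : \prod_(l <- s) ('X - l%:P) * G = ('X - la%:P) * T.
  by rewrite (perm_big _ (perm_to_rem las)) big_cons -mulrA.
rewrite -mulrA TE in kill; rewrite TE.
set w := opoly (ad (e a)) T (e b); pose v := opoly (ad (e a)) ('X - la%:P) w.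
have wE : ad (e a) w = la *: w + v by rewrite /v opolyXsubC // addrC subrK.
have vE : ad (e a) v = la *: v.
  by apply/eqP; rewrite -subr_eq0 -opolyXsubC // /v /w -!opolyM // -?mulrA kill.
rewrite opolyM // -/w -/v; apply: contrapT => /eqP v0; move: (v0).
have sv : espan e v by rewrite /v /w -opolyM //; exact: espan_opoly.
rewrite (no_jordan L0 Ediv eZ slow c0_central c0_free (a0 := a)
  (espan_opoly a T b) sv wE vE vE la0 v0).
by rewrite eqxx.
Qed.

(** The factor [0] of a polynomial killing [b] may be taken simple, because
    [N(a) = C(a)]. The separable part of the polynomial then kills [b], first in [E],
    hence in [A], and so it splits [b] into eigenvectors over [L]. *)
Lemma locfin_ss a : nil_part a = centralizer a -> locfin_part a `<=` ss_part iota a.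
Proof.
have al := ad_linear a; have ael := ad_linear (e a).
move=> NC b /locfin_polyP[P P0 Pb].
have [r [R R0 PE]] := multiplicity_XsubC P 0; rewrite P0 /= in R0.
have XRb : opoly (ad a) ('X * R) b = 0.
  rewrite opolyM // opolyX //.
  have : nil_part a (opoly (ad a) R b).
    exists r; rewrite iterS -opolyXn // -opolyM // mulrC -['X]subr0 -polyC0 -PE Pb.
    exact: (lin0 al).
  by rewrite NC.
have XR0 : 'X * R != 0.
  rewrite mulf_neq0 ?polyX_eq0 //; apply: contraNneq P0 => R00.
  by rewrite PE R00 mul0r.
pose Q := ('X * R) %/ gcdp ('X * R) ('X * R)^`(); pose QL := map_poly iota Q.
have [s RLE] := closed_field_poly_normal (map_poly iota R).
have QLb : opoly (ad (tens 1 a)) QL (tens 1 b) = 0 :> base_change iota A.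
  suff Qb : opoly (ad a) Q b = 0 by rewrite -tens_opoly Qb tens0r.
  have c1 : lead_coef (map_poly iota R) != 0.
    by rewrite lead_coef_eq0 map_poly_eq0; apply: contraNneq R0 => ->; rewrite root0.
  have s0 : 0 \notin s.
    rewrite -root_prod_XsubC -(rootZ _ _ c1) -RLE.
    by rewrite -(rmorph0 iota) fmorph_root.
  pose M := \prod_(z <- undup (0 :: s)) ('X - z%:P).
  have XRE : map_poly iota ('X * R) =
      lead_coef (map_poly iota R) *: \prod_(z <- 0 :: s) ('X - z%:P).
    by rewrite rmorphM /= map_polyX {1}RLE big_cons subr0 scalerAr.
  apply: e_eq0; rewrite e_opoly -/QL; apply: (@opoly_kill_dvd _ _ _ ael M).
    apply: uniq_roots_dvdp; last by rewrite uniq_rootsE undup_uniq.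
    apply/allP => z; rewrite mem_undup => zs; apply: root_div_gcd_deriv => //.
    by rewrite XRE rootZ // root_prod_XsubC.
  rewrite -[M]mulr1; apply: kill_undup.
    by rewrite /= eqxx (count_memPn s0).
  rewrite mulr1; have /eqP : e (opoly (ad a) ('X * R) b) = 0 by rewrite XRb rmorph0.
  by rewrite e_opoly XRE opolyZ scaler_eq0 (negPf c1) => /eqP.
have [t QLE] := closed_field_poly_normal QL.
have ut : uniq t.
  rewrite -separable_prod_XsubC; have : separable_poly QL.
    by rewrite separable_map; exact: make_separable.
  have c0' : lead_coef QL != 0.
    by rewrite lead_coef_eq0 map_poly_eq0; apply/separable_poly_neq0/make_separable.
  by rewrite QLE (eqp_separable (eqp_scale _ c0')).
have c0' : lead_coef QL != 0.
  by rewrite lead_coef_eq0 map_poly_eq0; apply/separable_poly_neq0/make_separable.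
move: QLb; rewrite QLE opolyZ => /eqP; rewrite scaler_eq0 (negPf c0') => /eqP.
move=> /(eigen_decomposition (tens_ad_linear _) ut)[sb [sbP sbE]].
by exists sb; split=> // p /sbP[].
Qed.

(** The eigenvalues are algebraic over [K]; the product of polynomials over [K]
    vanishing at them kills [b]. *)
Lemma ss_locfin a : ss_part iota a `<=` locfin_part a.
Proof.
move=> b [s [sP sE]]; apply/locfin_polyP.
have [P P0 Pr] : exists2 P : {poly K}, P != 0 &
    forall p, p \in s -> root (map_poly iota P) p.1.
  elim: s {sP sE} => [|p s [P P0 IHs]]; first by exists 1; rewrite ?oner_neq0.
  have [p1 p10 rp1] := Lalg p.1.
  exists (p1 * P); first by rewrite mulf_neq0.
  move=> q; rewrite inE rmorphM rootM => /orP[/eqP ->|/IHs ->]; by rewrite ?rp1 ?orbT.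
exists P => //; apply: e_eq0.
have -> : e (opoly (ad a) P b) = bar e (tens 1 (opoly (ad a) P b) : base_change iota A).
  by rewrite bar_tens // scale1r.
rewrite tens_opoly sE (lin_sum (opoly_linear (tens_ad_linear _) _)).
rewrite big_seq big1 ?bar0 // => p ps.
rewrite (opoly_eigen (tens_ad_linear _) _ (sP p ps)).
by have /rootP -> := Pr p ps; rewrite scale0r.
Qed.

End ElementTypes.

(** * Types of elements and homogeneity of centralizers *)

Section AbstractPartition.
Variables (K : fieldType) (L : closedFieldType) (iota : {rmorphism K -> L}).
Variables (A : algType K) (E : unitAlgType L) (e : {rmorphism A -> E}).
Hypothesis Lalg : algebraic_closure iota.
Hypothesis L0 : [pchar L] =i pred0.
Hypothesis Ediv : forall x : E, x != 0 -> x \is a GRing.unit.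
Hypothesis Ecomm : forall a : E, ~ alg_center E a ->
  forall b c, a * b = b * a -> a * c = c * a -> b * c = c * b.
Hypothesis e_inj : injective e.
Hypothesis A_noncomm : noncommutative A.
Implicit Types a b x : A.

Lemma alg_center_e a : alg_center A a <-> alg_center E (e a).
Proof.
split=> [aC|eaC b]; last by apply: e_inj; rewrite !rmorphM.
apply: contrapT => eaN; apply: A_noncomm => x y; apply: e_inj; rewrite !rmorphM.
by apply: (Ecomm eaN); rewrite -!rmorphM aC.
Qed.

Lemma commutative_centralizers_e : commutative_centralizers A.
Proof.
split=> // a aN b c /ad_eq0 ab /ad_eq0 ac; apply: e_inj; rewrite !rmorphM.
have eaN : ~ alg_center E (e a) by move=> /alg_center_e.
by apply: (Ecomm eaN); rewrite -!rmorphM ?ab ?ac.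
Qed.

Let Acomm := commutative_centralizers_e.2.

Lemma centralizer_eq a b : ~ alg_center A a -> ~ alg_center A b ->
  centralizer a b -> centralizer b = centralizer a.
Proof.
move=> aN bN ab; apply/seteqP; split=> c xc; apply/ad_eq0.
  by apply: (Acomm bN) => //; apply/ad_eq0; move/ad_eq0: ab.
exact: (Acomm aN).
Qed.

Lemma ad_commute a b y : centralizer a b -> ad a (ad b y) = ad b (ad a y).
Proof.
move=> ab; rewrite -[ad b y]/(b * y - y * b) (linB (ad_linear a)) !adM.
by have -> : ad a b = 0 by []; rewrite mul0r mulr0 add0r addr0.
Qed.

(** The top nonzero iterate of [ad a] on [x] lies in [C(a) = C(b)], so [ad b]
    lowers the order of nilpotency of [ad a]. *)
Lemma nil_subset a b : ~ alg_center A a -> ~ alg_center A b ->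
  centralizer a b -> nil_part a `<=` nil_part b.
Proof.
move=> aN bN ab x [i ax]; exists i; elim: i x ax => [|i IHi] x ax.
  by rewrite -[_ = 0]/(centralizer b x) (centralizer_eq aN bN ab).
rewrite iterSr; apply: IHi.
have Cax : centralizer b (iter i.+1 (ad a) x).
  by rewrite (centralizer_eq aN bN ab).
rewrite -[RHS]Cax; elim: (i.+1) => //= m ->; exact: ad_commute.
Qed.

Lemma nil_eq a b : ~ alg_center A a -> ~ alg_center A b ->
  centralizer a b -> nil_part b = nil_part a.
Proof.
move=> aN bN ab; apply/seteqP; split; apply: nil_subset => //.
by apply/ad_eq0; move/ad_eq0: ab.
Qed.

Lemma noncentral_centralizer a : ~ alg_center A a -> centralizer a <> setT.
Proof.
move=> aN aT; apply: aN => b; apply/ad_eq0.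
by rewrite -[_ = 0]/(centralizer a b) aT.
Qed.

(** The eigenvectors are the same; the eigenvalues are multiplied by [k]. *)
Lemma ss_part_line a z (k : K) : k != 0 -> alg_center A z ->
  ss_part iota (k *: a + z) = ss_part iota a.
Proof.
have incl a' z' k' : alg_center A z' -> ss_part iota a' `<=` ss_part iota (k' *: a' + z').
  move=> zC b [s [sP sE]]; exists [seq (iota k' * p.1, p.2) | p <- s].
  split; last by rewrite sE big_map.
  move=> q /mapP[p ps -> /=].
  have zp : tens 1 z' * p.2 - p.2 * tens 1 z' = 0 :> base_change iota A.
    elim/tens_ind: p.2 => [|l c x IHx]; first by rewrite mulr0 mul0r subrr.
    rewrite mulrDr mulrDl opprD addrACA IHx addr0 !tens_mulr mul1r mulr1 zC.
    by rewrite subrr.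
  rewrite /ad tensDr tens1Z mulrDl mulrDr opprD addrACA zp addr0.
  rewrite -[X in X - _]tens_scaleAl -[X in _ - X]tens_scaleAr -scalerBr.
  by rewrite -[_ - _]/(ad (tens 1 a') p.2) sP // scalerA.
move=> k0 zC; apply/seteqP; split; last exact: incl.
have aE : a = k^-1 *: (k *: a + z) + (- k^-1) *: z.
  by rewrite scalerDr scalerA mulVf // scale1r scaleNr addrK.
rewrite {2}aE; apply: incl => x.
by rewrite -scalerAl -scalerAr zC.
Qed.

Hypothesis eZ : forall k a, e (k *: a) = iota k *: e a.
Hypothesis slow : slow_growth A.
Variable c0 : A.
Hypothesis c0_central : alg_center E (e c0).
Hypothesis c0_free : power_free (e c0).
(** No new scalars arise as ratios of elements of [A] modulo the centre. *)
Hypothesis rational : forall a b k d, ~ alg_center A a -> alg_center E d ->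
  e b = k *: e a + d -> exists k', k = iota k'.

Let nil_ssA a := nil_ss L0 Ediv eZ e_inj slow c0_central c0_free (a := a).

Lemma locfin_ssE a : nil_part a = centralizer a -> locfin_part a = ss_part iota a.
Proof.
move=> NC; apply/seteqP; split; last exact: (ss_locfin Lalg eZ e_inj).
exact: (locfin_ss L0 Ediv eZ e_inj slow c0_central c0_free NC).
Qed.

Local Notation SN := (@strongly_nilpotent K L iota A).
Local Notation WN := (@weakly_nilpotent K L iota A).
Local Notation SS := (@strongly_semisimple K L iota A).
Local Notation WS := (@weakly_semisimple K L iota A).
Local Notation G := (@generic K L iota A).

Lemma nilpotent_type a : ~ alg_center A a -> nil_part a <> centralizer a ->
  (nil_part a = setT -> SN a) /\ (nil_part a <> setT -> WN a).
Proof.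
move=> aN NC; have DC := nil_ssA NC; split=> NT; first by split.
by split=> // CN; apply: NC.
Qed.

Lemma semisimple_type a : ~ alg_center A a -> nil_part a = centralizer a ->
  ss_part iota a <> centralizer a ->
  (ss_part iota a = setT -> SS a) /\ (ss_part iota a <> setT -> WS a).
Proof.
move=> aN NC DC; have FD := locfin_ssE NC; split=> DT; first by split.
by split=> //; [move=> CD; apply: DC|rewrite FD].
Qed.

Lemma generic_type a : ~ alg_center A a -> nil_part a = centralizer a ->
  ss_part iota a = centralizer a -> G a.
Proof. by move=> aN NC DC; split=> //; rewrite NC DC. Qed.

Lemma abstract_dixmier_partition : dixmier_partition iota A.
Proof.
apply/seteqP; split=> [a /= aN|a /=].
  have [NC|NC] := pselect (nil_part a = centralizer a); last first.
    have [sn wn] := nilpotent_type aN NC.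
    by have [/sn|/wn] := pselect (nil_part a = setT); tauto.
  have [DC|DC] := pselect (ss_part iota a = centralizer a).
    by have := generic_type aN NC DC; tauto.
  have [ss ws] := semisimple_type aN NC DC.
  by have [/ss|/ws] := pselect (ss_part iota a = setT); tauto.
by case=> [[[[|]|]|]|] [].
Qed.

(** Slow growth gives [e b = k (e a) + d] with [d] central in [E] and [k] in [L];
    rationality puts [k] in [K] and [d] in [A]. *)
Lemma semisimple_line a b : ~ alg_center A a -> ~ alg_center A b ->
  centralizer a b -> ss_part iota a <> centralizer a ->
  ss_part iota b <> centralizer b -> punctured_line_center a b.
Proof.
move=> aN bN ab Da Db.
have eig x : ss_part iota x <> centralizer x ->
    exists z la, [/\ espan e z, la != 0, z != 0 & ad (e x) z = la *: z].
  move=> Dx; have [y [Dy yC]] : exists y, ss_part iota x y /\ ~ centralizer x y.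
    apply: contrapT => /forallNP h; apply: Dx; apply/seteqP; split.
      by move=> y Dy; have /not_andP[//|/contrapT] := h y.
    exact: centralizer_ss.
  exact: (ss_eigenvector eZ e_inj Dy yC).
have [z [la [sz la0 z0 az]]] := eig a Da.
have [z' [mu [sz' mu0 z'0 bz']]] := eig b Db.
have eaN : ~ alg_center E (e a) by move=> /alg_center_e.
have ebN : ~ alg_center E (e b) by move=> /alg_center_e.
have eab : e a * e b = e b * e a by rewrite -!rmorphM; congr (e _); apply/ad_eq0.
have [k [d [dC bE]]] := commensurable L0 Ediv Ecomm eZ slow c0_central c0_free
  eaN ebN eab sz sz' la0 z0 az mu0 z'0 bz'.
have [k' kE] := rational aN dC bE.
have zC : alg_center A (b - k' *: a).
  by apply/alg_center_e; rewrite rmorphB /= eZ -kE bE addrAC subrr add0r.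
exists k', (b - k' *: a); split=> //; last by rewrite addrC subrK.
by apply/eqP => k'0; apply: bN; rewrite k'0 scale0r subr0 in zC.
Qed.

Definition kind_type (k : centralizer_kind) : A -> Prop :=
  match k with
  | AllStronglyNilpotent => SN
  | AllWeaklyNilpotent => WN
  | GenericOrStronglySemisimple => SS
  | GenericOrWeaklySemisimple => WS
  | AllGeneric => G
  end.

Lemma kind_type_inj k k' a : kind_type k a -> kind_type k' a -> k = k'.
Proof.
have aT := @noncentral_centralizer a.
case: k; case: k' => //= h h'; exfalso; rewrite /strongly_nilpotent /weakly_nilpotent
  /strongly_semisimple /weakly_semisimple /generic in h h'; move: aT;
  repeat match goal with
  | H : and3 _ _ _ |- _ => destruct H
  | H : and4 _ _ _ _ |- _ => destruct H
  | H : and5 _ _ _ _ _ |- _ => destruct H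
  end; move=> /(_ ltac:(assumption)) aT; congruence.
Qed.

Lemma kind_witness k a : ~ alg_center A a -> has_centralizer_kind iota a k ->
  exists2 x, (centralizer a `\` alg_center A) x & kind_type k x.
Proof.
move=> aN; have Sa : (centralizer a `\` alg_center A) a.
  by split=> //; apply/ad_eq0.
case: k => /= [h|h|[x [tx lx _]]|[x [tx lx _]]|h]; try by exists a => //; exact: h.
- have [] := lx x; last by exists x.
  by exists 1, 0; split; rewrite ?oner_neq0 ?scale1r ?addr0 // => y; rewrite mul0r mulr0.
- have [] := lx x; last by exists x.
  by exists 1, 0; split; rewrite ?oner_neq0 ?scale1r ?addr0 // => y; rewrite mul0r mulr0.
Qed.

Lemma kind_cover k a x : has_centralizer_kind iota a k ->
  (centralizer a `\` alg_center A) x -> kind_type k x \/ G x.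
Proof.
case: k => /= [h|h|[y [ty ly gy]]|[y [ty ly gy]]|h] Sx; try by left; exact: h.
- have [/ly[]|nl] := pselect (punctured_line_center y x); first by left.
  by right; apply: gy.
- have [/ly[]|nl] := pselect (punctured_line_center y x); first by left.
  by right; apply: gy.
Qed.

(** The types exclude each other. A witness of the type defining one kind is of the
    type defining the other kind, or generic; in the latter case a witness of the
    second kind settles the matter. *)
Lemma kind_unique k k' a : ~ alg_center A a ->
  has_centralizer_kind iota a k -> has_centralizer_kind iota a k' -> k = k'.
Proof.
move=> aN ka ka'.
have [x Sx tx] := kind_witness aN ka; have [y Sy ty] := kind_witness aN ka'.
have [/(kind_type_inj tx)//|gx] := kind_cover ka' Sx.
have [/kind_type_inj/(_ ty)//|gy] := kind_cover ka Sy.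
by rewrite (kind_type_inj (k' := AllGeneric) tx gx) (kind_type_inj (k' := AllGeneric) ty gy).
Qed.

(** All noncentral [b] in [C(a)] share [C(b) = C(a)] and [N(b) = N(a)]. If these
    differ, all are nilpotent of the same sort. If they agree and some [x] in [C(a)]
    has eigenvectors, the others with eigenvectors are on the line of [x]. *)
Theorem abstract_homogeneous : homogeneous_centralizers iota A.
Proof.
split=> [//||a aN]; first exact: abstract_dixmier_partition.
suff [k ka] : exists k, has_centralizer_kind iota a k.
  by exists k; split=> // k' ka'; exact: kind_unique aN ka ka'.
have [NC|NC] := pselect (nil_part a = centralizer a); last first.
  have NCb b : (centralizer a `\` alg_center A) b -> nil_part b <> centralizer b.
    by move=> [ab bN]; rewrite (nil_eq aN bN ab) (centralizer_eq aN bN ab).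
  have [NT|NT] := pselect (nil_part a = setT).
    exists AllStronglyNilpotent => /= b Sb; have [ab bN] := Sb.
    apply: (nilpotent_type bN (NCb b Sb)).1; by rewrite (nil_eq aN bN ab).
  exists AllWeaklyNilpotent => /= b Sb; have [ab bN] := Sb.
  apply: (nilpotent_type bN (NCb b Sb)).2; by rewrite (nil_eq aN bN ab).
have NCb b : (centralizer a `\` alg_center A) b -> nil_part b = centralizer b.
  by move=> [ab bN]; rewrite (nil_eq aN bN ab) (centralizer_eq aN bN ab).
have [[x [Sx Dx]]|none] := pselect (exists x, (centralizer a `\` alg_center A) x /\
    ss_part iota x <> centralizer x); last first.
  exists AllGeneric => /= b Sb; apply: generic_type (NCb b Sb) _; first by case: Sb.
  by apply: contrapT => Db; apply: none; exists b.
have [ax xN] := Sx.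
have line y : punctured_line_center x y ->
    [/\ (centralizer a `\` alg_center A) y, nil_part y = centralizer y,
        ss_part iota y <> centralizer y & ss_part iota y = ss_part iota x].
  move=> [k [z [k0 zC yE]]].
  have yN : ~ alg_center A y.
    move=> yC; apply: xN => w; apply/ad_eq0.
    have /ad_eq0 := yC w; rewrite yE /ad mulrDl mulrDr opprD addrACA (zC w) subrr.
    by rewrite addr0 -[_ - _]/(ad (k *: x) w) ad_scale => /eqP;
      rewrite scaler_eq0 (negPf k0) => /eqP.
  have Sy : (centralizer a `\` alg_center A) y.
    split=> //; apply/ad_eq0; move/ad_eq0: ax => ax.
    by rewrite yE mulrDr mulrDl (zC a) -scalerAr -scalerAl ax.
  have Dy : ss_part iota y = ss_part iota x by rewrite yE ss_part_line.
  split=> //; first exact: NCb.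
  rewrite Dy; case: (Sy) => ay _.
  by rewrite (centralizer_eq aN yN ay) -(centralizer_eq aN xN ax).
have rest : (centralizer a `\` alg_center A) `\` punctured_line_center x `<=`
    [set y | G y].
  move=> y [Sy nl]; have [ay yN] := Sy; apply: generic_type (NCb y Sy) _ => //.
  apply: contrapT => Dy; apply: nl; apply: semisimple_line => //.
  by rewrite (centralizer_eq aN xN ax).
have [ss ws] := semisimple_type xN (NCb x Sx) Dx.
have [DT|DT] := pselect (ss_part iota x = setT).
  exists GenericOrStronglySemisimple; exists x; split; [exact: ss| |exact: rest].
  move=> y /line[Sy NCy Dy DyE]; split=> //.
  by apply: (semisimple_type _ NCy Dy).1; [case: Sy|rewrite DyE].
exists GenericOrWeaklySemisimple; exists x; split; [exact: ws| |exact: rest].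
move=> y /line[Sy NCy Dy DyE]; split=> //.
by apply: (semisimple_type _ NCy Dy).2; [case: Sy|rewrite DyE].
Qed.

End AbstractPartition.

(** * The ring of skew Laurent series *)

Section FiniteSums.
Variable k : fieldType.
Implicit Types F G : int -> k.

(** Sums over all integers; the lemmas below apply to families of finite support. *)
Definition fsum F : k := \sum_(i \in [set: int]) F i.

Definition supported N F := forall i : int, (N < `|i|)%N -> F i = 0.

Definition int_box (N : nat) : seq int := [seq t%:Z - N%:Z | t <- iota 0 (2 * N).+1].

Lemma mem_int_box N (i : int) : (i \in int_box N) = (`|i| <= N)%N.
Proof.
apply/mapP/idP => [[t]|iN]; first by rewrite mem_iota => h ->; lia.
by exists (absz (i + N%:Z)); rewrite ?mem_iota; lia.
Qed.

Lemma int_box_uniq N : uniq (int_box N).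
Proof. by rewrite map_inj_uniq ?iota_uniq // => s t; lia. Qed.

Lemma fsumE N F : supported N F -> fsum F = \sum_(i <- int_box N) F i.
Proof.
move=> FN; rewrite /fsum (fsbigE (int_box N)) ?int_box_uniq //.
  by apply: eq_bigl => i; rewrite in_setT.
by move=> i _; rewrite mem_int_box -ltnNge; exact: FN.
Qed.

Lemma fsum_eq F G : F =1 G -> fsum F = fsum G.
Proof. by move=> FG; congr fsum; apply/funext. Qed.

Lemma fsum0 F : (forall i, F i = 0) -> fsum F = 0.
Proof. by move=> F0; apply: fsbig1. Qed.

Lemma fsumD N F G : supported N F -> supported N G ->
  fsum (fun i => F i + G i) = fsum F + fsum G.
Proof.
move=> FN GN; rewrite !(@fsumE N) ?big_split //.
by move=> i iN; rewrite FN // GN // addr0.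
Qed.

Lemma fsum_single F m : (forall i, i != m -> F i = 0) -> fsum F = F m.
Proof.
move=> Fm; rewrite (@fsumE `|m|); last first.
  by move=> i mi; apply: Fm; apply: contraTneq mi => ->; rewrite ltnn.
rewrite (bigD1_seq m) ?int_box_uniq ?mem_int_box //= big1 ?addr0 // => i; exact: Fm.
Qed.

Lemma fsum_mulr a F : a * fsum F = fsum (fun i => a * F i).
Proof. exact: mulr_fsumr. Qed.

Lemma fsum_mull a F : fsum F * a = fsum (fun i => F i * a).
Proof. exact: mulr_fsuml. Qed.

Lemma fsum_rmorph (f : {rmorphism k -> k}) N F : supported N F ->
  f (fsum F) = fsum (fun i => f (F i)).
Proof.
move=> FN; rewrite !(@fsumE N) ?rmorph_sum // => i iN.
by rewrite FN // rmorph0.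
Qed.

Lemma fsum_shift m F : fsum F = fsum (fun i => F (i - m)).
Proof.
apply: (@reindex_fsbigT _ _ _ _ _ (fun i => i - m) F).
by exists (fun i => i + m) => i; rewrite ?subrK ?addrK.
Qed.

Lemma fsum_exchange N (F : int -> int -> k) :
  (forall i j, (N < `|i|)%N || (N < `|j|)%N -> F i j = 0) ->
  fsum (fun i => fsum (F i)) = fsum (fun j => fsum (fun i => F i j)).
Proof.
move=> FN; rewrite (@fsumE N); last first.
  by move=> i iN; apply: fsum0 => j; rewrite FN ?iN.
rewrite [RHS](@fsumE N); last first.
  by move=> j jN; apply: fsum0 => i; rewrite FN // jN orbT.
rewrite (eq_bigr (fun i => \sum_(j <- int_box N) F i j)); last first.
  by move=> i _; apply: fsumE => j jN; rewrite FN // jN orbT.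
rewrite [RHS](eq_bigr (fun j => \sum_(i <- int_box N) F i j)); last first.
  by move=> j _; apply: fsumE => i iN; rewrite FN // iN.
exact: exchange_big.
Qed.

End FiniteSums.

(** A family of automorphisms [tau n] of a field [k] over a field [L], with
    [tau] additive in [n]; it twists the Laurent series below. *)
Record shift_action (L k : fieldType) := Shift {
  shift_in : {rmorphism L -> k};
  shift_tau : int -> {rmorphism k -> k};
  shift_tau0 : forall x, shift_tau 0 x = x;
  shift_tauD : forall m n x, shift_tau (m + n) x = shift_tau m (shift_tau n x);
  shift_tau_in : forall n l, shift_tau n (shift_in l) = shift_in l
}.

Definition val_ge (k : fieldType) (f : int -> k) (N : int) :=
  forall n, n < N -> f n = 0.

(** Skew Laurent series [sum_n f_n T^n] with [T a = tau 1 a T]. *)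
Record laurent (L k : fieldType) (s : shift_action L k) := Laurent {
  laurent_coef :> int -> k;
  laurent_coefP : `[< exists N, val_ge laurent_coef N >] }.

Section SkewLaurent.
Variables (L k : fieldType) (s : shift_action L k).
Local Notation tau := (shift_tau s).
Local Notation laurent := (laurent s).
Implicit Types (m n N M : int).

HB.instance Definition _ := gen_eqMixin laurent.
HB.instance Definition _ := gen_choiceMixin laurent.

Implicit Types f g h : laurent.

Lemma coef_low f : exists N, val_ge f N.
Proof. exact/asboolP/laurent_coefP. Qed.

Lemma laurentP f g : f =1 g -> f = g.
Proof.
case: f g => [f fP] [g gP] /= /funext fg; rewrite fg in fP *.
by congr Laurent; exact: bool_irrelevance.
Qed.

Lemma val_ge_leq (f : int -> k) N M : M <= N -> val_ge f N -> val_ge f M.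
Proof. by move=> MN fN n nM; apply: fN; exact: lt_le_trans MN. Qed.

Definition mklaurent (f : int -> k) (fP : exists N, val_ge f N) : laurent :=
  Laurent s (introT (asboolP _) fP).

Lemma laurent_add_bounded f g : exists N, val_ge (fun n => f n + g n) N.
Proof.
have [N fN] := coef_low f; have [M gM] := coef_low g.
exists (Num.min N M) => n; rewrite lt_min => /andP[nN nM].
by rewrite fN // gM // addr0.
Qed.

Lemma laurent_opp_bounded f : exists N, val_ge (fun n => - f n) N.
Proof. by have [N fN] := coef_low f; exists N => n /fN ->; rewrite oppr0. Qed.

Definition laurent_add f g := mklaurent (laurent_add_bounded f g).
Definition laurent_opp f := mklaurent (laurent_opp_bounded f).
Definition laurent_zero : laurent :=
  mklaurent (ex_intro (fun N => val_ge (fun=> 0) N) 0 (fun n _ => erefl)).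

Lemma laurent_addA : associative laurent_add.
Proof. by move=> f g h; apply: laurentP => n /=; rewrite addrA. Qed.
Lemma laurent_addC : commutative laurent_add.
Proof. by move=> f g; apply: laurentP => n /=; rewrite addrC. Qed.
Lemma laurent_add0 : left_id laurent_zero laurent_add.
Proof. by move=> f; apply: laurentP => n /=; rewrite add0r. Qed.
Lemma laurent_addN : left_inverse laurent_zero laurent_opp laurent_add.
Proof. by move=> f; apply: laurentP => n /=; rewrite addNr. Qed.

HB.instance Definition _ :=
  GRing.isZmodule.Build laurent laurent_addA laurent_addC laurent_add0 laurent_addN.

Lemma lcoefD f g n : (f + g) n = f n + g n. Proof. by []. Qed.
Lemma lcoefN f n : (- f) n = - f n. Proof. by []. Qed.
Definition laurent_conv (f g : int -> k) n := fsum (fun i => f i * tau i (g (n - i))).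

Lemma laurent_conv_supported (f g : int -> k) N M n : val_ge f N -> val_ge g M ->
  supported (`|N| + `|n - M|)%N (fun i => f i * tau i (g (n - i))).
Proof.
move=> fN gM i iNM; have [iN|iN] := ltP i N; first by rewrite fN // mul0r.
by rewrite gM ?rmorph0 ?mulr0 //; lia.
Qed.

Lemma laurent_conv_low (f g : int -> k) N M : val_ge f N -> val_ge g M ->
  val_ge (laurent_conv f g) (N + M).
Proof.
move=> fN gM n nNM; apply: fsum0 => i.
have [iN|iN] := ltP i N; first by rewrite fN // mul0r.
by rewrite gM ?rmorph0 ?mulr0 //; lia.
Qed.

Lemma laurent_mul_bounded f g : exists N, val_ge (laurent_conv f g) N.
Proof.
have [N fN] := coef_low f; have [M gM] := coef_low g.
by exists (N + M); exact: laurent_conv_low.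
Qed.

Definition laurent_mul f g := mklaurent (laurent_mul_bounded f g).

Lemma lmono_bounded (c : k) m : exists N, val_ge (fun n => if n == m then c else 0) N.
Proof. by exists m => n nm; rewrite lt_eqF. Qed.

(** The series [c T^m]. *)
Definition lmono (c : k) m : laurent := mklaurent (lmono_bounded c m).

Lemma lmono_mul c m f n : laurent_mul (lmono c m) f n = c * tau m (f (n - m)).
Proof.
rewrite /= /laurent_conv (@fsum_single _ _ m) ?eqxx // => i /negPf ->.
by rewrite mul0r.
Qed.

Lemma mul_lmono c m f n : laurent_mul f (lmono c m) n = f (n - m) * tau (n - m) c.
Proof.
rewrite /= /laurent_conv (@fsum_single _ _ (n - m)) => [|i inm].
  by rewrite subKr eqxx.
by rewrite ifF ?rmorph0 ?mulr0 //; apply: contra_neqF inm => /eqP; lia.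
Qed.

(** Both sides are the sum of [f_p tau_p(g_(l-p)) tau_l(h_(n-l))] over all [p] and [l];
    the support is finite because the three series are bounded below. *)
Lemma laurent_mulA : associative laurent_mul.
Proof.
move=> f g h; apply: laurentP => n /=.
have [N fN] := coef_low f; have [M gM] := coef_low g; have [P hP] := coef_low h.
pose F (p l : int) := f p * tau p (g (l - p)) * tau l (h (n - l)).
transitivity (fsum (fun p => fsum (fun l => F p l))).
  apply: fsum_eq => p /=; rewrite /laurent_conv.
  rewrite (fsum_rmorph _ (laurent_conv_supported (n := n - p) gM hP)) fsum_mulr.
  rewrite (fsum_shift p); apply: fsum_eq => l; rewrite /F rmorphM /=.
  rewrite -shift_tauD addrCA subrr addr0 mulrA; congr (_ * tau _ (h _)); lia.
rewrite (@fsum_exchange _ (`|N| + `|M| + `|P| + `|n|)); last first.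
  move=> p l pl; rewrite /F; have [pN|pN] := ltP p N; first by rewrite fN // !mul0r.
  have [lM|lM] := ltP (l - p) M; first by rewrite gM // rmorph0 mulr0 mul0r.
  by rewrite hP ?rmorph0 ?mulr0 //; lia.
by apply: fsum_eq => l /=; rewrite -fsum_mull.
Qed.

Lemma laurent_mul1l : left_id (lmono 1 0) laurent_mul.
Proof.
by move=> f; apply: laurentP => n; rewrite lmono_mul mul1r subr0 shift_tau0.
Qed.

Lemma laurent_mul1r : right_id (lmono 1 0) laurent_mul.
Proof.
by move=> f; apply: laurentP => n; rewrite mul_lmono subr0 rmorph1 mulr1.
Qed.

Lemma laurent_mulDl : left_distributive laurent_mul +%R.
Proof.
move=> f g h; apply: laurentP => n /=.
have [N fN] := coef_low f; have [M gM] := coef_low g; have [P hP] := coef_low h.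
pose Q := Num.min N M.
rewrite -(fsumD (laurent_conv_supported (n := n) (val_ge_leq (_ : Q <= N) fN) hP)
  (laurent_conv_supported (n := n) (val_ge_leq (_ : Q <= M) gM) hP)) ?ge_min ?lexx ?orbT //.
by apply: fsum_eq => i; rewrite mulrDl.
Qed.

Lemma laurent_mulDr : right_distributive laurent_mul +%R.
Proof.
move=> f g h; apply: laurentP => n /=.
have [N fN] := coef_low f; have [M gM] := coef_low g; have [P hP] := coef_low h.
pose Q := Num.min M P.
rewrite -(fsumD (laurent_conv_supported (n := n) fN (val_ge_leq (_ : Q <= M) gM))
  (laurent_conv_supported (n := n) fN (val_ge_leq (_ : Q <= P) hP))) ?ge_min ?lexx ?orbT //.
by apply: fsum_eq => i; rewrite rmorphD mulrDr.
Qed.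

Lemma laurent_1_neq0 : lmono 1 0 != 0 :> laurent.
Proof.
apply/eqP => /(congr1 (fun f : laurent => f 0)) /= /eqP.
by rewrite oner_eq0.
Qed.

HB.instance Definition _ := GRing.Zmodule_isNzRing.Build laurent
  laurent_mulA laurent_mul1l laurent_mul1r laurent_mulDl laurent_mulDr
  laurent_1_neq0.

End SkewLaurent.

(** * Valuation and inverses of skew Laurent series *)

Section SkewLaurentDivision.
Variables (L k : fieldType) (s : shift_action L k).
Local Notation tau := (shift_tau s).
Local Notation E := (laurent s).
Implicit Types (m n N M : int) (f g h u : E).

Lemma lcoefM f g n : (f * g) n = laurent_conv s f g n. Proof. by []. Qed.
Lemma lcoef1 n : (1 : E) n = if n == 0 then 1 else 0. Proof. by []. Qed.
Lemma lcoefB f g n : (f - g) n = f n - g n. Proof. by []. Qed.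

Lemma coef_lmono_mul c m f n : (lmono s c m * f) n = c * tau m (f (n - m)).
Proof. exact: lmono_mul. Qed.

Lemma coef_mul_lmono c m f n : (f * lmono s c m) n = f (n - m) * tau (n - m) c.
Proof. exact: mul_lmono. Qed.

Lemma val_geM f g N M : val_ge f N -> val_ge g M -> val_ge (f * g) (N + M).
Proof. exact: laurent_conv_low. Qed.

Lemma val_geD f g N : val_ge f N -> val_ge g N -> val_ge (f + g) N.
Proof. by move=> fN gN n nN; rewrite lcoefD fN // gN // addr0. Qed.

Lemma val_geN f N : val_ge f N -> val_ge (- f) N.
Proof. by move=> fN n nN; rewrite lcoefN fN // oppr0. Qed.

Lemma val_geX u (n : nat) : val_ge u 1 -> val_ge (u ^+ n) n%:Z.
Proof.
move=> u1; elim: n => [|n IHn]; first by move=> m m0; rewrite lcoef1 lt_eqF.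
by rewrite exprS intS; exact: val_geM.
Qed.

Lemma low_coefM f g N M : val_ge f N -> val_ge g M ->
  (f * g) (N + M) = f N * tau N (g M).
Proof.
move=> fN gM; rewrite lcoefM /laurent_conv (@fsum_single _ _ N); last first.
  move=> i iN; have [lt_iN|] := ltP i N; first by rewrite fN // mul0r.
  move=> le_Ni; rewrite gM ?rmorph0 ?mulr0 //.
  by move/eqP: iN; lia.
by rewrite addrAC subrr add0r.
Qed.

Definition isval f N := val_ge f N /\ f N != 0.

Lemma isval_ex f : f != 0 -> exists N, isval f N.
Proof.
move=> f0; have [N fN] := coef_low f.
have [n fn] : exists n, f n != 0.
  apply: contrapT => /forallNP f00; move/eqP: f0; apply; apply: laurentP => n.
  by apply/eqP/negPn/negP; exact: f00.
have ex : exists t : nat, f (N + t%:Z) != 0.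
  exists (absz (n - N)); have -> : N + `|n - N|%N = n; last by [].
  have [nN|nN] := ltP n N; [by rewrite fN ?eqxx in fn | lia].
have := ex_minnP ex; case=> t ft tmin; exists (N + t%:Z); split=> // m mt.
have [mN|mN] := ltP m N; first exact: fN.
apply/eqP/negPn/negP => fm; have := tmin (absz (m - N)).
have -> : N + `|m - N|%N = m by lia.
by move=> /(_ fm); lia.
Qed.

Lemma isval_unique f N M : isval f N -> isval f M -> N = M.
Proof.
move=> [fN fN0] [fM fM0]; apply/eqP; rewrite eq_le.
apply/andP; split; rewrite leNgt; apply/negP => lt.
  by rewrite fN ?eqxx in fM0.
by rewrite fM ?eqxx in fN0.
Qed.

Lemma isval_neq0 f N : isval f N -> f != 0.
Proof. by case=> _; apply: contraNneq => ->. Qed.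

Lemma isvalM f g N M : isval f N -> isval g M -> isval (f * g) (N + M).
Proof.
move=> [fN fN0] [gM gM0]; split; first exact: val_geM.
by rewrite low_coefM // mulf_neq0 // fmorph_eq0.
Qed.

Lemma val_ge_eq0 f : (forall N, val_ge f N) -> f = 0.
Proof. by move=> fN; apply: laurentP => n; apply: (fN (n + 1)); lia. Qed.

(** The inverse of [1 - u] is the sum of the powers of [u]; only the first
    [n + 1] of them contribute to the coefficient of index [n]. *)
Lemma geometric_bounded u :
  exists N, val_ge (fun n => (\sum_(m < (absz n).+1) u ^+ m) n *+ (0 <= n)%R) N.
Proof. by exists 0 => n n0; rewrite leNgt n0 mulr0n. Qed.

Definition geometric u : E := mklaurent s (geometric_bounded u).

Lemma lcoef_sum (I : Type) (r : seq I) (P : pred I) (F : I -> E) n :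
  (\sum_(i <- r | P i) F i) n = \sum_(i <- r | P i) F i n.
Proof. by elim/big_rec2: _ => // i x y _ <-. Qed.

Lemma geometric_approx u (M : nat) : val_ge u 1 ->
  val_ge (geometric u - \sum_(m < M) u ^+ m) M%:Z.
Proof.
move=> u1 n nM; rewrite lcoefB /=; have [n0|n0] := leP 0 n; last first.
  rewrite mulr0n lcoef_sum big1 ?subrr // => i _.
  by apply: val_geX => //; lia.
rewrite mulr1n !lcoef_sum; apply/eqP; rewrite subr_eq0; apply/eqP.
have le_nM : ((absz n).+1 <= M)%N by lia.
rewrite (big_ord_widen _ (fun i => (u ^+ i) n) le_nM) big_mkcond /=.
apply: eq_bigr => i _; case: ifP => // /negbT; rewrite -leqNgt => ni.
by rewrite (val_geX (n := i) u1) //; lia.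
Qed.

Lemma geometric_mulr u : val_ge u 1 -> (1 - u) * geometric u = 1.
Proof.
move=> u1; apply/eqP; rewrite -subr_eq0; apply/eqP/val_ge_eq0 => N.
pose M := absz N; apply: (@val_ge_leq _ _ M%:Z); first by rewrite /M; lia.
pose P := \sum_(m < M) u ^+ m.
have -> : (1 - u) * geometric u - 1 = (1 - u) * (geometric u - P) - u ^+ M.
  have uP : (1 - u) * P = 1 - u ^+ M.
    by rewrite -opprB mulNr -subrX1 opprB.
  by rewrite mulrBr uP opprB [_ ^+ _ - 1]addrC addrA addrK.
apply: val_geD; last exact/val_geN/val_geX.
rewrite -[M%:Z]add0r; apply: val_geM; last exact: geometric_approx.
move=> n n0; rewrite lcoefB lcoef1 lt_eqF // sub0r u1 ?oppr0 //; lia.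
Qed.

Lemma geometric_one u : val_ge u 1 -> val_ge (1 - geometric u) 1.
Proof.
move=> u1; rewrite -opprB; apply: val_geN.
by have := geometric_approx (M := 1) u1; rewrite big_ord1 expr0.
Qed.

(** The right inverse of [1 - u] is again of the form [1 - u'], so it has a right
    inverse in turn, and is two-sided. *)
Lemma one_sub_inverse u : val_ge u 1 ->
  exists g, (1 - u) * g = 1 /\ g * (1 - u) = 1.
Proof.
move=> u1; exists (geometric u); split; first exact: geometric_mulr.
have := geometric_mulr (geometric_one u1); rewrite subKr.
set t := geometric (1 - _) => gt.
suff -> : 1 - u = t by [].
transitivity ((1 - u) * (geometric u * t)); first by rewrite gt mulr1.
by rewrite mulrA geometric_mulr // mul1r.
Qed.

(** Dividing by the lowest term reduces to a series [1 - u] with [u] of positive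
    valuation. *)
Lemma laurent_inverse f : f != 0 -> exists g, g * f = 1 /\ f * g = 1.
Proof.
move=> /isval_ex[N [fN fN0]]; pose m := lmono s (f N) N.
pose m' := lmono s (tau (- N) (f N)^-1) (- N).
have mm' : m * m' = 1.
  apply: laurentP => n; rewrite coef_lmono_mul lcoef1 /=.
  have [->|n0] := eqVneq n 0.
    by rewrite sub0r eqxx -shift_tauD subrr shift_tau0 divff.
  by rewrite ifF ?rmorph0 ?mulr0 //; apply: contra_neqF n0 => /eqP; lia.
have m'm : m' * m = 1.
  apply: laurentP => n; rewrite coef_lmono_mul lcoef1 /=.
  have [->|n0] := eqVneq n 0.
    by rewrite sub0r opprK eqxx -rmorphM mulVf // rmorph1.
  by rewrite ifF ?rmorph0 ?mulr0 //; apply: contra_neqF n0 => /eqP; lia.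
have u1 : val_ge (1 - m' * f) 1.
  move=> n n1; rewrite lcoefB lcoef1 coef_lmono_mul opprK.
  have [->|n0] := eqVneq n 0.
    by rewrite add0r -rmorphM mulVf // rmorph1 subrr.
  by rewrite (fN (n + N)); [rewrite rmorph0 mulr0 subrr|move/eqP: n0; lia].
have [g [vg gv]] := one_sub_inverse u1; rewrite subKr in vg gv.
exists (g * m'); split; first by rewrite -mulrA.
have -> : f = m * (m' * f) by rewrite mulrA mm' mul1r.
by rewrite -mulrA [m' * f * _]mulrA vg mul1r.
Qed.

Definition laurent_inv f : E :=
  if pselect (f != 0) is left f0 then projT1 (cid (laurent_inverse f0)) else f.

Lemma laurent_mulV : {in [pred f : E | f != 0], left_inverse 1 laurent_inv *%R}.
Proof.
move=> f; rewrite inE => f0; rewrite /laurent_inv; case: pselect => // f0'.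
by case: cid => g [].
Qed.

Lemma laurent_mulrV : {in [pred f : E | f != 0], right_inverse 1 laurent_inv *%R}.
Proof.
move=> f; rewrite inE => f0; rewrite /laurent_inv; case: pselect => // f0'.
by case: cid => g [].
Qed.

Lemma laurent_unitP f g : g * f = 1 /\ f * g = 1 -> [pred f : E | f != 0] f.
Proof.
case=> gf _; rewrite /=; apply/eqP => f0.
by move/eqP: gf; rewrite f0 mulr0 eq_sym oner_eq0.
Qed.

Lemma laurent_inv_out : {in [predC [pred f : E | f != 0]], laurent_inv =1 id}.
Proof.
move=> f; rewrite !inE negbK => f0; rewrite /laurent_inv; case: pselect => // f1.
by exfalso; move/negP: f1; apply.
Qed.

HB.instance Definition _ := GRing.NzRing_hasMulInverse.Build E
  laurent_mulV laurent_mulrV laurent_unitP laurent_inv_out.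

Lemma laurent_unit f : f != 0 -> f \is a GRing.unit.
Proof. by []. Qed.

Definition laurent_scale (l : L) f : E := lmono s (shift_in s l) 0 * f.

Lemma coef_scale l f n : laurent_scale l f n = shift_in s l * f n.
Proof. by rewrite coef_lmono_mul subr0 shift_tau0. Qed.

Lemma laurent_scaleA l l' f :
  laurent_scale l (laurent_scale l' f) = laurent_scale (l * l') f.
Proof. by apply: laurentP => n; rewrite !coef_scale rmorphM mulrA. Qed.

Lemma laurent_scale1 : left_id 1 laurent_scale.
Proof. by move=> f; apply: laurentP => n; rewrite coef_scale rmorph1 mul1r. Qed.

Lemma laurent_scaleDr : right_distributive laurent_scale +%R.
Proof. by move=> l f g; exact: mulrDr. Qed.

Lemma laurent_scaleDl f : {morph laurent_scale^~ f : l l' / l + l'}.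
Proof.
by move=> l l'; apply: laurentP => n; rewrite lcoefD !coef_scale rmorphD mulrDl.
Qed.

HB.instance Definition _ := GRing.Zmodule_isLmodule.Build L E
  laurent_scaleA laurent_scale1 laurent_scaleDr laurent_scaleDl.

Lemma laurent_scaleAl (l : L) f g : l *: (f * g) = (l *: f) * g.
Proof. exact: mulrA. Qed.

HB.instance Definition _ := GRing.Lmodule_isLalgebra.Build L E laurent_scaleAl.

Lemma laurent_scaleAr (l : L) f g : l *: (f * g) = f * (l *: g).
Proof.
rewrite -[LHS]/(lmono s _ 0 * (f * g)) -[l *: g]/(lmono s _ 0 * g) !mulrA.
congr (_ * _); apply: laurentP => n; rewrite coef_lmono_mul coef_mul_lmono subr0 shift_tau0.
by rewrite shift_tau_in mulrC.
Qed.

HB.instance Definition _ := GRing.Lalgebra_isAlgebra.Build L E laurent_scaleAr.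

Lemma lcoefZ l f n : (l *: f) n = shift_in s l * f n.
Proof. exact: coef_scale. Qed.

End SkewLaurentDivision.

(** * Centralizers in the skew Laurent series *)

Section LaurentCentralizers.
Variables (L k : fieldType) (s : shift_action L k).
Local Notation tau := (shift_tau s).
Local Notation E := (laurent s).
Hypothesis tau_fix : forall n x, n != 0 -> tau n x = x -> tau 1 x = x.
Implicit Types (m n N M : int) (a b c f g h u : E).

Lemma tau_fixed x n : tau 1 x = x -> tau n x = x.
Proof.
move=> x1; have x1' : tau (-1) x = x.
  by rewrite -{1}x1 -shift_tauD addNr shift_tau0.
elim: n => [|n IHn|n IHn]; first by rewrite shift_tau0.
  by rewrite intS shift_tauD IHn.
by rewrite intS opprD shift_tauD IHn.
Qed.

Lemma lmono_central x : tau 1 x = x -> alg_center E (lmono s x 0).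
Proof.
move=> x1 f; apply: laurentP => n.
by rewrite coef_lmono_mul coef_mul_lmono subr0 shift_tau0 tau_fixed // mulrC.
Qed.

Lemma isval1 : isval (1 : E) 0.
Proof. by split; [move=> n n0; rewrite lcoef1 lt_eqF|rewrite lcoef1 eqxx oner_neq0]. Qed.

Lemma isvalV f N : isval f N -> isval f^-1 (- N).
Proof.
move=> fN; have f0 := isval_neq0 fN.
have [M fM] : exists M, isval f^-1 M by apply: isval_ex; rewrite invr_eq0.
have := isvalM fN fM; rewrite divrr ?laurent_unit // => /(isval_unique isval1) NM.
by have -> : - N = M by lia.
Qed.

Lemma isvalX f N (q : nat) : isval f N -> isval (f ^+ q) (q%:Z * N).
Proof.
move=> fN; elim: q => [|q IHq]; first by rewrite mul0r; exact: isval1.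
by rewrite exprS intS mulrDl mul1r; exact: isvalM.
Qed.

Lemma isval_exprz f N (q : int) : isval f N -> isval (f ^ q) (q * N).
Proof.
move=> fN; case: q => q; first exact: isvalX.
by rewrite NegzE -exprnN mulNr; apply: isvalV; exact: isvalX.
Qed.

(** Elements of the same valuation commuting with [a] have proportional leading
    coefficients, which is where the nonzero valuation of [a] is used. *)
Lemma leading_ratio a b c n m : n != 0 -> isval a n -> isval b m -> val_ge c m ->
  a * b = b * a -> a * c = c * a -> tau 1 (c m / b m) = c m / b m.
Proof.
move=> n0 [an an0] [bm bm0] cm ab ac; apply: (tau_fix n0).
have tb0 : tau n (b m) != 0 by rewrite fmorph_eq0.
have Eb := congr1 (fun f : E => f (n + m)) ab.
have Ec := congr1 (fun f : E => f (n + m)) ac.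
rewrite /= [LHS]low_coefM // [n + m]addrC [RHS]low_coefM // in Eb.
rewrite /= [LHS]low_coefM // [n + m]addrC [RHS]low_coefM // in Ec.
rewrite fmorph_div /=; apply: (mulfI an0); rewrite mulrA Ec.
apply: (mulIf tb0); rewrite divfK // [RHS]mulrAC Eb.
by field.
Qed.

(** Commutation is a closed condition for the topology of the valuation. *)
Lemma commute_limit b c :
  (forall M, exists2 q, val_ge (c - q) M & b * q = q * b) -> b * c = c * b.
Proof.
move=> approx; apply/eqP; rewrite -subr_eq0; apply/eqP/val_ge_eq0 => N.
have [B bB] := coef_low b.
have [q cq bq] := approx (N - B).
have -> : b * c - c * b = b * (c - q) - (c - q) * b.
  by rewrite mulrBr mulrBl bq opprB addrA subrK.
have NE : N = B + (N - B) by lia.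
apply: val_geD; first by rewrite NE; exact: val_geM bB cq.
by apply: val_geN; rewrite NE [B + _]addrC; exact: val_geM cq bB.
Qed.

(** [u] of least positive valuation in the centralizer of [a] topologically
    generates it over the centre: every element is a limit of elements of the double
    centralizer of [u]. Approximating one factor shows first that the centralizer
    commutes with [u], then that it is commutative. *)
Lemma centralizer_nonzero_val a n b c : isval a n -> n != 0 ->
  a * b = b * a -> a * c = c * a -> b * c = c * b.
Proof.
move=> an n0 ab ac.
have exd : exists d : nat, `[< (0 < d)%N /\ exists u, a * u = u * a /\ isval u d >].
  have [n_pos|n_neg] := leP 0 n.
    exists (absz n); apply/asboolP; split; first by move/eqP: n0; lia.
    by exists a; split=> //; have -> : (absz n : int) = n by lia.
  exists (absz n); apply/asboolP; split; first lia.
  have ua : a \is a GRing.unit by apply/laurent_unit/isval_neq0/an.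
  exists a^-1; split; first by rewrite divrr // mulVr.
  have nE : (absz n : int) = - n by lia. by rewrite nE; exact: isvalV.
have := ex_minnP exd; case=> d /asboolP[d_pos [u [au ud]]] dmin.
have u0 := isval_neq0 ud; have uu := laurent_unit u0.
have a_exp (q : int) : a * u ^ q = u ^ q * a by exact: commrXz.
have dvd f m : a * f = f * a -> isval f m -> exists q : int, m = q * d%:Z.
  move=> af fm; exists (m %/ d%:Z)%Z.
  have r0 := modz_ge0 m (d := d%:Z) ltac:(lia).
  have rd := ltz_mod m (d := d%:Z) ltac:(lia).
  have mE := divz_eq m d.
  pose g := f * u ^ (- (m %/ d)%Z).
  have gr : isval g (m %% d)%Z.
    have -> : (m %% d)%Z = m + (- (m %/ d)%Z) * d%:Z by lia.
    exact: isvalM fm (isval_exprz _ ud).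
  have [r_eq0|r_neq0] := eqVneq (m %% d)%Z 0; first by lia.
  have := dmin (absz (m %% d)%Z); move/(_ _)/wrap => [|]; last lia.
  apply/asboolP; split; first by move/eqP: r_neq0; lia.
  exists g; split; first by rewrite /g mulrA af -mulrA a_exp mulrA.
  by have -> : (absz (m %% d)%Z : int) = (m %% d)%Z by lia.
have approx (t : nat) f N : a * f = f * a -> val_ge f (N - t%:Z) ->
    exists2 q, val_ge (f - q) N & forall x, u * x = x * u -> q * x = x * q.
  elim: t f => [|t IHt] f af ft.
    exists 0; first by rewrite subr0 -[N]subr0.
    by move=> x _; rewrite mul0r mulr0.
  pose m := N - t.+1%:Z; have mS : N - t%:Z = m + 1 by rewrite /m; lia.
  have [fm0|fm0] := eqVneq (f m) 0.
    apply: IHt => // i; rewrite mS => im; have [->//|im'] := eqVneq i m.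
    by apply: ft; rewrite -/m; move/eqP: im'; lia.
  have [q mE] := dvd f m af (conj ft fm0).
  have um : isval (u ^ q) m by rewrite mE; exact: isval_exprz.
  have rfix := leading_ratio n0 an um ft (a_exp q) af.
  set r := f m / _ in rfix; have rC := lmono_central rfix.
  pose g := lmono s r 0 * u ^ q.
  have gm i : g i = r * (u ^ q) i by rewrite coef_lmono_mul subr0 shift_tau0.
  have [|i|q1 q1N q1C] := IHt (f - g).
  - by rewrite mulrBr mulrBl af /g mulrA -rC -!mulrA a_exp.
  - rewrite mS => im; rewrite lcoefB gm; have [->|im'] := eqVneq i m.
      by rewrite /r divfK ?subrr //; case: um.
    have lt_im : i < m by move/eqP: im'; lia.
    by rewrite ft // (um.1 i lt_im) mulr0 subr0.
  exists (g + q1); first by rewrite opprD addrA.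
  move=> x ux; rewrite mulrDl mulrDr q1C //; congr (_ + _).
  have uqx : u ^ q * x = x * u ^ q by apply: commr_sym; apply: commrXz; exact/esym.
  by rewrite /g -[LHS]mulrA uqx [LHS]mulrA [RHS]mulrA rC.
have approx' f M : a * f = f * a ->
    exists2 q, val_ge (f - q) M & forall x, u * x = x * u -> q * x = x * q.
  move=> af; have [B fB] := coef_low f; apply: (approx (absz (M - B))) => //.
  by apply: val_ge_leq fB; lia.
have uc : u * c = c * u.
  apply: commute_limit => M; have [q qM qC] := approx' c M ac; exists q => //.
  by rewrite qC.
have ub : u * b = b * u.
  apply: commute_limit => M; have [q qM qC] := approx' b M ab; exists q => //.
  by rewrite qC.
apply: commute_limit => M; have [q qM qC] := approx' c M ac; exists q => //.
by rewrite qC.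
Qed.

(** A fixed constant term is central, and subtracting it leaves a series of positive
    valuation. If the constant term is not fixed, every element of the centralizer
    has valuation [0], while a commutator of such elements has no constant term. *)
Theorem laurent_centralizers a : ~ alg_center E a ->
  forall b c, a * b = b * a -> a * c = c * a -> b * c = c * b.
Proof.
move=> aN b c ab ac.
have a0 : a != 0 by apply/eqP => a0; apply: aN => x; rewrite a0 mul0r mulr0.
have [n an] := isval_ex a0.
have [n0|n0] := eqVneq n 0; last exact: centralizer_nonzero_val an n0 ab ac.
rewrite {n}n0 in an; pose x := a 0.
have [xfix|xfix] := pselect (tau 1 x = x).
  have xC := lmono_central xfix; pose a' := a - lmono s x 0.
  have a'0 : a' != 0.
    by rewrite subr_eq0; apply/eqP => aE; apply: aN; rewrite aE.
  have [n a'n] := isval_ex a'0.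
  have n0 : n != 0.
    apply/eqP => n0; move: a'n; rewrite n0 => -[_].
    by rewrite lcoefB /= ?eqxx subrr eqxx.
  by apply: (centralizer_nonzero_val a'n n0); rewrite mulrBl mulrBr xC ?ab ?ac.
have val0 f m : a * f = f * a -> isval f m -> m = 0.
  move=> af [fm fm0]; apply/eqP/negPn/negP => m0; apply: xfix; apply: (tau_fix m0).
  have E1 : (a * f) (0 + m) = a 0 * tau 0 (f m) by apply: low_coefM; case: an.
  have E2 : (f * a) (m + 0) = f m * tau m (a 0) by apply: low_coefM; case: an.
  move: E1; rewrite af add0r -{1}[m]addr0 E2 shift_tau0 mulrC => /(mulIf fm0).
  by [].
have low f : a * f = f * a -> val_ge f 0.
  move=> af; have [->//|f0] := eqVneq f 0.
  by have [m fm] := isval_ex f0; rewrite -(val0 f m af fm); case: fm.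
apply/eqP; rewrite -subr_eq0; apply/negPn/negP => h0.
have ah : a * (b * c - c * b) = (b * c - c * b) * a.
  by rewrite mulrBr mulrBl !mulrA ab ac -!mulrA ab ac.
have [m hm] := isval_ex h0; have m0 := val0 _ _ ah hm.
have lowM f g : a * f = f * a -> a * g = g * a -> (f * g) 0 = f 0 * g 0.
  by move=> af ag; rewrite -[in LHS](addr0 0) low_coefM ?shift_tau0 //; exact: low.
by case: hm => _; rewrite m0 lcoefB !lowM // [c 0 * _]mulrC subrr eqxx.
Qed.

End LaurentCentralizers.

(** * Rational functions in the Casimir element and H *)

Lemma subf_div (F : fieldType) (n d n' d' : F) : d != 0 -> d' != 0 ->
  n / d - n' / d' = (n * d' - n' * d) / (d * d').
Proof. by move=> d0 d'0; field; rewrite d0 d'0. Qed.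

Section FractionFields.
Variables (R : idomainType).
Local Notation "x %:F" := (@FracField.tofrac R x).

Lemma fraction_ex (x : {fraction R}) : exists n d : R, d != 0 /\ x = n%:F / d%:F.
Proof.
have [n [d [d0 xE]]] : exists n d : R, d != 0 /\ x * d%:F = n%:F.
  elim/quotW: x => x; exists (frac x).1, (frac x).2; split; first exact: denom_ratioP.
  unlock FracField.tofrac; rewrite -[LHS]FracField.pi_mul; apply/eqmodP => /=.
  rewrite FracField.equivfE /FracField.mulf /=.
  by rewrite !numden_Ratio ?mulf_neq0 ?oner_neq0 ?denom_ratioP // !mulr1 mulrC.
by exists n, d; split=> //; rewrite -xE mulfK // tofrac_eq0.
Qed.

Lemma fraction_morph_eq (F : fieldType) (g h : {rmorphism {fraction R} -> F}) :
  (forall p, g p%:F = h p%:F) -> g =1 h.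
Proof.
move=> gh x; have [n [d [d0 ->]]] := fraction_ex x.
by rewrite !fmorph_div !gh.
Qed.

Lemma fraction_extend (F : fieldType) (f : {rmorphism R -> F}) : injective f ->
  exists g : {rmorphism {fraction R} -> F}, forall p, g p%:F = f p.
Proof.
move=> f_inj; have f0 d : d != 0 -> f d != 0.
  by rewrite -(rmorph0 f) (inj_eq f_inj).
have /(_ _)/cid-/all_tag[num /(_ _)/cid-/all_tag[den dP]] := fraction_ex.
pose g x := f (num x) / f (den x).
have gE x n d : d != 0 -> x = n%:F / d%:F -> g x = f n / f d.
  move=> d0 xE; have [e0 xE'] := dP x; apply/eqP; rewrite /g eqr_div ?f0 //.
  rewrite -!rmorphM (inj_eq f_inj) -tofrac_eq !rmorphM /= -eqr_div ?tofrac_eq0 //.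
  by rewrite -xE -xE'.
have gD : zmod_morphism g.
  move=> x y; have [dx xE] := dP x; have [dy yE] := dP y.
  rewrite (@gE (x - y) (num x * den y - num y * den x) (den x * den y)) ?mulf_neq0 //.
    by rewrite rmorphB !rmorphM /g subf_div ?f0.
  by rewrite {1}xE {1}yE rmorphB !rmorphM /= subf_div ?tofrac_eq0.
have gM : monoid_morphism g.
  split; first by rewrite (@gE 1 1 1) ?oner_neq0 ?rmorph1 ?divr1.
  move=> x y; have [dx xE] := dP x; have [dy yE] := dP y.
  rewrite (@gE (x * y) (num x * num y) (den x * den y)) ?mulf_neq0 //.
    by rewrite !rmorphM /= /g mulf_div.
  by rewrite {1}xE {1}yE !rmorphM /= mulf_div.
pose G : {rmorphism {fraction R} -> F} :=
  HB.pack g (GRing.isZmodMorphism.Build _ _ g gD) (GRing.isMonoidMorphism.Build _ _ g gM).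
by exists G => p; rewrite /= (@gE _ p 1) ?oner_neq0 ?rmorph1 ?divr1.
Qed.

End FractionFields.

Section Shift.
Variable L : fieldType.
Local Notation R := {poly {poly L}}.
Local Notation k := {fraction R}.
Local Notation "x %:F" := (@FracField.tofrac R x).

Definition int_poly (n : int) : {poly {poly L}} := 'X + (n%:~R)%:P.

Definition poly_shift n : {rmorphism R -> R} :=
  GRing.RMorphism.clone _ _ (fun p : R => p \Po int_poly n) _.

Lemma poly_shiftE n (p : R) : poly_shift n p = p \Po ('X + (n%:~R)%:P).
Proof. by []. Qed.

Lemma poly_shift0 p : poly_shift 0 p = p.
Proof. by rewrite poly_shiftE addr0 comp_polyXr. Qed.

Lemma poly_shiftD m n p : poly_shift (m + n) p = poly_shift m (poly_shift n p).
Proof.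
rewrite !poly_shiftE -comp_polyA; congr (_ \Po _).
by rewrite comp_polyD comp_polyX comp_polyC rmorphD polyCD addrA.
Qed.

Lemma poly_shift_inj n : injective ((@FracField.tofrac R) \o poly_shift n : R -> k).
Proof.
move=> p q /eqP; rewrite /= tofrac_eq => /eqP pq.
have {}pq : poly_shift n p = poly_shift n q by exact: pq.
by rewrite -[p]poly_shift0 -[q]poly_shift0 -(addNr n) !poly_shiftD pq.
Qed.

Lemma tau_ex n : exists g : {rmorphism k -> k}, forall p, g p%:F = (poly_shift n p)%:F.
Proof.
exact: (@fraction_extend _ _ (GRing.RMorphism.clone _ _
  ((@FracField.tofrac R) \o poly_shift n) _) (@poly_shift_inj n)).
Qed.

Definition frac_tau n : {rmorphism k -> k} := projT1 (cid (tau_ex n)).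

Lemma frac_tauE n p : frac_tau n p%:F = (poly_shift n p)%:F.
Proof. by rewrite /frac_tau; case: cid => g /= ->. Qed.

Definition frac_in : {rmorphism L -> k} :=
  GRing.RMorphism.clone _ _ ((@FracField.tofrac R) \o polyC \o polyC) _.

Lemma frac_tau0 x : frac_tau 0 x = x.
Proof.
apply: (fraction_morph_eq (g := frac_tau 0) (h := idfun)) => p /=.
by rewrite frac_tauE poly_shift0.
Qed.

Lemma frac_tauD m n x : frac_tau (m + n) x = frac_tau m (frac_tau n x).
Proof.
apply: (fraction_morph_eq (g := frac_tau (m + n)) (h := frac_tau m \o frac_tau n)) => p /=.
by rewrite !frac_tauE poly_shiftD.
Qed.

Lemma frac_tau_in n l : frac_tau n (frac_in l) = frac_in l.
Proof. by rewrite /= frac_tauE poly_shiftE comp_polyC. Qed.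

(** On rational functions in [C] and [H], [tau n] substitutes [H + n] for [H]. *)
Definition H_shift : shift_action L k := Shift frac_tau0 frac_tauD frac_tau_in.

End Shift.

(** A rational function of [H] taking equal values at [h0 + m n] for all [m] is
    constant in [H]. *)
Lemma periodic_const (K : fieldType) (p r : {poly {poly K}}) (h0 : {poly K}) (n : int) :
  [pchar K] =i pred0 -> n != 0 ->
  (forall m : nat, p.[h0] * r.[h0 + (m%:Z * n)%:~R] =
                   r.[h0] * p.[h0 + (m%:Z * n)%:~R]) ->
  p.[h0] *: r = r.[h0] *: p.
Proof.
move=> K0 n0 per; apply/eqP; rewrite -subr_eq0; set q := _ - _.
apply: contraT => q0; pose rs := [seq h0 + (m%:Z * n)%:~R | m <- iota 0 (size q)].
have : (size rs < size q)%N.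
  apply: max_poly_roots q0 _ _.
    apply/allP => x /mapP[m _ ->]; rewrite /root /q !hornerE per subrr //.
  rewrite map_inj_uniq ?iota_uniq // => m m' /addrI.
  have K0' : [pchar {poly K}] =i pred0.
    by move=> i; rewrite pchar_poly K0.
  by move=> /(intr_inj_pchar0 K0') /(mulIf n0) [].
by rewrite size_map size_iota ltnn.
Qed.

Lemma nonroot_ex (K : fieldType) (r : {poly {poly K}}) :
  [pchar K] =i pred0 -> r != 0 -> exists h0, r.[h0] != 0.
Proof.
move=> K0 r0; apply: contrapT => /forallNP none.
pose rs := [seq i%:R%:P : {poly K} | i <- iota 0 (size r)].
have : (size rs < size r)%N.
  apply: max_poly_roots r0 _ _.
    by apply/allP => x _; apply: contrapT => rx; apply: (none x); apply/negP.
  by rewrite map_inj_uniq ?iota_uniq // => m m' /polyC_inj /(natr_inj_pchar0 K0).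
by rewrite size_map size_iota ltnn.
Qed.

Section FixedFractions.
Variables (K L : fieldType) (iota : {rmorphism K -> L}).
Hypothesis L0 : [pchar L] =i pred0.
Local Notation k := {fraction {poly {poly L}}}.
Local Notation tau := (shift_tau (H_shift L)).

(** [K[C][H]] inside [L(C, H)]. *)
Definition fraction_emb : {rmorphism {poly {poly K}} -> k} :=
  GRing.RMorphism.clone _ _
    ((@FracField.tofrac {poly {poly L}}) \o (map_poly (map_poly iota))) _.

Lemma fraction_embE p :
  fraction_emb p = @FracField.tofrac {poly {poly L}} (map_poly (map_poly iota) p).
Proof. by []. Qed.

Lemma fraction_emb_inj : injective fraction_emb.
Proof.
move=> p q /eqP; rewrite !fraction_embE tofrac_eq => /eqP.
by apply: map_inj_poly; [exact: map_poly_inj|exact: rmorph0].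
Qed.

Lemma fraction_emb_eq0 p : (fraction_emb p == 0) = (p == 0).
Proof. by rewrite -(inj_eq fraction_emb_inj) rmorph0. Qed.

Lemma fraction_emb_tau n p : tau n (fraction_emb p) = fraction_emb (poly_shift K n p).
Proof.
rewrite /= frac_tauE poly_shiftE poly_shiftE; congr (FracField.tofrac _).
rewrite map_comp_poly; congr (_ \Po _).
by rewrite [RHS]rmorphD /= map_polyX map_polyC /= !rmorph_int.
Qed.

(** The shift has infinite order, so a fixed rational function takes the same value at
    infinitely many translates of a point where its denominator does not vanish. *)
Lemma fixed_fraction x n (p r : {poly {poly K}}) : n != 0 -> tau n x = x ->
  r != 0 -> x * fraction_emb r = fraction_emb p ->
  exists p0 r0 : {poly K}, r0 != 0 /\ x * fraction_emb r0%:P = fraction_emb p0%:P.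
Proof.
move=> n0 xn r0 xr; have K0 : [pchar K] =i pred0.
  by move=> i; rewrite -(fmorph_pchar iota) L0.
have xmn m : tau (m%:Z * n) x = x.
  elim: m => [|m IHm]; first by rewrite mul0r shift_tau0.
  by rewrite intS mulrDl mul1r shift_tauD IHm.
have per m : p * poly_shift K (m%:Z * n) r = r * poly_shift K (m%:Z * n) p.
  apply: fraction_emb_inj; rewrite !rmorphM -!fraction_emb_tau -xr rmorphM xmn.
  by rewrite [x * _]mulrC -!mulrA [x * _]mulrC.
have [h0 rh0] := nonroot_ex K0 r0.
have pr : p.[h0] *: r = r.[h0] *: p.
  apply: (periodic_const (n := n)) => // m.
  have := congr1 (fun q => q.[h0]) (per m).
  by rewrite !poly_shiftE !hornerM !horner_comp !hornerE.
exists p.[h0], r.[h0]; split=> //.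
have er0 : fraction_emb r != 0 by rewrite fraction_emb_eq0.
apply: (mulIf er0); rewrite mulrAC xr -!rmorphM; congr (fraction_emb _).
by rewrite !mul_polyC pr mulrC mul_polyC.
Qed.

End FixedFractions.

(** The fixed fraction is a quotient of polynomials in [C] alone, so every shift fixes
    it. *)
Lemma H_shift_fix (L : fieldType) : [pchar L] =i pred0 -> forall n x, n != 0 ->
  shift_tau (H_shift L) n x = x -> shift_tau (H_shift L) 1 x = x.
Proof.
move=> L0 n x n0 xn; have [p [r [r0 xE]]] := fraction_ex x.
have embE q : fraction_emb idfun q = @FracField.tofrac {poly {poly L}} q.
  by rewrite fraction_embE !map_poly_id // => ? _; rewrite map_poly_id.
have [|p0 [r0' [r0'0 xr]]] := @fixed_fraction _ _ (idfun : {rmorphism L -> L}) L0 x n p r n0 xn r0.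
  by rewrite !embE xE divfK // tofrac_eq0.
have e0 : fraction_emb (idfun : {rmorphism L -> L}) r0'%:P != 0.
  by rewrite fraction_emb_eq0 polyC_eq0.
have tau1 q : shift_tau (H_shift L) 1 (fraction_emb (idfun : {rmorphism L -> L}) q%:P)
   = fraction_emb (idfun : {rmorphism L -> L}) q%:P.
  by rewrite fraction_emb_tau poly_shiftE comp_polyC.
by apply: (mulIf e0); rewrite -{1}[fraction_emb _ _]tau1 -rmorphM xr tau1.
Qed.

(** * Weight monomials *)

Section Sl2Triple.
Variables (K : fieldType) (B : algType K) (X Y H : B).
Hypotheses (HX : H * X - X * H = X) (HY : H * Y - Y * H = - Y).
Hypothesis XY : X * Y - Y * X = H *+ 2.
Implicit Types (n : int) (u v : B).

Let C := Y * X + H * (H + 1).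

Lemma sl2_HX : H * X = X * (H + 1).
Proof. by rewrite mulrDr mulr1 -[X in _ = _ + X]HX addrC subrK. Qed.

Lemma sl2_HY : H * Y = Y * (H - 1).
Proof. by rewrite mulrBr mulr1 -[X in _ = _ + X]HY addrC subrK. Qed.

Lemma sl2_XH : X * H = (H - 1) * X.
Proof. by rewrite mulrBl mul1r sl2_HX mulrDr mulr1 addrK. Qed.

Lemma sl2_YH : Y * H = (H + 1) * Y.
Proof. by rewrite mulrDl mul1r sl2_HY mulrBr mulr1 subrK. Qed.

Lemma sl2_CE : C = Y * X + (H ^+ 2 + H).
Proof. by rewrite /C mulrDr mulr1 expr2. Qed.

Lemma sl2_YX : Y * X = C - H ^+ 2 - H.
Proof. by rewrite sl2_CE -[RHS]addrA -opprD addrK. Qed.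

Lemma sl2_XY : X * Y = C - H ^+ 2 + H.
Proof.
have -> : X * Y = Y * X + H *+ 2 by rewrite -XY addrC subrK.
by rewrite sl2_YX mulr2n addrA subrK.
Qed.

Lemma sl2_CH : C * H = H * C.
Proof.
rewrite sl2_CE mulrDl [RHS]mulrDr; congr (_ + _); last first.
  by rewrite mulrDl mulrDr -exprS -exprSr.
by rewrite -mulrA sl2_XH mulrA -sl2_HY mulrA.
Qed.

Lemma sl2_CX : C * X = X * C.
Proof.
rewrite [in RHS]/C mulrDr !mulrA sl2_XY sl2_XH -[_ * X * (H + 1)]mulrA -sl2_HX.
rewrite mulrA -mulrDl; congr (_ * _).
by rewrite mulrBl mul1r -expr2 -addrA [H + _]addrC !subrK.
Qed.

Lemma sl2_CY : C * Y = Y * C.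
Proof.
have CE : C = X * Y + H * (H - 1).
  by rewrite sl2_XY mulrBr mulr1 -expr2 -addrA [H + _]addrC !subrK.
rewrite [in RHS]CE mulrDr !mulrA sl2_YX sl2_YH -[_ * Y * (H - 1)]mulrA -sl2_HY.
rewrite mulrA -mulrDl; congr (_ * _).
by rewrite mulrDl mul1r -expr2 -addrA [- H + _]addrC addrK subrK.
Qed.

Lemma sl2_HXn m : H * X ^+ m = X ^+ m * (H + m%:R).
Proof.
elim: m => [|m IHm]; first by rewrite addr0 mul1r mulr1.
rewrite exprSr mulrA IHm -!mulrA; congr (_ * _).
rewrite mulrDl sl2_HX mulr_natl -mulr_natr -mulrDr; congr (_ * _).
by rewrite -[m.+1]addn1 natrD addrAC addrA.
Qed.

Lemma sl2_HYn m : H * Y ^+ m = Y ^+ m * (H - m%:R).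
Proof.
elim: m => [|m IHm]; first by rewrite subr0 mul1r mulr1.
rewrite exprSr mulrA IHm -!mulrA; congr (_ * _).
rewrite mulrBl sl2_HY mulr_natl -mulr_natr -mulrBr; congr (_ * _).
by rewrite -[m.+1]addn1 natrD opprD addrAC addrA.
Qed.

Definition weight n : B := match n with Posz m => X ^+ m | Negz m => Y ^+ m.+1 end.

(** [p1 C + p2 H^2 + p3 H + p4]: the polynomials that occur when a generator is
    moved past a weight vector. *)
Definition quad (p : K * K * K * K) : B :=
  p.1.1.1 *: C + p.1.1.2 *: H ^+ 2 + p.1.2 *: H + p.2%:A.

Lemma sl2_H2 v (x : B) : H * v = v * x -> H ^+ 2 * v = v * x ^+ 2.
Proof. by move=> Hv; rewrite !expr2 -mulrA Hv mulrA Hv mulrA. Qed.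

Lemma quadE c (x : K) : C - (H + x%:A) ^+ 2 + c *: (H + x%:A) =
  quad (1, -1, c - x *+ 2, c * x - x ^+ 2).
Proof.
have sq : (H + x%:A) ^+ 2 = H ^+ 2 + x *: H + (x *: H + (x ^+ 2)%:A).
  by rewrite expr2 mulrDl !mulrDr !mulr_algl mulr_algr scalerA -!expr2 !addrA.
rewrite sq /quad /= scale1r scaleN1r scalerDr scalerA.
rewrite !scalerBl mulr2n scalerDl !opprD !addrA.
by rewrite [RHS](ACl (1*2*4*5*7*3*6)%AC).
Qed.

Lemma quad1 : quad (0, 0, 0, 1) = 1.
Proof. by rewrite /quad /= !scale0r !add0r scale1r. Qed.

Lemma weight_X n : exists p, X * weight n = weight (n + 1) * quad p.
Proof.
case: n => m.
  exists (0, 0, 0, 1); rewrite quad1 mulr1 addrC -intS /= exprS //.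
exists (1, -1, 1 - (- m%:R) *+ 2, 1 * (- m%:R) - (- m%:R) ^+ 2).
have -> : weight (Negz m + 1) = Y ^+ m.
  by case: m => [|m] //; have -> : Negz m.+1 + 1 = Negz m by lia.
rewrite -quadE /= exprS mulrA sl2_XY mulrDl mulrBl.
have mE : H + (- m%:R)%:A = H - m%:R :> B by rewrite scaleNr scaler_nat.
have HY_ := sl2_HYn m; rewrite mE HY_ (sl2_H2 HY_) scale1r.
have CYm : C * Y ^+ m = Y ^+ m * C by apply: commrX; exact: sl2_CY.
by rewrite CYm -mulrBr -mulrDr.
Qed.

Lemma weight_Y n : exists p, Y * weight n = weight (n - 1) * quad p.
Proof.
case: n => [[|m]|m].
- by exists (0, 0, 0, 1); rewrite quad1 !mulr1.
- exists (1, -1, -1 - (m%:R) *+ 2, -1 * m%:R - m%:R ^+ 2).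
  have -> : weight (m.+1%:Z - 1) = X ^+ m by have -> : m.+1%:Z - 1 = m by lia.
  rewrite -quadE /= exprS mulrA sl2_YX !mulrBl.
  have HX_ := sl2_HXn m; rewrite scaler_nat HX_ (sl2_H2 HX_) scaleN1r.
  have CXm : C * X ^+ m = X ^+ m * C by apply: commrX; exact: sl2_CX.
  by rewrite CXm -!mulrBr.
- exists (0, 0, 0, 1); rewrite quad1 mulr1.
  have -> : Negz m - 1 = Negz m.+1 by lia.
  by rewrite /= [RHS]exprS.
Qed.

Lemma weight_H n : exists p, H * weight n = weight n * quad p.
Proof.
case: n => m; last exists (0, 0, 1, - m.+1%:R); first exists (0, 0, 1, m%:R).
  by rewrite /= sl2_HXn /quad /= !scale0r !add0r scale1r scaler_nat.
by rewrite /= sl2_HYn /quad /= !scale0r !add0r scale1r scaleNr scaler_nat.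
Qed.

Definition monomial n i l : B := weight n * (H ^+ i * C ^+ l).

(** Weights at most [d] in absolute value, degree at most [2 d] in [H] and [d] in the
    Casimir element: a generator raises the degree in [C] by one or that in [H] by
    two, so each generator maps level [d] to level [d + 1]. *)
Definition mon_basis (d : nat) : seq B :=
  [seq monomial (p.1%:Z - d%:Z) p.2.1 p.2.2
    | p <- allpairs pair (iota 0 (2 * d).+1)
             (allpairs pair (iota 0 (2 * d).+1) (iota 0 d.+1))].

Lemma size_mon_basis d : (size (mon_basis d) <= 4 * d.+1 ^ 3)%N.
Proof.
rewrite size_map !size_allpairs !size_iota.
have h : ((2 * d).+1 <= 2 * d.+1)%N by lia.
apply: (@leq_trans ((2 * d.+1) * (2 * d.+1 * d.+1))%N).
  by rewrite leq_mul // leq_mul.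
by rewrite !expnS expn0 muln1 !mulnA; lia.
Qed.

Lemma mem_mon_basis d n i l : (absz n <= d)%N -> (i <= 2 * d)%N -> (l <= d)%N ->
  monomial n i l \in mon_basis d.
Proof.
move=> nd id_ ld; apply/mapP; exists (absz (n + d%:Z), (i, l)).
  apply/allpairsP; exists (absz (n + d%:Z), (i, l)); split=> //.
    by rewrite mem_iota /=; lia.
  by apply/allpairsP; exists (i, l); split=> //; rewrite mem_iota /=; lia.
by congr monomial; rewrite /=; lia.
Qed.

Lemma mon_basisP d x : x \in mon_basis d -> exists n i l,
  [/\ (absz n <= d)%N, (i <= 2 * d)%N, (l <= d)%N & x = monomial n i l].
Proof.
move=> /mapP[p /allpairsP[[t q] [td /allpairsP[[i l] [id_ ld qE]] pE]] ->].
exists (t%:Z - d%:Z), i, l; move: td id_ ld; rewrite !mem_iota /= => td id_ ld.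
by split; [lia|lia|lia|rewrite pE /= in qE *; rewrite qE].
Qed.

Lemma mon_basis_mono d d' x : (d <= d')%N ->
  inspan (mon_basis d) x -> inspan (mon_basis d') x.
Proof.
move=> dd'; apply: inspan_trans => y /mon_basisP[n [i [l [nd id_ ld ->]]]].
by apply: inspan_mem; apply: mem_mon_basis; lia.
Qed.

Lemma quad_monomial d n i l p : (absz n <= d.+1)%N -> (i <= 2 * d)%N -> (l <= d)%N ->
  inspan (mon_basis d.+1) (weight n * quad p * (H ^+ i * C ^+ l)).
Proof.
move=> nd id_ ld; have CHi : C * H ^+ i = H ^+ i * C by apply: commrX; exact: sl2_CH.
have qE : quad p * (H ^+ i * C ^+ l) = p.1.1.1 *: (H ^+ i * C ^+ l.+1) +
    p.1.1.2 *: (H ^+ i.+2 * C ^+ l) + p.1.2 *: (H ^+ i.+1 * C ^+ l) +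
    p.2 *: (H ^+ i * C ^+ l).
  rewrite /quad !mulrDl -!scalerAl mul1r; congr (_ *: _ + _ *: _ + _ *: _ + _).
  - by rewrite mulrA CHi exprS mulrA.
  - by rewrite mulrA -exprD.
  - by rewrite mulrA -exprS.
rewrite -mulrA qE !mulrDr -!scalerAr.
have mon i' l' : (i' <= 2 * d.+1)%N -> (l' <= d.+1)%N ->
    inspan (mon_basis d.+1) (weight n * (H ^+ i' * C ^+ l')).
  by move=> *; apply: inspan_mem; apply: mem_mon_basis.
by do ![apply: inspanD]; apply: inspanZ; apply: mon; lia.
Qed.

Lemma gen_mon_basis g d x : (g = X \/ g = Y \/ g = H) ->
  inspan (mon_basis d) x -> inspan (mon_basis d.+1) (g * x).
Proof.
move=> gE [c ->]; rewrite mulr_sumr; apply: inspan_sum => j _.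
rewrite -scalerAr; apply: inspanZ.
have /mon_basisP[n [i [l [nd id_ ld ->]]]] :
  (mon_basis d)`_j \in mon_basis d by exact: mem_nth.
rewrite /monomial (mulrA g); case: gE => [->|[->|->]].
- by have [p ->] := weight_X n; apply: quad_monomial => //; lia.
- by have [p ->] := weight_Y n; apply: quad_monomial => //; lia.
- by have [p ->] := weight_H n; apply: quad_monomial => //; lia.
Qed.

End Sl2Triple.

(** * Growth of the enveloping algebra and its image in the series *)

Section Usl2Growth.
Variable K : fieldType.
Local Notation U := (Usl2 K).
Local Notation X := (usl2X K).
Local Notation Y := (usl2Y K).
Local Notation H := (usl2H K).
Local Notation basis := (mon_basis X Y H).
Implicit Types (u x : U).

Lemma usl2_classD t t' : usl2_class (TmAdd t t') = usl2_class t + usl2_class t' :> U.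
Proof. exact: esym (usl2_addE t t'). Qed.

Lemma usl2_classM t t' : usl2_class (TmMul t t') = usl2_class t * usl2_class t' :> U.
Proof. exact: esym (usl2_mulE t t'). Qed.

Lemma usl2_classC k : usl2_class (TmCst k) = k%:A :> U.
Proof. exact: esym (usl2_mulr1 _). Qed.

(** [D] bounds the length in the generators of an expression of [u]. *)
Lemma usl2_mul_basis u : exists D, forall d x,
  inspan (basis d) x -> inspan (basis (D + d)) (u * x).
Proof.
elim/usl2_ind: u; elim=> [|||k|t [D Dt] t' [D' Dt']|t [D Dt] t' [D' Dt']].
- exists 1%N => d x; apply: gen_mon_basis; rewrite ?usl2_HX ?usl2_HY ?usl2_XY //.
  by left.
- exists 1%N => d x; apply: gen_mon_basis; rewrite ?usl2_HX ?usl2_HY ?usl2_XY //.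
  by right; left.
- exists 1%N => d x; apply: gen_mon_basis; rewrite ?usl2_HX ?usl2_HY ?usl2_XY //.
  by right; right.
- by exists 0%N => d x dx; rewrite usl2_classC mulr_algl; exact: inspanZ.
- exists (D + D')%N => d x dx; rewrite usl2_classD mulrDl; apply: inspanD.
    by apply: mon_basis_mono (Dt d x dx); lia.
  by apply: mon_basis_mono (Dt' d x dx); lia.
- exists (D + D')%N => d x dx; rewrite usl2_classM -mulrA -addnA.
  by apply: Dt; exact: Dt'.
Qed.

Lemma one_in_basis : inspan (basis 0) 1.
Proof.
have <- : monomial X Y H 0 0 0 = 1 by rewrite /monomial /= !mulr1.
by apply: inspan_mem; exact: mem_mon_basis.
Qed.

Lemma usl2_in_basis u : exists D, inspan (basis D) u.
Proof.
have [D Du] := usl2_mul_basis u; exists (D + 0)%N.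
by rewrite -[u]mulr1; apply: Du; exact: one_in_basis.
Qed.

Lemma usl2_products (s : seq U) : exists D, forall N y,
  y \in products s N -> inspan (basis (D * N)) y.
Proof.
have [D Ds] : exists D, forall u, u \in s -> forall d x,
    inspan (basis d) x -> inspan (basis (D + d)) (u * x).
  elim: s => [|u s [D Ds]]; first by exists 0%N.
  have [D' Du] := usl2_mul_basis u; exists (D + D')%N => v; rewrite inE.
  case/orP=> [/eqP ->|vs] d x dx.
    by apply: mon_basis_mono (Du d x dx); lia.
  by apply: mon_basis_mono (Ds v vs d x dx); lia.
exists D; elim=> [|N IHN] y.
  by rewrite /= inE muln0 => /eqP ->; exact: one_in_basis.
move=> /allpairsP[[u x] /= [us xN ->]]; rewrite mulnS.
by apply: Ds => //; exact: IHN.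
Qed.

(** At length [4 n] the dimension is at most [4 (4 D n + 1)^3], which is less than
    [n^4] once [n] exceeds [4 (4 D + 1)^3]. *)
Lemma usl2_slow_growth : slow_growth U.
Proof.
move=> s; have [D Ds] := usl2_products (1 :: s).
pose n := (4 * (4 * D).+1 ^ 3).+1; exists n.
have dim : (span_dim (products (1%R :: s) (4 * n)) <= 4 * (D * (4 * n)).+1 ^ 3)%N.
  apply: leq_trans (size_mon_basis X Y H (D * (4 * n))).
  exact: span_dim_le (@Ds _).
apply: (leq_ltn_trans dim).
have h : ((D * (4 * n)).+1 <= (4 * D).+1 * n)%N by rewrite /n; lia.
apply: (@leq_ltn_trans (4 * ((4 * D).+1 * n) ^ 3)).
  by rewrite leq_mul2l leq_exp2r.
rewrite expnMn mulnA [(n ^ 4)%N]expnS ltn_pmul2r ?expn_gt0 ?/n //.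
Qed.

End Usl2Growth.

Section SeriesMonomials.
Variables (L k : fieldType) (s : shift_action L k).
Local Notation tau := (shift_tau s).
Implicit Types (a b : k) (m n : int).

Lemma lmonoM a m b n : lmono s a m * lmono s b n = lmono s (a * tau m b) (m + n).
Proof.
apply: laurentP => i; rewrite coef_lmono_mul /=.
have -> : (i - m == n) = (i == m + n) by rewrite subr_eq addrC.
by case: ifP => _; rewrite ?rmorph0 ?mulr0.
Qed.

Lemma lmonoD a b n : lmono s (a + b) n = lmono s a n + lmono s b n.
Proof. by apply: laurentP => i; rewrite lcoefD /=; case: ifP; rewrite ?addr0. Qed.

Lemma lmonoN a n : lmono s (- a) n = - lmono s a n.
Proof. by apply: laurentP => i; rewrite lcoefN /=; case: ifP; rewrite ?oppr0. Qed.

Lemma lmono_scalar l : l%:A = lmono s (shift_in s l) 0 :> laurent s.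
Proof. exact: mulr1. Qed.

End SeriesMonomials.

Section Usl2Series.
Variables (K L : fieldType) (iota : {rmorphism K -> L}).
Local Notation U := (Usl2 K).
Local Notation X := (usl2X K).
Local Notation Y := (usl2Y K).
Local Notation H := (usl2H K).
Local Notation C := (casimir K).
Local Notation S := (H_shift L).
Local Notation E := (laurent S).
Local Notation emb := (fraction_emb iota).

(** [X] raises the [H]-weight, so it is the inverse of the series variable, which
    shifts [H] upwards; [Y] is then forced by [Y X = C - H^2 - H]. *)
Definition serX : E := lmono S 1 (-1).
Definition serY : E := lmono S (emb ('X%:P - 'X ^+ 2 - 'X)) 1.
Definition serH : E := lmono S (emb 'X) 0.

Definition ser_cst : {rmorphism K -> E} :=
  GRing.RMorphism.clone _ _ (GRing.in_alg E \o iota) _.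

Lemma tauX n : shift_tau S n (emb 'X) = emb ('X + (n%:~R)%:P).
Proof. by rewrite fraction_emb_tau poly_shiftE comp_polyX. Qed.

Lemma tau_const n (p : {poly K}) : shift_tau S n (emb p%:P) = emb p%:P.
Proof. by rewrite fraction_emb_tau poly_shiftE comp_polyC. Qed.

Lemma ser_HX : serH * serX - serX * serH = serX.
Proof.
rewrite !lmonoM rmorph1 tauX mulr1 mul1r add0r addr0 -lmonoN -lmonoD -rmorphB.
by rewrite opprD addrA subrr sub0r -polyCN rmorphN1 opprK rmorph1.
Qed.

Lemma ser_HY : serH * serY - serY * serH = - serY.
Proof.
rewrite !lmonoM shift_tau0 tauX add0r addr0 -!lmonoN -lmonoD -!rmorphM -rmorphB.
by congr (lmono S _ 1); rewrite -rmorphN; congr (emb _); rewrite polyC1; ring.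
Qed.

Lemma ser_XY : serX * serY - serY * serX = serH *+ 2.
Proof.
pose g : {poly {poly K}} := 'X%:P - 'X ^+ 2 - 'X.
have -> : serX * serY = lmono S (emb (poly_shift K (-1) g)) 0.
  by rewrite lmonoM mul1r fraction_emb_tau.
have -> : serY * serX = lmono S (emb g) 0 by rewrite lmonoM rmorph1 mulr1.
rewrite -lmonoN -lmonoD /g.
rewrite mulr2n -lmonoD; congr (lmono S _ 0); rewrite -rmorphB -rmorphD.
congr (emb _); rewrite poly_shiftE !comp_polyB comp_polyC comp_polyX expr2.
by rewrite comp_polyM comp_polyX !rmorphN1; ring.
Qed.

Lemma ser_cstC k b : ser_cst k * b = b * ser_cst k.
Proof. by rewrite /= mulr_algl mulr_algr. Qed.

Definition ser_eval (u : U) : E := usl2_eval ser_cst serX serY serH (usl2_repr u).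

Lemma ser_evalE t : ser_eval (usl2_class t) = usl2_eval ser_cst serX serY serH t.
Proof.
apply: (usl2_eval_cong ser_cstC ser_HX ser_HY ser_XY); exact: usl2_repr_cong.
Qed.

Lemma ser_eval_zmod : zmod_morphism ser_eval.
Proof.
elim/usl2_ind => t; elim/usl2_ind => u.
have -> : usl2_class t - usl2_class u =
    usl2_class (TmAdd t (TmMul (TmCst (- 1)) u)) :> U.
  by rewrite usl2_classD usl2_classM usl2_classC scaleN1r mulN1r.
by rewrite !ser_evalE /= rmorphN1 scaleN1r mulN1r.
Qed.

Lemma ser_eval_monoid : monoid_morphism ser_eval.
Proof.
split; first by rewrite -[1]scale1r -usl2_classC ser_evalE /= rmorph1 scale1r.
elim/usl2_ind => t; elim/usl2_ind => u.
by rewrite -usl2_classM !ser_evalE.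
Qed.

HB.instance Definition _ := GRing.isZmodMorphism.Build U E ser_eval ser_eval_zmod.
HB.instance Definition _ := GRing.isMonoidMorphism.Build U E ser_eval ser_eval_monoid.

Lemma ser_evalZ k u : ser_eval (k *: u) = iota k *: ser_eval u.
Proof.
have -> : k *: u = usl2_class (TmCst k) * u by rewrite usl2_classC mulr_algl.
by rewrite ser_eval_monoid.2 ser_evalE /= mulr_algl.
Qed.

Lemma ser_evalX : ser_eval X = serX. Proof. exact: ser_evalE. Qed.
Lemma ser_evalY : ser_eval Y = serY. Proof. exact: ser_evalE. Qed.
Lemma ser_evalH : ser_eval H = serH. Proof. exact: ser_evalE. Qed.

Lemma ser_scalar k : ser_eval k%:A = lmono S (emb k%:P%:P) 0.
Proof.
rewrite ser_evalZ rmorph1 lmono_scalar; congr (lmono S _ 0).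
by rewrite fraction_embE /= map_polyC /= map_polyC.
Qed.

Lemma lmono_embD p q n : lmono S (emb (p + q)) n = lmono S (emb p) n + lmono S (emb q) n.
Proof. by rewrite rmorphD lmonoD. Qed.

Lemma lmono_embM p q : lmono S (emb (p * q)) 0 = lmono S (emb p) 0 * lmono S (emb q) 0.
Proof. by rewrite lmonoM shift_tau0 rmorphM addr0. Qed.

Lemma ser_casimir : ser_eval C = lmono S (emb 'X%:P) 0.
Proof.
rewrite /casimir rmorphD !rmorphM rmorphD rmorph1 /= ser_evalX ser_evalY ser_evalH.
have -> : (1 : E) = lmono S (emb 1) 0 by rewrite rmorph1.
rewrite -lmono_embD -lmono_embM lmonoM rmorph1 mulr1 subrr -lmono_embD.
by congr (lmono S (emb _) 0); ring.
Qed.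

(** [K[C][H] -> Usl(2)]; the outer variable is [H]. *)
Definition usl2_poly (q : {poly {poly K}}) : U := (map_poly (horner_alg C) q).[H].

Lemma ser_horner_casimir (p : {poly K}) :
  ser_eval (horner_alg C p) = lmono S (emb p%:P) 0.
Proof.
elim/poly_ind: p => [|p k IHp].
  by rewrite !rmorph0 /=; apply: laurentP => n /=; rewrite if_same.
rewrite !rmorphD !rmorphM /= horner_algX horner_algC IHp ser_casimir ser_scalar.
by rewrite lmonoD lmonoM shift_tau0 addr0.
Qed.

Lemma ser_usl2_poly q : ser_eval (usl2_poly q) = lmono S (emb q) 0.
Proof.
elim/poly_ind: q => [|q p IHq].
  rewrite /usl2_poly !rmorph0 horner0 rmorph0.
  by apply: laurentP => n /=; rewrite if_same.
rewrite /usl2_poly rmorphD rmorphM /= map_polyX map_polyC hornerMXaddC -/(usl2_poly q).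
rewrite rmorphD rmorphM /= IHq ser_evalH ser_horner_casimir.
by rewrite lmono_embD lmono_embM.
Qed.

End Usl2Series.

(** * Normal form and injectivity *)

Lemma lmono_exp (L k : fieldType) (s : shift_action L k) (a : k) (m : int) n : a != 0 ->
  exists2 b, b != 0 & lmono s a m ^+ n = lmono s b (n%:Z * m).
Proof.
move=> a0; elim: n => [|n [b b0 IHn]]; first by exists 1; rewrite ?oner_neq0 // mul0r.
exists (a * shift_tau s m b); first by rewrite mulf_neq0 // fmorph_eq0.
by rewrite exprS IHn lmonoM intS mulrDl mul1r.
Qed.

Section SeriesOfUsl2.
Variables (K L : fieldType) (iota : {rmorphism K -> L}).
Local Notation U := (Usl2 K).
Local Notation X := (usl2X K).
Local Notation Y := (usl2Y K).
Local Notation H := (usl2H K).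
Local Notation S := (H_shift L).
Local Notation E := (laurent S).
Local Notation emb := (fraction_emb iota).
Local Notation e := (ser_eval iota).
Local Notation ev := (@usl2_poly K).

Lemma ser_weight n : exists2 w, w != 0 & e (weight X Y n) = lmono S w (- n).
Proof.
case: n => m /=; rewrite rmorphXn /= ?ser_evalX ?ser_evalY.
  have [w w0 ->] := @lmono_exp _ _ S 1 (-1) m (oner_neq0 _).
  by exists w; rewrite // mulrN1.
have [|w w0 ->] := @lmono_exp _ _ S (emb ('X%:P - 'X ^+ 2 - 'X)) 1 m.+1.
  rewrite fraction_emb_eq0; apply/eqP => /(congr1 (fun p : {poly {poly K}} => p`_2)).
  rewrite !coefB coefC coefXn coefX coef0 /= !subr0 sub0r => /eqP.
  by rewrite oppr_eq0 oner_eq0.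
by exists w; rewrite // mulr1 NegzE opprK.
Qed.

Lemma usl2_polyD p q : ev (p + q) = ev p + ev q.
Proof. by rewrite /usl2_poly rmorphD hornerD. Qed.

Lemma usl2_poly0 : ev 0 = 0.
Proof. by rewrite /usl2_poly rmorph0 horner0. Qed.

Lemma usl2_polyZ k q : ev (k%:P%:P * q) = k *: ev q.
Proof.
by rewrite /usl2_poly rmorphM /= map_polyC /= horner_algC mul_polyC hornerZ mulr_algl.
Qed.

Lemma usl2_poly_mon i l : ev ('X ^+ i * ('X ^+ l)%:P) = H ^+ i * casimir K ^+ l.
Proof.
have CH : casimir K * H = H * casimir K.
  exact: (sl2_CH (usl2_HX K) (usl2_HY K)).
rewrite mulrC mul_polyC /usl2_poly map_polyZ /= map_polyXn hornerZ hornerXn.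
rewrite rmorphXn /= horner_algX; apply: commrX; apply/commr_sym/commrX.
by apply: commr_sym.
Qed.

(** The spanning monomials of the same weight combine into one coefficient. *)
Lemma usl2_normal_form u : exists D (q : nat -> {poly {poly K}}),
  u = \sum_(t < (2 * D).+1) weight X Y (t%:Z - D%:Z) * ev (q t).
Proof.
have [D [c ->]] := usl2_in_basis u; exists D.
elim/big_rec: _ => [|i v _ [q ->]].
  by exists (fun=> 0); rewrite big1 // => t _; rewrite usl2_poly0 mulr0.
have [n [a [l [nD aD lD ->]]]] := mon_basisP (mem_nth 0 (ltn_ord i)).
pose t0 := absz (n + D%:Z).
exists (fun t => (if t == t0 then (c i)%:P%:P * ('X ^+ a * ('X ^+ l)%:P) else 0) + q t).
have lt_t0 : (t0 < (2 * D).+1)%N by rewrite /t0; lia.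
under [RHS]eq_bigr do rewrite usl2_polyD mulrDr.
rewrite big_split /=; congr (_ + _).
rewrite (bigD1 (Ordinal lt_t0)) //= eqxx big1 ?addr0; last first.
  by move=> t; rewrite -val_eqE /= => /negPf ->; rewrite usl2_poly0 mulr0.
rewrite usl2_polyZ usl2_poly_mon -scalerAr /monomial; congr (_ *: (weight _ _ _ * _)).
by rewrite /t0; lia.
Qed.

(** The summands of the normal form go to distinct powers of the series variable. *)
Lemma ser_eval_inj : injective e.
Proof.
move=> u v uv; apply/eqP; rewrite -subr_eq0; apply/eqP.
have : e (u - v) = 0 by rewrite rmorphB /= uv subrr.
move: (u - v) => {uv}{}u eu; have [D [q uE]] := usl2_normal_form u.
rewrite uE big1 // => t _; suff -> : q t = 0 by rewrite usl2_poly0 mulr0.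
pose n (t : nat) : int := t%:Z - D%:Z.
have := congr1 (fun f : E => f (- n t)) eu; rewrite uE rmorph_sum lcoef_sum.
rewrite (bigD1 t) //= big1 ?addr0; last first.
  move=> t' tt'; rewrite (ser_eval_monoid iota).2 ser_usl2_poly; have [w w0 ->] := ser_weight (n t').
  rewrite lmonoM addr0 /= ifF //; apply: contra_neqF tt' => /eqP h.
  by apply/val_inj; move: h; rewrite /n /=; lia.
rewrite (ser_eval_monoid iota).2 ser_usl2_poly; have [w w0 ->] := ser_weight (n t).
rewrite lmonoM addr0 /= eqxx => /eqP; rewrite mulf_eq0 (negPf w0) fmorph_eq0.
by rewrite fraction_emb_eq0 => /eqP.
Qed.

Lemma ser_coef u n : exists p, e u n = emb p.
Proof.
elim/usl2_ind: u n; have emb0 : exists p, 0 = emb p by exists 0; rewrite rmorph0.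
have mono_emb q m n : exists p, lmono S (emb q) m n = emb p.
  by rewrite /=; case: ifP => // _; exists q.
have mono_emb1 m n : exists p, lmono S 1 m n = emb p.
  by rewrite -(rmorph1 emb); exact: mono_emb.
elim=> [n|n|n|k n|t IHt t' IHt' n|t IHt t' IHt' n].
- by rewrite ser_evalX; exact: mono_emb1.
- by rewrite ser_evalY; exact: mono_emb.
- by rewrite ser_evalH; exact: mono_emb.
- by rewrite usl2_classC ser_scalar; exact: mono_emb.
- rewrite usl2_classD rmorphD lcoefD; have [p ->] := IHt n; have [p' ->] := IHt' n.
  by exists (p + p'); rewrite rmorphD.
rewrite usl2_classM rmorphM lcoefM /laurent_conv.
have [N fN] := coef_low (e (usl2_class t)); have [M gM] := coef_low (e (usl2_class t')).
rewrite (fsumE (laurent_conv_supported S (n := n) fN gM)).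
elim/big_rec: _ => // i x _ [p ->]; have [p1 ->] := IHt i; have [p2 ->] := IHt' (n - i).
by exists (p1 * poly_shift K i p2 + p); rewrite rmorphD rmorphM fraction_emb_tau.
Qed.

End SeriesOfUsl2.

(** * The division ring of fractions *)

Section OreExtension.
Variables (K : fieldType) (U : algType K) (Q : unitAlgType K) (j : {lrmorphism U -> Q}).
Hypothesis jQ : division_ring_of_fractions j.
Variables (E : unitRingType) (f : {rmorphism U -> E}).
Hypothesis Ediv : forall x : E, x != 0 -> x \is a GRing.unit.
Hypothesis f_inj : injective f.
Implicit Types (s t a b p r u : U) (q : Q) (x y : E).

(** By the Ore condition, [j s q = j a] determines the value of an extension at [q]. *)
Lemma fraction_ring_extend : exists F : {rmorphism Q -> E}, forall u, F (j u) = f u.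
Proof.
have [j_inj Qdiv Qleft Qright] := jQ.
have f0 s : s != 0 -> f s \is a GRing.unit.
  by move=> s0; apply: Ediv; rewrite -(rmorph0 f) (inj_eq f_inj).
have j0 s : s != 0 -> j s \is a GRing.unit.
  by move=> s0; apply: Qdiv; rewrite -(rmorph0 j) (inj_eq j_inj).
(* [q = (j s)^-1 (j a)] iff [j s * q = j a] *)
have Ql q : exists s a, s != 0 /\ j s * q = j a.
  have [a [s [s0 ->]]] := Qleft q; exists s, a; split=> //.
  by rewrite mulVKr // j0.
(* the left Ore condition in [U] *)
have ore s t : s != 0 -> t != 0 -> exists p r, [/\ p != 0, p * s != 0 & p * s = r * t].
  move=> s0 t0; have [p [r [p0 pr]]] := Ql (j s / j t).
  exists p, r; split=> //; last first.
    apply: j_inj; rewrite !rmorphM; apply: (mulIr (x := (j t)^-1)).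
      by rewrite unitrV j0.
    by rewrite -mulrA pr mulrK // j0.
  apply/eqP => ps; have : j p * j s \is a GRing.unit by rewrite unitrMl ?j0.
  by rewrite -rmorphM /= ps rmorph0 unitr0.
pose rel q x := exists s a, [/\ s != 0, j s * q = j a & f s * x = f a].
have rel_fun q x y : rel q x -> rel q y -> x = y.
  move=> [s [a [s0 sq sx]]] [t [b [t0 tq ty]]].
  have [p [r [p0 ps0 psE]]] := ore s t s0 t0.
  have pa : p * a = r * b.
    by apply: j_inj; rewrite !rmorphM /= -sq -tq !mulrA -!rmorphM /= psE.
  apply: (mulrI (f0 _ ps0)); rewrite rmorphM -mulrA sx -rmorphM pa rmorphM -ty.
  by rewrite mulrA -rmorphM -psE rmorphM.
have rel_ex q : exists x, rel q x.
  have [s [a [s0 sq]]] := Ql q; exists ((f s)^-1 * f a), s, a; split=> //.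
  by rewrite mulVKr // f0.
have /(_ _)/cid-/all_tag[F FP] := rel_ex.
have relB q x q' x' : rel q x -> rel q' x' -> rel (q - q') (x - x').
  move=> [s [a [s0 sq sx]]] [t [b [t0 tq ty]]].
  have [p [r [p0 ps0 psE]]] := ore s t s0 t0.
  exists (p * s), (p * a - r * b); split=> //.
    by rewrite mulrBr rmorphB !rmorphM /= -sq -tq !mulrA -!rmorphM /= psE.
  by rewrite mulrBr rmorphB !rmorphM -sx -ty !mulrA -!rmorphM psE.
have relM q x q' x' : rel q x -> rel q' x' -> rel (q * q') (x * x').
  move=> [s [a [s0 sq sx]]] [t [b [t0 tq ty]]].
  have [p [r [p0 pr]]] := Ql (j a / j t).
  have rE : p * a = r * t.
    apply: j_inj; rewrite !rmorphM; apply: (mulIr (x := (j t)^-1)).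
      by rewrite unitrV j0.
    by rewrite -mulrA pr mulrK // j0.
  have ps0 : p * s != 0.
    apply/eqP => ps; have : j p * j s \is a GRing.unit by rewrite unitrMl ?j0.
    by rewrite -rmorphM /= ps rmorph0 unitr0.
  exists (p * s), (r * b); split=> //.
    by rewrite !rmorphM /= -mulrA [j s * _]mulrA sq mulrA -rmorphM /= rE rmorphM /= -mulrA tq.
  by rewrite !rmorphM -mulrA [f s * _]mulrA sx mulrA -rmorphM rE rmorphM -mulrA ty.
have relj u : rel (j u) (f u) by exists 1, u; rewrite oner_neq0 !rmorph1 !mul1r.
have FB : zmod_morphism F by move=> q q'; exact: rel_fun (FP _) (relB _ _ _ _ (FP q) (FP q')).
have FM : monoid_morphism F.
  split; last by move=> q q'; exact: rel_fun (FP _) (relM _ _ _ _ (FP q) (FP q')).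
  by apply: rel_fun (FP _) _; rewrite -(rmorph1 j) -(rmorph1 f); exact: relj.
pose G : {rmorphism Q -> E} :=
  HB.pack F (GRing.isZmodMorphism.Build _ _ F FB) (GRing.isMonoidMorphism.Build _ _ F FM).
by exists G => u; exact: rel_fun (FP _) (relj u).
Qed.

End OreExtension.

Section FractionsOfUsl2.
Variables (K : fieldType) (L : closedFieldType) (iota : {rmorphism K -> L}).
Hypothesis K0 : [pchar K] =i pred0.
Variables (Q : unitAlgType K) (j : {lrmorphism Usl2 K -> Q}).
Hypothesis jQ : division_ring_of_fractions j.
Local Notation U := (Usl2 K).
Local Notation X := (usl2X K).
Local Notation Y := (usl2Y K).
Local Notation H := (usl2H K).
Local Notation C := (casimir K).
Local Notation S := (H_shift L).
Local Notation E := (laurent S).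
Local Notation emb := (fraction_emb iota).
Local Notation e := (ser_eval iota).
Implicit Types (u : U) (q : Q) (x : E).

Lemma closure_char0 : [pchar L] =i pred0.
Proof. by move=> i; rewrite (fmorph_pchar iota) K0. Qed.

Let L0 := closure_char0.

Lemma ser_centralizers (a : E) : ~ alg_center E a ->
  forall b c, a * b = b * a -> a * c = c * a -> b * c = c * b.
Proof. exact: laurent_centralizers (H_shift_fix L0) a. Qed.

Lemma jQ_unit q : q != 0 -> q \is a GRing.unit.
Proof. by case: jQ => _ + _ _; apply. Qed.

Lemma j_inj : injective j.
Proof. by case: jQ. Qed.

Lemma j_neq0 u : u != 0 -> j u != 0.
Proof. by rewrite -(rmorph0 j) (inj_eq j_inj). Qed.

Lemma fractions_right q : exists a s, s != 0 /\ q * j s = j a.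
Proof.
have [_ _ _ /(_ q)[a [s [s0 ->]]]] := jQ; exists a, s; split=> //.
by rewrite mulrVK // jQ_unit // j_neq0.
Qed.

Definition frac_ser : {rmorphism Q -> E} := projT1 (cid
  (fraction_ring_extend jQ (f := e) (@laurent_unit _ _ S) (@ser_eval_inj _ _ iota))).

Lemma frac_serE u : frac_ser (j u) = e u.
Proof. by rewrite /frac_ser; case: cid => F /= ->. Qed.

Lemma frac_ser_inj : injective frac_ser.
Proof.
move=> p q pq; apply/eqP; rewrite -subr_eq0; apply: contraT => /jQ_unit pq0.
have := rmorph_unit frac_ser pq0; by rewrite rmorphB pq subrr unitr0.
Qed.

Lemma frac_serZ k q : frac_ser (k *: q) = iota k *: frac_ser q.
Proof.
rewrite -mulr_algl rmorphM -(rmorph1 j) -linearZ frac_serE ser_evalZ rmorph1.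
by rewrite mulr_algl.
Qed.

Lemma usl2_noncommutative : noncommutative U.
Proof.
move=> UC; have := usl2_HX K; rewrite UC subrr => /esym X0.
have := ser_evalX iota; rewrite X0 rmorph0 => /(congr1 (fun x : E => x (-1))) /eqP.
by rewrite /= eq_sym oner_eq0.
Qed.

Lemma ser_const_central (p : {poly K}) : alg_center E (lmono S (emb p%:P) 0).
Proof. by apply: lmono_central; exact: tau_const. Qed.

Lemma casimir_fractions_ser q : casimir_fractions j q -> exists p r : {poly K},
  r != 0 /\ frac_ser q * lmono S (emb r%:P) 0 = lmono S (emb p%:P) 0.
Proof.
move=> [p [r [r0 ->]]]; exists p, r; split.
  by apply: contraNneq r0 => ->; rewrite rmorph0.
rewrite -!ser_horner_casimir -!frac_serE -rmorphM mulrVK //.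
exact/jQ_unit/j_neq0.
Qed.

Lemma lmono_neq0 (f : {fraction {poly {poly L}}}) n : f != 0 -> lmono S f n != 0.
Proof.
apply: contraNneq => fn0; have := congr1 (fun x : E => x n) fn0.
by rewrite /= eqxx => ->.
Qed.

Lemma casimir_fractions_central q : casimir_fractions j q -> alg_center E (frac_ser q).
Proof.
move=> /casimir_fractions_ser[p [r [r0 qr]]] x.
have ur : lmono S (emb r%:P) 0 \is a GRing.unit.
  by apply/laurent_unit/lmono_neq0; rewrite fraction_emb_eq0 polyC_eq0.
apply: (mulIr ur); rewrite -[LHS]mulrA -(ser_const_central r x) mulrA qr.
by rewrite -[RHS]mulrA qr; exact: ser_const_central.
Qed.

(** A central [q] commutes with [H], so its series is a single coefficient, and with
    [X], so this coefficient is fixed by the shift; as a fraction of elements of [U] it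
    is a quotient of polynomials over [K]. *)
Lemma frac_center : alg_center Q = casimir_fractions j.
Proof.
apply/seteqP; split=> q; last first.
  move=> /casimir_fractions_central qC q'; apply: frac_ser_inj.
  by rewrite !rmorphM.
move=> qC; set x := frac_ser q.
have xC u : x * e u = e u * x by rewrite -frac_serE -!rmorphM qC.
have x0 n : n != 0 -> x n = 0.
  move=> n0; have : (x * e H) n = (e H * x) n by rewrite xC.
  rewrite ser_evalH coef_mul_lmono coef_lmono_mul subr0 shift_tau0 tauX.
  have c0 : emb (n%:~R)%:P != 0.
    rewrite fraction_emb_eq0 polyC_eq0; apply/eqP => nK; move/eqP: n0; apply.
    apply: (@intr_inj_pchar0 {poly K}); last by rewrite nK.
    by move=> i; rewrite pchar_poly K0.
  rewrite rmorphD mulrDr [emb 'X * _]mulrC => /eqP.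
  by rewrite -subr_eq0 addrAC subrr add0r mulf_eq0 (negPf c0) orbF => /eqP.
have xE : x = lmono S (x 0) 0.
  by apply: laurentP => n /=; case: eqP => [->//|/eqP/x0].
have xfix : shift_tau S (-1) (x 0) = x 0.
  have : (x * e X) (-1) = (e X * x) (-1) by rewrite xC.
  by rewrite ser_evalX coef_mul_lmono coef_lmono_mul subrr rmorph1 mulr1 mul1r.
have [a [s [s0 qs]]] := fractions_right q.
have es : x * e s = e a by rewrite -!frac_serE -rmorphM qs.
have [n sn] : exists n, e s n != 0.
  apply: contrapT => /forallNP none; move/eqP: s0; apply; apply: (@ser_eval_inj _ _ iota).
  rewrite rmorph0; apply: laurentP => n; apply/eqP/negPn/negP; exact: none.
have [r rE] := ser_coef iota s n; have [p pE] := ser_coef iota a n.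
have r0 : r != 0 by rewrite -(fraction_emb_eq0 iota) -rE.
have xr : x 0 * emb r = emb p.
  by rewrite -rE -pE -es [in RHS]xE coef_lmono_mul subr0 shift_tau0.
have [//|p0 [r0' [r0'0 xr0]]] := fixed_fraction L0 (n := -1) _ xfix r0 xr.
exists p0, r0'; have hr0 : horner_alg C r0' != 0.
  apply: contraNneq r0'0 => h; have := ser_horner_casimir iota r0'; rewrite h rmorph0.
  move/esym/eqP; apply: contraTT => r00; apply: lmono_neq0.
  by rewrite fraction_emb_eq0 polyC_eq0.
split=> //; apply: frac_ser_inj; have uj := jQ_unit (j_neq0 hr0).
apply: (mulIr (x := frac_ser (j (horner_alg C r0')))); first exact: rmorph_unit.
rewrite -!rmorphM mulrVK // rmorphM !frac_serE !ser_horner_casimir.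
by rewrite -/x xE lmonoM shift_tau0 addr0 xr0.
Qed.

End FractionsOfUsl2.

(** * Subalgebras of the division ring of fractions *)

Section SubalgebrasOfFractions.
Variables (K : fieldType) (L : closedFieldType) (iota : {rmorphism K -> L}).
Hypothesis K0 : [pchar K] =i pred0.
Hypothesis Lalg : algebraic_closure iota.
Variables (Q : unitAlgType K) (j : {lrmorphism Usl2 K -> Q}).
Hypothesis jQ : division_ring_of_fractions j.
Local Notation C := (casimir K).
Local Notation S := (H_shift L).
Local Notation E := (laurent S).
Local Notation emb := (fraction_emb iota).
Local Notation e := (ser_eval iota).
Local Notation f := (frac_ser iota jQ).

Let L0 : [pchar L] =i pred0 := closure_char0 iota K0.

(** Scalars of [L] that are fractions of elements of [U] lie in [K]: compare
    coefficients in [K[C][H]]. *)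
Lemma frac_ser_scalar q (c : L) : f q = c%:A -> exists k, q = k%:A.
Proof.
move=> qc; have [a [s [s0 qs]]] := fractions_right jQ q.
have es : c *: e s = e a.
  by rewrite -mulr_algl -qc -!(frac_serE iota jQ) -rmorphM qs.
have [n sn] : exists n, e s n != 0.
  apply: contrapT => /forallNP none; move/eqP: s0; apply; apply: (@ser_eval_inj _ _ iota).
  rewrite rmorph0; apply: laurentP => n; apply/eqP/negPn/negP; exact: none.
have [r rE] := ser_coef iota s n; have [p pE] := ser_coef iota a n.
have r0 : r != 0 by rewrite -(fraction_emb_eq0 iota) -rE.
have cr : c%:P%:P * map_poly (map_poly iota) r = map_poly (map_poly iota) p.
  apply/eqP; rewrite -tofrac_eq; apply/eqP.
  by rewrite rmorphM -[RHS]pE -es lcoefZ rE.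
have [i ri] : exists i, r`_i != 0.
  by exists (size r).-1; rewrite -lead_coefE lead_coef_eq0.
have [l rl] : exists l, r`_i`_l != 0.
  by exists (size r`_i).-1; rewrite -lead_coefE lead_coef_eq0.
have cE : c * iota r`_i`_l = iota p`_i`_l.
  have := congr1 (fun q : {poly {poly L}} => q`_i`_l) cr.
  by rewrite coefCM coefCM !coef_map.
exists (p`_i`_l / r`_i`_l); apply: (frac_ser_inj (iota := iota) (jQ := jQ)).
rewrite qc frac_serZ rmorph1 fmorph_div -cE mulfK // fmorph_eq0 //.
Qed.

(** [L] is algebraically closed, so an algebraic element of [E] that is a fraction in [C]
    is a scalar of [L], hence of [K]. *)
Lemma frac_ser_power_free q : casimir_fractions j q -> (forall k, q <> k%:A) ->
  power_free (f q).
Proof.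
move=> qC qN n c sum0 i0.
pose P := \sum_(i < n) c i *: 'X^i.
have hZ k p : horner_alg (f q) (k *: p) = k *: horner_alg (f q) p.
  by rewrite -mul_polyC rmorphM /= horner_algC mulr_algl.
have PE : horner_alg (f q) P = \sum_i c i *: f q ^+ i.
  rewrite rmorph_sum; apply: eq_bigr => i _.
  by rewrite [LHS]hZ rmorphXn /= horner_algX.
have Pi : P`_i0 = c i0.
  rewrite coef_sum (bigD1 i0) //= coefZ coefXn eqxx mulr1 big1 ?addr0 // => i ii0.
  by rewrite coefZ coefXn (inj_eq val_inj) eq_sym (negPf ii0) mulr0.
rewrite -Pi; suff -> : P = 0 by rewrite coef0.
apply: contrapT => /eqP P0; have [rs PrE] := closed_field_poly_normal P.
have : horner_alg (f q) (\prod_(z <- rs) ('X - z%:P)) = 0.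
  have lc : lead_coef P != 0 by rewrite lead_coef_eq0.
  apply: (scalerI lc); rewrite scaler0 -hZ -PrE.
  by rewrite PE.
elim: rs {PrE} => [|z rs IHrs].
  by rewrite big_nil rmorph1 => /eqP; rewrite oner_eq0.
rewrite big_cons rmorphM => prod0.
have [xz|xz] := eqVneq (horner_alg (f q) ('X - z%:P)) 0.
  have [k qk] : exists k, q = k%:A; last exact: (qN k).
  apply: (frac_ser_scalar (c := z)); apply/eqP; rewrite -subr_eq0 -xz.
  by rewrite rmorphB /= horner_algX horner_algC.
apply: IHrs; apply: (mulrI (laurent_unit xz)).
by rewrite mulr0.
Qed.

Variables (A : algType K) (v : {lrmorphism A -> Q}).
Hypothesis v_inj : injective v.
Hypothesis A_noncomm : noncommutative A.

Lemma subalgebra_commutative_centralizers : commutative_centralizers A.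
Proof.
apply: (@commutative_centralizers_e _ _ A E (f \o v)) => //.
  exact: ser_centralizers K0.
by apply: inj_comp => //; exact: frac_ser_inj.
Qed.

Hypothesis slow : slow_growth A.

Lemma subalgebra_homogeneous c0 : casimir_fractions j (v c0) ->
  (forall k, v c0 <> k%:A) ->
  [/\ dixmier_partition iota A, homogeneous_centralizers iota A &
      commutative_centralizers A].
Proof.
move=> cC cN.
have Ediv (x : E) : x != 0 -> x \is a GRing.unit by exact: laurent_unit.
have Ecomm := @ser_centralizers _ _ iota K0.
have inj : injective (f \o v) by apply: inj_comp => //; exact: frac_ser_inj.
have eZ k a : (f \o v) (k *: a) = iota k *: (f \o v) a.
  by rewrite /= linearZ frac_serZ.
have c0_central : alg_center E ((f \o v) c0) by exact: casimir_fractions_central.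
have c0_free : power_free ((f \o v) c0) by exact: frac_ser_power_free.
have rational a b k d : ~ alg_center A a -> alg_center E d ->
    (f \o v) b = k *: (f \o v) a + d -> exists k', k = iota k'.
  move=> aN dC bE; have [x ax] : exists x, ad a x <> 0.
    apply: contrapT => /forallNP none; apply: aN => x; apply/ad_eq0.
    by apply: contrapT; exact: none.
  have vax : v (ad a x) \is a GRing.unit.
    by apply: (jQ_unit jQ); rewrite -(rmorph0 v) (inj_eq v_inj); apply/eqP.
  have bx : f (v (ad b x)) = k *: f (v (ad a x)).
    have eE y : f (v (ad y x)) = ad (f (v y)) (f (v x)) by rewrite /ad !rmorphB !rmorphM.
    rewrite !eE; move: bE => /= ->; rewrite -ad_scale /ad mulrDl mulrDr opprD addrACA.
    by rewrite (dC (f (v x))) subrr addr0.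
  have [k' k'E] : exists k', v (ad b x) / v (ad a x) = k'%:A.
    apply: (frac_ser_scalar (c := k)); apply: (mulIr (rmorph_unit f vax)).
    by rewrite -rmorphM divrK // bx mulr_algl.
  exists k'; have := congr1 f k'E; rewrite frac_serZ rmorph1 => h.
  have : k%:A = (iota k')%:A :> E.
    rewrite -h; apply: (mulIr (rmorph_unit f vax)).
    by rewrite -rmorphM divrK // bx mulr_algl.
  move/eqP; rewrite -subr_eq0 -scalerBl scaler_eq0 oner_eq0 orbF subr_eq0.
  by move/eqP.
split; last exact: subalgebra_commutative_centralizers.
  exact: (@abstract_dixmier_partition _ _ _ _ _ (f \o v) Lalg L0 Ediv inj eZ slow c0).
exact: (@abstract_homogeneous _ _ _ _ _ (f \o v) Lalg L0 Ediv Ecomm inj A_noncomm eZ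
  slow c0 c0_central c0_free rational).
Qed.

End SubalgebrasOfFractions.

Theorem proposition6p1 (R : realType) (K : fieldType)
    (char0 : [pchar K] =i pred0)
    (Kbar : closedFieldType) (iota : {rmorphism K -> Kbar})
    (Kbar_closure : algebraic_closure iota)
    (Q : unitAlgType K) (j : {lrmorphism Usl2 K -> Q})
    (Q_fractions : division_ring_of_fractions j) :
  [/\ commutative_centralizers (Usl2 K),
      commutative_centralizers Q &
      alg_center Q = casimir_fractions j] /\
  ([/\ dixmier_partition iota (Usl2 K),
       homogeneous_centralizers iota (Usl2 K) &
       commutative_centralizers (Usl2 K)] /\
   forall A : subalgClosed Q,
     noncommutative (subalg A) ->
     (GKdim R (subalg A) < 4%:R%:E)%E ->
     [set q : Q | q \in A] `&` casimir_fractions j <> [set k%:A | k in [set: K]] ->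
     [/\ dixmier_partition iota (subalg A),
         homogeneous_centralizers iota (subalg A) &
         commutative_centralizers (subalg A)]).
Proof.
have UN := usl2_noncommutative iota.
have j_inj := j_inj Q_fractions.
have QN : noncommutative Q.
  by move=> QC; apply: UN => x y; apply: j_inj; rewrite !rmorphM; exact: QC.
have CN k : j (casimir K) <> k%:A.
  rewrite -(rmorph1 j) -linearZ => /j_inj CE.
  have := ser_casimir iota; rewrite CE ser_scalar => /(congr1 (fun x : laurent _ => x 0)).
  rewrite /= => /fraction_emb_inj/polyC_inj/(congr1 (fun p : {poly K} => p`_1)) /eqP.
  by rewrite coefC coefX /= eq_sym oner_eq0.
have CC : casimir_fractions j (j (casimir K)).
  exists 'X, 1; rewrite rmorph1 oner_neq0; split=> //.
  by rewrite horner_algX rmorph1 divr1.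
split.
  split.
  - exact: (@subalgebra_commutative_centralizers _ _ iota char0 _ _ Q_fractions _ j j_inj UN).
  - exact: (@subalgebra_commutative_centralizers _ _ iota char0 _ _ Q_fractions Q idfun).
  - exact: (frac_center iota char0 Q_fractions).
split.
  exact: (subalgebra_homogeneous char0 Kbar_closure Q_fractions j_inj UN
    (@usl2_slow_growth K) CC CN).
move=> A AN /slow_growth_GKdim slow AC.
have valB : zmod_morphism (@subalg_val K Q A) by [].
have valM : monoid_morphism (@subalg_val K Q A) by [].
have valZ : scalable (@subalg_val K Q A) by [].
pose v : {lrmorphism subalg A -> Q} := HB.pack (@subalg_val K Q A)
  (GRing.isZmodMorphism.Build _ _ _ valB) (GRing.isMonoidMorphism.Build _ _ _ valM)
  (GRing.isScalable.Build _ _ _ _ _ valZ).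
have v_inj : injective v by exact: val_inj.
have [q [[qA qC] qN]] : exists q, ([set q : Q | q \in A] `&` casimir_fractions j) q /\
    forall k, q <> k%:A.
  apply: contrapT => /forallNP none; apply: AC; apply/seteqP; split=> q.
    move=> qAC; have /not_andP[//|/existsNP[k /contrapT ->]] := none q.
    by exists k.
  move=> [k _ <-]; split; first by rewrite /= rpredZ // rpred1.
  exists k%:P, 1; rewrite rmorph1 oner_neq0; split=> //.
  by rewrite horner_algC linearZ /= !rmorph1 divr1.
exact: (subalgebra_homogeneous char0 Kbar_closure Q_fractions v_inj AN slow
  (c0 := Subalg qA) qC qN).
Qed.
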